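(* Let $(\phi_{1,n})_{n=1}^{\infty}$ and $(\phi_{2,n})_{n=1}^{\infty}$ be sequences of holomorphic self-maps of $\mathbb{D}$ and assume that $\phi_{1,n}(0)\to a$ and $\phi_{2,n}(0)\to b$, where $a,b\in\mathbb{T}$. The following assertions are equivalent. (1) The sequences $(C_{\phi_{1,n}})_n$, $(C_{\phi_{2,n}})_n$ admit a disjointly $\mathcal{B}$-universal function. (2) The sequences $(C_{\phi_{1,n}})_n$, $(C_{\phi_{2,n}})_n$ admit a disjointly $\mathcal{B}$-universal Blaschke product. (3) There is a subsequence $(n_k)$ such that $$\lim_{k\to\infty}\frac{|\phi_{1,n_k}'(0)|}{1-|\phi_{1,n_k}(0)|^2}=\lim_{k\to\infty}\frac{|\phi_{2,n_k}'(0)|}{1-|\phi_{2,n_k}(0)|^2}=1$$ and $$\rho(\phi_{1,n_k}(0),\phi_{2,n_k}(0))\to 1\quad\text{as }k\to\infty.$$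
   Context: $\mathbb{D}=\{z\in\mathbb{C}:|z|<1\}$ and $\mathbb{T}=\{z\in\mathbb{C}:|z|=1\}$. $\mathcal{B}=\{f\in H(\mathbb{D}):\sup_{z\in\mathbb{D}}|f(z)|\le 1\}$ is the closed unit ball of $H^\infty(\mathbb{D})$, endowed with the topology of uniform convergence on compact subsets of $\mathbb{D}$. For $\phi:\mathbb{D}\to\mathbb{D}$ holomorphic, $C_\phi(f)=f\circ\phi$ is the composition operator, which maps $\mathcal{B}$ into itself. A function $f\in\mathcal{B}$ is disjointly $\mathcal{B}$-universal for $(C_{\phi_{1,n}})_n,(C_{\phi_{2,n}})_n$ if $\{(f\circ\phi_{1,n},f\circ\phi_{2,n}):n\in\mathbb{N}\}$ is dense in $\mathcal{B}\times\mathcal{B}$ with the product topology. For $z,w\in\mathbb{D}$ the pseudo-hyperbolic distance is $\rho(z,w)=\left|\frac{z-w}{1-\overline{z}w}\right|$. *)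

(* Defs.v *)
From HB Require Import structures.
From mathcomp Require Import all_boot all_order all_algebra.
From mathcomp Require Import all_classical all_reals all_analysis.
From mathcomp Require Export complex.

Set Implicit Arguments.
Unset Strict Implicit.
Unset Printing Implicit Defensive.

Import Order.TTheory GRing.Theory Num.Theory.
Import numFieldNormedType.Exports.

Local Open Scope classical_set_scope.
Local Open Scope ring_scope.

(* The complex numbers are R[i] for R : realType. Their norm `|z| is itself
   R[i]-valued, and the order of R[i] is total only on the real axis; all the
   inequalities below are between real elements. *)
Definition unit_disc (R : realType) : set R[i] := [set z | `|z| < 1].

Definition unit_circle (R : realType) : set R[i] := [set z | `|z| = 1].

(* Functions on the disc are represented by total functions on R[i], whose
   values outside the disc are irrelevant. As the disc is open, derivability
   at its points, here over the field R[i], only depends on the restriction. *)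
Definition holomorphic_on_disc (R : realType) (f : R[i] -> R[i]) : Prop :=
  forall z : R[i], unit_disc z -> derivable (f : R[i]^o -> R[i]^o) z 1.

Definition holomorphic_self_map (R : realType) (phi : R[i] -> R[i]) : Prop :=
  holomorphic_on_disc phi /\
  forall z : R[i], unit_disc z -> unit_disc (phi z).

Definition cderive (R : realType) (f : R[i] -> R[i]) (z : R[i]) : R[i] :=
  derive1 (f : R[i]^o -> R[i]^o) z.

Definition compact_in_disc (R : realType) (K : set R[i]^o) : Prop :=
  compact K /\ K `<=` @unit_disc R.

(* The library equips this type with the topology of uniform convergence on
   the members of the family, and its pairs with the product topology. *)
Definition disc_fun (R : realType) : Type :=
  {family @compact_in_disc R, R[i]^o -> R[i]^o}.

Definition Hinfty_ball (R : realType) : set (disc_fun R) :=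
  [set f | holomorphic_on_disc f /\
           forall z : R[i], unit_disc z -> `|f z| <= 1].

Definition composition_operator (R : realType) (phi : R[i] -> R[i])
  (f : disc_fun R) : disc_fun R := f \o phi.

(* As the closure of S in the subspace A is the trace on A of its closure in
   the whole space, this is density of S in the subspace A. *)
Definition dense_in (T : topologicalType) (A S : set T) : Prop :=
  S `<=` A /\ A `<=` closure S.

Definition disjointly_universal (R : realType)
  (phi1 phi2 : nat -> R[i] -> R[i]) (f : disc_fun R) : Prop :=
  Hinfty_ball f /\
  dense_in (@Hinfty_ball R `*` @Hinfty_ball R)
    (range (fun n : nat => (composition_operator (phi1 n) f,
                            composition_operator (phi2 n) f))).

Definition pseudo_hyperbolic (R : realType) (z w : R[i]) : R[i] :=
  `| (z - w) / (1 - z^* * w) |.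

Definition blaschke_factor (R : realType) (a z : R[i]) : R[i] :=
  `|a| / a * ((a - z) / (1 - a^* * z)).

(* Zeros are repeated according to multiplicity; those at the origin are
   accounted for by the power z ^+ m. *)
Definition finite_blaschke_product (R : realType) (f : R[i] -> R[i]) : Prop :=
  exists (c : R[i]) (m : nat) (a : seq R[i]),
    [/\ unit_circle c,
        (forall x : R[i], x \in a -> unit_disc x /\ x != 0)
      & forall z : R[i], unit_disc z ->
          f z = c * z ^+ m * \prod_(x <- a) blaschke_factor x z].

Definition infinite_blaschke_product (R : realType) (f : R[i] -> R[i]) :
  Prop :=
  exists (c : R[i]) (m : nat) (a : nat -> R[i]),
    [/\ unit_circle c,
        (forall k : nat, unit_disc (a k) /\ a k != 0),
        cvgn (series (fun k : nat => 1 - `|a k| : R[i]^o))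
      & forall z : R[i], unit_disc z ->
          (fun n : nat =>
             c * z ^+ m * \prod_(0 <= k < n) blaschke_factor (a k) z)
            @ \oo --> (f z : R[i]^o)].

Definition blaschke_product (R : realType) (f : R[i] -> R[i]) : Prop :=
  finite_blaschke_product f \/ infinite_blaschke_product f.

(* Main.v *)
Require Import Defs.
From mathcomp Require Import all_boot all_order all_algebra.
From mathcomp Require Import all_classical all_reals all_analysis.
From mathcomp Require Import complex.
From mathcomp Require Import ring lra.

(** Condition (3) says that along a subsequence the self-maps are almost
    automorphisms of the disc, and that those of the two sequences move 0 to
    points that are hyperbolically far apart.

    From (1) to (3).  Let f be universal and approximate the identity along
    phi1 n and, along the same n, an automorphism sending 0 to a number t
    close to 1.  By the Schwarz-Pick inequality f does not increase the
    pseudo-hyperbolic distance.  As the compositions almost preserve the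
    distance of 0 and 1/2, so do phi1 n and phi2 n, and their hyperbolic
    derivatives at 0 are close to 1; as f sends phi1 n 0 and phi2 n 0 close
    to 0 and t, the distance of these two points is almost at least t
    ([distortion_lower_bound], [rho_lower_bound], [extremal_indices]).

    From (3) to (2).  The zeros of a universal Blaschke product are chosen
    in finite batches.  Suppose that a finite product F has been built and
    that two targets G1, G2 are given.  Near a and b the product F is almost
    a unimodular constant, and far along the subsequence phi1 n is almost
    z |-> mob (phi1 n 0) (w1 * z) with w1 unimodular; similarly for phi2.
    Caratheodory's theorem provides finite Blaschke products H1 and H2 that
    approximate the targets corrected by these constants, and the new factor
    is the product of H1 and H2 transported by automorphisms to phi1 n 0 and
    phi2 n 0.  In a hyperbolic neighbourhood of phi1 n 0 the second factor
    must be close to 1 and conversely.  Since the two points are far apart,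
    this is a condition on the values of H1 and H2 at one boundary point; a
    second one fixes the rotation of the new factor ([caratheodory],
    [stage]).  The new zeros are close to the circle, so their defect, the
    sum of the 1 - |x|, is as small as desired.  A function of the Schur
    class is determined up to any precision on smaller discs by finitely many
    integers ([code_close]), so countably many pairs of targets suffice.
    They are treated one after the other, the defect of later zeros being so
    small that earlier approximations survive in the infinite product
    ([universal_blaschke]).  Finally (2) trivially implies (1).

    The complex analysis behind this is built on Goursat's bisection for
    midpoint sums along the sides of parallelograms ([goursat]).  Applied to
    h o exp, it bounds the value of h at the centre of a circle by its values
    on the circle, for h merely continuous at the centre ([center_bound]).
    For difference quotients this is Cauchy's estimate; the removability of
    the singularity of f z / z ([hol_div]) and the Schwarz lemma follow, and
    with them the Schwarz-Pick inequality and its quantitative maximum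
    principle ([schwarz_pick], [schur_close0]).  Caratheodory's theorem is
    obtained from the Schur algorithm, each step of which contracts the
    pseudo-hyperbolic distance on smaller discs ([schur_algorithm]). *)

Set Implicit Arguments.
Unset Strict Implicit.
Unset Printing Implicit Defensive.
Import Order.TTheory GRing.Theory Num.Theory.
Import numFieldNormedType.Exports.
Local Open Scope classical_set_scope.
Local Open Scope ring_scope.

Local Notation "x %:C" := (real_complex _ x) : ring_scope.

(** * Real-valued modulus of complex numbers *)

Section Modulus.
Variable R : realType.
Implicit Types (z w : R[i]) (x y : R).

(** The norm of [R[i]] takes values in [R[i]], where the order is partial;
    estimates are made with this version in [R], where the order is total and
    suprema exist. *)
Definition cm z : R := complex.Re `|z|.

Lemma cmE z : `|z| = (cm z)%:C.
Proof. by rewrite /cm normc_def. Qed.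

Lemma cm_real x : cm x%:C = `|x|.
Proof. by rewrite /cm normc_def /= expr0n /= addr0 sqrtr_sqr. Qed.

Lemma cm_ge0 z : 0 <= cm z.
Proof. by rewrite -lecR -cmE normr_ge0. Qed.

Lemma cm0 : cm 0 = 0.
Proof. by rewrite (cm_real 0) normr0. Qed.

Lemma cm1 : cm 1 = 1.
Proof. by rewrite (cm_real 1) normr1. Qed.

Lemma cmM z w : cm (z * w) = cm z * cm w.
Proof. by apply: complexI; rewrite rmorphM /= -!cmE normrM. Qed.

Lemma cmN z : cm (- z) = cm z.
Proof. by rewrite /cm normrN. Qed.

Lemma cmB z w : cm (z - w) = cm (w - z).
Proof. by rewrite -cmN opprB. Qed.

Lemma cmD z w : cm (z + w) <= cm z + cm w.
Proof. by rewrite -lecR rmorphD /= -!cmE ler_normD. Qed.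

Lemma cmDB z w : cm (z - w) <= cm z + cm w.
Proof. by rewrite -[cm w]cmN cmD. Qed.

Lemma cmBD z w : cm z - cm w <= cm (z - w).
Proof. by rewrite lerBlDr -{1}[z](subrK w) cmD. Qed.

Lemma cmBDD z w : cm z - cm w <= cm (z + w).
Proof. by rewrite -[cm w]cmN -{2}[w]opprK cmBD. Qed.

Lemma cm_tri w z u : cm (z - u) <= cm (z - w) + cm (w - u).
Proof. by apply: le_trans (cmD _ _); rewrite addrA subrK. Qed.

Lemma cmV z : cm z^-1 = (cm z)^-1.
Proof. by apply: complexI; rewrite fmorphV /= -!cmE normfV. Qed.

Lemma cm_div z w : cm (z / w) = cm z / cm w.
Proof. by rewrite cmM cmV. Qed.

Lemma cmJ z : cm z^* = cm z.
Proof. by rewrite /cm norm_conjC. Qed.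

Lemma cm_eq0 z : (cm z == 0) = (z == 0).
Proof. by rewrite -[z == 0]normr_eq0 cmE -(inj_eq (@complexI R)). Qed.

Lemma cm_gt0 z : (0 < cm z) = (z != 0).
Proof. by rewrite lt_def cm_ge0 andbT cm_eq0. Qed.

Lemma cm_sqr z : (cm z ^+ 2)%:C = z * z^*.
Proof. by rewrite rmorphXn /= -cmE normCK. Qed.

Lemma conj_real x : (x%:C)^* = x%:C :> R[i].
Proof. exact: conjc_real. Qed.

Lemma cm_nat n : cm n%:R = n%:R.
Proof. by rewrite -(rmorph_nat (real_complex R)) cm_real normr_nat. Qed.

Lemma cm_prod (I : Type) (s : seq I) (F : I -> R[i]) :
  cm (\prod_(i <- s) F i) = \prod_(i <- s) cm (F i).
Proof. by apply: (big_morph cm cmM cm1). Qed.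

Lemma cm_Re z : `|complex.Re z| <= cm z.
Proof. by rewrite -lecR -cmE normc_ge_Re. Qed.

Lemma cm_Im z : `|complex.Im z| <= cm z.
Proof.
rewrite /cm normc_def /= -sqrtr_sqr ler_wsqrtr // lerDr sqr_ge0 //.
Qed.

Lemma cm_ReIm z : cm z <= `|complex.Re z| + `|complex.Im z|.
Proof.
rewrite {1}[z]complexE (le_trans (cmD _ _)) // cmM !cm_real.
suff -> : cm 'i%C = 1 by rewrite mul1r.
by rewrite /cm normc_def /= expr0n expr1n /= add0r sqrtr1.
Qed.

Lemma unit_discE z : unit_disc z <-> cm z < 1.
Proof. by rewrite /unit_disc /= cmE -(ltcR (cm z) 1). Qed.

Lemma unit_circleE z : unit_circle z <-> cm z = 1.
Proof.
rewrite /unit_circle /= cmE; split => [h|->//].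
by apply: complexI; rewrite h.
Qed.

End Modulus.

(** * Continuity and complex differentiability *)

Section Convergence.
Variable R : realType.
Local Notation C := (R[i]^o).

Lemma cvg_cmP (T : Type) (F : set_system T) (FF : Filter F) (f : T -> C) (l : C) :
  f @ F --> l <-> forall e : R, 0 < e -> \forall x \near F, cm (f x - l) < e.
Proof.
split.
  move=> /cvgrPdist_lt h e e0.
  have e0' : 0 < e%:C :> R[i] by rewrite ltcR.
  have := h _ e0'; apply: filterS => x.
  by rewrite cmE ltcR cmB.
move=> h; apply/cvgrPdist_lt => e e0.
have er : e = (complex.Re e)%:C.
  by rewrite RRe_real // realE (ltW e0).
have := h (complex.Re e); rewrite er ltcR in e0 * => /(_ e0).
apply: filterS => x.
by rewrite cmE ltcR cmB.
Qed.

Lemma near_cmP (z : C) (P : set C) :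
  (\forall w \near z, P w) <->
  exists2 d : R, 0 < d & forall w : R[i], cm (w - z) < d -> P w.
Proof.
split.
  move=> /nbhs_ballP[e /= e0 h].
  have er : e = (complex.Re e)%:C.
    by rewrite RRe_real // realE (ltW e0).
  exists (complex.Re e); first by rewrite -ltcR -er.
  move=> w hw; apply: h; rewrite /ball /= er.
  by rewrite distrC cmE ltcR.
move=> [d d0 h]; apply/nbhs_ballP; exists (d%:C) => /=; first by rewrite ltcR.
by move=> w; rewrite /ball /= distrC cmE ltcR => /h.
Qed.

Definition ccont (f : R[i] -> R[i]) (z : R[i]) :=
  forall e : R, 0 < e -> exists2 d : R, 0 < d &
     forall w, cm (w - z) < d -> cm (f w - f z) < e.

Lemma ccontE (f : R[i] -> R[i]) (z : R[i]) :
  ccont f z <-> (f : C -> C) @ (z : C) --> (f z : C).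
Proof.
have FF := nbhs_filter (z : C).
split => [h|/(cvg_cmP FF) h e /h /near_cmP //].
by apply/(cvg_cmP FF) => e /h /near_cmP.
Qed.

Lemma ccont_cst (c z : R[i]) : ccont (fun=> c) z.
Proof. by move=> e e0; exists 1 => // w _; rewrite subrr cm0. Qed.

Lemma ccont_id (z : R[i]) : ccont id z.
Proof. by move=> e e0; exists e. Qed.

Lemma ccontD f g z : ccont f z -> ccont g z -> ccont (fun w => f w + g w) z.
Proof. by move=> /ccontE cf /ccontE cg; apply/ccontE; exact: cvgD cf cg. Qed.

Lemma ccontM f g z : ccont f z -> ccont g z -> ccont (fun w => f w * g w) z.
Proof. by move=> /ccontE cf /ccontE cg; apply/ccontE; exact: cvgM cf cg. Qed.

Lemma ccontN f z : ccont f z -> ccont (fun w => - f w) z.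
Proof. by move=> /ccontE cf; apply/ccontE; exact: cvgN cf. Qed.

Lemma ccontB f g z : ccont f z -> ccont g z -> ccont (fun w => f w - g w) z.
Proof. by move=> /ccontE cf /ccontE cg; apply/ccontE; exact: cvgB cf cg. Qed.

Lemma ccontV f z : f z != 0 -> ccont f z -> ccont (fun w => (f w)^-1) z.
Proof. by move=> f0 /ccontE cf; apply/ccontE; exact: cvgV f0 cf. Qed.

Lemma ccont_comp f g z : ccont f z -> ccont g (f z) -> ccont (fun w => g (f w)) z.
Proof.
move=> cf cg e /cg[d d0 hd]; have [r r0 hr] := cf d d0.
by exists r => // w /hr /hd.
Qed.

Lemma ccont_ext f g z : (exists2 r : R, 0 < r & forall w, cm (w - z) < r -> f w = g w) ->
  ccont f z -> ccont g z.
Proof.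
move=> [r r0 fg] cf e /cf[d d0 hd]; exists (Num.min d r); first by rewrite lt_min d0.
move=> w; rewrite lt_min => /andP[wd wr].
by rewrite -!fg ?subrr ?cm0 //; exact: hd.
Qed.

(** Caratheodory's form of differentiability: the difference quotient extends
    to a function continuous at [z]. The product and chain rules become
    identities between these continuous factors. *)
Definition hasd (f : R[i] -> R[i]) (z d : R[i]) :=
  exists phi : R[i] -> R[i], [/\ ccont phi z, phi z = d &
    forall w, f w = f z + phi w * (w - z)].

Lemma derive_hasd (f : R[i] -> R[i]) (z : R[i]) :
  derivable (f : C -> C) z 1 -> hasd f z (cderive f z).
Proof.
move=> df.
have h : (fun h : C => h^-1 *: ((f : C -> C) (h + z) - f z)) @ 0^' --> (cderive f z : C).
  rewrite /cderive /derive1; move: df; rewrite /derivable.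
  set g1 := fun h => _; set g2 := fun h => _.
  by have -> : g1 = g2 by apply/funext => w; rewrite /g1 /g2 /= [w%:A]mulr1.
exists (fun w => if w == z then cderive f z else (f w - f z) / (w - z)).
split; [|by rewrite eqxx|]; last first.
  move=> w; case: eqP => [->|/eqP wz]; first by rewrite subrr mulr0 addr0.
  by rewrite divfK ?subr_eq0 // addrC subrK.
move=> e e0; rewrite eqxx.
have [d d0 hd] := (near_cmP 0 _).1 ((cvg_cmP (dnbhs_filter (0 : C)) _ _).1 h _ e0).
exists d => // w hw.
case: eqP => [_|/eqP wz]; first by rewrite subrr cm0.
have := hd (w - z); rewrite subr0 => /(_ hw).
by rewrite subr_eq0 => /(_ wz); rewrite subrK /GRing.scale /= mulrC.
Qed.

Lemma hasd_derive (f : R[i] -> R[i]) (z d : R[i]) :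
  hasd f z d -> derivable (f : C -> C) z 1 /\ cderive f z = d.
Proof.
move=> [phi [cphi <- fE]].
have h : (fun h : C => h^-1 *: ((f : C -> C) (h + z) - f z)) @ 0^' --> (phi z : C).
  apply/(cvg_cmP (dnbhs_filter (0 : C))) => e /cphi[d0 d00 hd].
  apply/near_cmP; exists d0 => // w; rewrite subr0 => wd w0.
  have -> : w^-1 *: ((f : C -> C) (w + z) - f z) = phi (w + z).
    rewrite (fE (w + z)) /GRing.scale /= [f z + _]addrC !addrK mulrC mulfK //.
  by apply: hd; rewrite addrK.
split; last exact: (cvg_lim _ h).
rewrite /derivable; move: h; set g1 := fun h => _; set g2 := fun h => _.
have -> : g2 = g1 by apply/funext => w; rewrite /g1 /g2 /= [w%:A]mulr1.
exact: cvgP.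
Qed.

Lemma hasd_uniq f z d d' : hasd f z d -> hasd f z d' -> d = d'.
Proof. by move=> /hasd_derive[_ <-] /hasd_derive[_ <-]. Qed.

Lemma hasd_ccont f z d : hasd f z d -> ccont f z.
Proof.
move=> [phi [cphi _ fE]].
have -> : f = (fun w => f z + phi w * (w - z)) by apply/funext.
apply: ccontD; first exact: ccont_cst.
by apply: ccontM cphi _; apply: ccontB (ccont_id z) (ccont_cst z z).
Qed.

Lemma hasd_cst (c z : R[i]) : hasd (fun=> c) z 0.
Proof.
exists (fun=> 0); split; [exact: ccont_cst|by []|].
by move=> w; rewrite mul0r addr0.
Qed.

Lemma hasd_id (z : R[i]) : hasd id z 1.
Proof.
exists (fun=> 1); split; [exact: ccont_cst|by []|].
by move=> w; rewrite mul1r addrC subrK.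
Qed.

Lemma hasdD f g z df dg : hasd f z df -> hasd g z dg ->
  hasd (fun w => f w + g w) z (df + dg).
Proof.
move=> [p [cp <- fE]] [q [cq <- gE]]; exists (fun w => p w + q w); split.
- exact: ccontD.
- by [].
- by move=> w; rewrite (fE w) (gE w); ring.
Qed.

Lemma hasdM f g z df dg : hasd f z df -> hasd g z dg ->
  hasd (fun w => f w * g w) z (df * g z + f z * dg).
Proof.
move=> hf hg; have cg := hasd_ccont hg.
move: hf hg => [p [cp <- fE]] [q [cq <- gE]].
exists (fun w => p w * g w + f z * q w); split; [|by []|].
- by apply: ccontD (ccontM cp cg) _; apply: ccontM cq; exact: ccont_cst.
- by move=> w; rewrite (fE w) (gE w); ring.
Qed.

Lemma hasd_comp f g z df dg : hasd f z df -> hasd g (f z) dg ->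
  hasd (fun w => g (f w)) z (dg * df).
Proof.
move=> hf; have cf := hasd_ccont hf.
move: hf => [p [cp <- fE]] [q [cq <- gE]].
exists (fun w => q (f w) * p w); split; [|by []|].
- by apply: ccontM cp; exact: ccont_comp.
- by move=> w; rewrite (gE (f w)) (fE w); ring.
Qed.

Lemma hasdV (z : R[i]) : z != 0 -> hasd (fun w => w^-1) z (- z ^- 2).
Proof.
(* Since [0^-1 = 0], the factor [z ^- 2] is forced at [w = 0]. *)
move=> z0; exists (fun w => if w == 0 then z ^- 2 else - (w * z)^-1).
split.
- apply: (@ccont_ext (fun w => - (w * z)^-1)).
    exists (cm z); first by rewrite cm_gt0.
    by move=> w; case: eqP => // ->; rewrite sub0r cmN ltxx.
  apply: ccontN; apply: ccontV; first by rewrite mulf_neq0.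
  by apply: ccontM; [exact: ccont_id|exact: ccont_cst].
- by rewrite (negbTE z0).
- move=> w; case: eqP => [->|/eqP w0]; first by rewrite invr0; field.
  by field; rewrite w0 z0.
Qed.

Lemma hasdN f z df : hasd f z df -> hasd (fun w => - f w) z (- df).
Proof.
move=> hf; have := hasdM (hasd_cst (-1) z) hf.
rewrite mul0r add0r mulN1r.
by have -> : (fun w => -1 * f w) = (fun w => - f w)
  by apply/funext => w; rewrite mulN1r.
Qed.

Lemma hasdB f g z df dg : hasd f z df -> hasd g z dg ->
  hasd (fun w => f w - g w) z (df - dg).
Proof. by move=> hf /hasdN hg; apply: hasdD. Qed.

Lemma hasd_div f g z df dg : g z != 0 -> hasd f z df -> hasd g z dg ->
  hasd (fun w => f w / g w) z ((df * g z - f z * dg) / g z ^+ 2).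
Proof.
move=> g0 hf hg; have := hasdM hf (hasd_comp hg (hasdV g0)).
by set d1 := (X in hasd _ _ X -> _); have -> : d1 = (df * g z - f z * dg) / g z ^+ 2
  by rewrite /d1; field.
Qed.

Lemma hasd_ext f g z d : (exists2 r : R, 0 < r & forall w, cm (w - z) < r -> f w = g w) ->
  hasd f z d -> hasd g z d.
Proof.
move=> [r r0 fg] [p [cp pz fE]].
have fgz : f z = g z by apply: fg; rewrite subrr cm0.
exists (fun w => if cm (w - z) < r then p w else (g w - g z) / (w - z)).
split.
- by apply: ccont_ext cp; exists r => // w ->.
- by rewrite subrr cm0 r0.
move=> w; case: ifPn => [wr|]; first by rewrite -fg // -fgz.
rewrite -leNgt => /(lt_le_trans r0); rewrite cm_gt0 => wz.
by rewrite divfK // addrC subrK.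
Qed.

Lemma hasdP f z d : hasd f z d -> forall e : R, 0 < e -> exists2 r : R, 0 < r &
  forall w, cm (w - z) < r -> cm (f w - f z - d * (w - z)) <= e * cm (w - z).
Proof.
move=> [p [cp <- fE]] e /cp[r r0 h]; exists r => // w /h hw.
rewrite (fE w) (_ : _ - _ - _ = (p w - p z) * (w - z)); last by ring.
by rewrite cmM ler_wpM2r ?cm_ge0 // ltW.
Qed.

(** In this form [center_bound] applies to difference quotients. *)
Lemma hasd_quot (f : R[i] -> R[i]) z d : hasd f z d <->
  ccont (fun h => if h == 0 then d else (f (z + h) - f z) / h) 0.
Proof.
split=> [[p [cp <- fE]] e e0|h].
  have [r r0 h] := cp e e0.
  exists r => // w /=; rewrite subr0 eqxx => wr.
  case: eqP => [_|/eqP w0] /=; first by rewrite subrr cm0.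
  rewrite (fE (z + w)) [f z + _]addrC addrK [z + w]addrC addrK mulfK //.
  by apply: h; rewrite addrK.
exists (fun w => if w == z then d else (f w - f z) / (w - z)); split.
- move=> e e0; have [r r0 {}h] := h e e0; exists r => // w wr /=; rewrite eqxx.
  have := h (w - z); rewrite subr0 eqxx subr_eq0 [z + _]addrC subrK; exact.
- by rewrite eqxx.
move=> w; case: eqP => [->|/eqP wz]; first by rewrite subrr mulr0 addr0.
by rewrite divfK ?subr_eq0 // addrC subrK.
Qed.

End Convergence.

(** * Dependent choice and bisection *)

(** The invariant [P] guarantees that the steps can go on; [Q] records what a
    step achieves. Bisections and the choice of the zeros of the universal
    function both have this shape. *)
Lemma dependent_seq (T : Type) (P : nat -> T -> Prop) (Q : nat -> T -> T -> Prop) (x0 : T) :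
  P 0%N x0 -> (forall n x, P n x -> exists2 y, Q n x y & P n.+1 y) ->
  exists s : nat -> T, s 0%N = x0 /\ forall n, P n (s n) /\ Q n (s n) (s n.+1).
Proof.
move=> P0 step.
have [F hF] : {F : nat * T -> T & forall p, P p.1 p.2 -> Q p.1 p.2 (F p) /\ P p.1.+1 (F p)}.
  apply: (choice (P := fun p y => P p.1 p.2 -> Q p.1 p.2 y /\ P p.1.+1 y)) => -[n x] /=.
  have [/step[y Qy Py]|nP] := pselect (P n x); first by exists y.
  by exists x.
pose s := fix s n := if n is m.+1 then F (m, s m) else x0.
have Ps n : P n (s n) by elim: n => [//|n IH]; have [] := hF (n, s n) IH.
by exists s; split=> // n; split=> //; have [] := hF (n, s n) (Ps n).
Qed.

Section Dyadic.
Variable R : realType.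

Lemma pow_half_small (e : R) : 0 < e -> exists k, 2^-1 ^+ k < e.
Proof.
move=> e0; exists (Num.bound e^-1).
rewrite exprVn invf_plt ?posrE ?exprn_gt0 //.
apply: lt_trans (archi_boundP _) _; first by rewrite invr_ge0 ltW.
by rewrite -natrX ltr_nat ltn_expl.
Qed.

Lemma nested_point (u : nat -> R) :
  (forall k, u k <= u k.+1 /\ u k.+1 + 2^-1 ^+ k.+1 <= u k + 2^-1 ^+ k) ->
  exists x, forall k, u k <= x <= u k + 2^-1 ^+ k.
Proof.
move=> hu.
have incr : {homo u : m n / (m <= n)%N >-> m <= n}.
  by apply: (homo_leq (fun x => lexx x) le_trans) => n; have [] := hu n.
have decr : {homo (fun k => u k + 2^-1 ^+ k) : m n / (m <= n)%N >-> n <= m}.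
  apply: (homo_leq (r := fun x y => y <= x)) => [x|y x z xy yz|n]; first exact: lexx.
    exact: le_trans yz xy.
  by have [] := hu n.
have ub k : ubound (range u) (u k + 2^-1 ^+ k).
  move=> _ [j _ <-]; case: (leqP j k) => [jk|/ltnW kj].
    by rewrite (le_trans (incr _ _ jk)) // lerDl exprn_ge0.
  by rewrite (le_trans _ (decr _ _ kj)) // lerDl exprn_ge0.
exists (sup (range u)) => k; apply/andP; split.
  by apply: ub_le_sup; [exists (u 0%N + 2^-1 ^+ 0); exact: ub|exists k].
by apply: ge_sup => //; exists (u 0%N); exists 0%N.
Qed.

(** The lower left corners of the chosen quarters increase in each coordinate,
    so the suprema of their coordinates belong to all the squares.
    One-dimensional bisections are the case of a property that ignores the
    second coordinate. *)
Lemma dyadic_nested (P : nat -> R -> R -> Prop) : P 0%N 0 0 ->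
  (forall k x y, P k x y -> exists i j : bool,
     P k.+1 (x + i%:R * 2^-1 ^+ k.+1) (y + j%:R * 2^-1 ^+ k.+1)) ->
  exists x y, [/\ 0 <= x <= 1, 0 <= y <= 1 & forall k, exists a b,
    [/\ P k a b, a <= x <= a + 2^-1 ^+ k & b <= y <= b + 2^-1 ^+ k]].
Proof.
move=> P0 step.
have [s [s0 hs]] := @dependent_seq (R * R)%type (fun k p => P k p.1 p.2)
  (fun k p q => exists i j : bool, q = (p.1 + i%:R * 2^-1 ^+ k.+1, p.2 + j%:R * 2^-1 ^+ k.+1))
  (0, 0) P0 (fun k p Pp => let: ex_intro i (ex_intro j h) := step k p.1 p.2 Pp in
     ex_intro2 _ _ _ (ex_intro _ i (ex_intro _ j erefl)) h).
have half k : 0 < 2^-1 ^+ k.+1 :> R /\ 2^-1 ^+ k = 2^-1 ^+ k.+1 *+ 2 :> R.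
  split; first by rewrite exprn_gt0.
  by rewrite exprS; lra.
have aux (f : R * R -> R) (k : nat) (i : bool) :
    f (s k.+1) = f (s k) + i%:R * 2^-1 ^+ k.+1 ->
    f (s k) <= f (s k.+1) /\ f (s k.+1) + 2^-1 ^+ k.+1 <= f (s k) + 2^-1 ^+ k.
  by have [? ->] := half k; move=> ->; case: i; rewrite /= ?mulr1n; lra.
have [x hx] : exists x, forall k, (s k).1 <= x <= (s k).1 + 2^-1 ^+ k.
  by apply: nested_point => k; have [_ [i [j e]]] := hs k; apply: (aux fst k i); rewrite e.
have [y hy] : exists y, forall k, (s k).2 <= y <= (s k).2 + 2^-1 ^+ k.
  by apply: nested_point => k; have [_ [i [j e]]] := hs k; apply: (aux snd k j); rewrite e.
exists x, y; split.
- by have := hx 0%N; rewrite s0 add0r expr0.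
- by have := hy 0%N; rewrite s0 add0r expr0.
- by move=> k; exists (s k).1, (s k).2; split=> //; have [] := hs k.
Qed.

End Dyadic.

(** * Goursat's theorem for discrete contour sums *)

Section Goursat.
Variable R : realType.
Local Notation C := R[i].
Implicit Types (G : C -> C) (p u v : C) (n : nat).

(** The midpoint sum with [2 ^ n] pieces for the integral of [G] along the
    segment from [p] to [p + v]. *)
Fixpoint edge G n p v : C :=
  if n is m.+1 then edge G m p (v / 2) + edge G m (p + v / 2) (v / 2)
  else G (p + v / 2) * v.

(** The midpoint sum along the boundary of the parallelogram with corner [p]
    and sides [u], [v]. No limit in [n] is taken: a sum of level [n.+1] is
    exactly the sum of four sums of level [n] (contour_split), and Goursat's
    argument uses nothing else of an integral. *)
Definition contour G n p u v :=
  edge G n p u + edge G n (p + u) v - edge G n (p + v) u - edge G n p v.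

(** The midpoint rule is exact on affine functions, so that their contour sums
    vanish. *)
Lemma edge_affine (a b : C) n p v :
  edge (fun w => a + b * w) n p v = (a + b * (p + v / 2)) * v.
Proof.
elim: n p v => [//|n IH] p v /=; rewrite !IH.
by field.
Qed.

Lemma edgeB F G n p v :
  edge (fun w => F w - G w) n p v = edge F n p v - edge G n p v.
Proof.
elim: n p v => [|n IH] p v /=; first by rewrite mulrBl.
by rewrite !IH; ring.
Qed.

Lemma edge_bound G n p v (M : R) :
  (forall t : R, 0 <= t <= 1 -> cm (G (p + t%:C * v)) <= M) ->
  cm (edge G n p v) <= M * cm v.
Proof.
have half : (2^-1 : C) = (2^-1 : R)%:C by rewrite fmorphV rmorph_nat.
elim: n p v => [|n IH] p v hG /=.
  rewrite cmM ler_wpM2r ?cm_ge0 //.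
  have := hG 2^-1; rewrite -half mulrC; apply; lra.
have cv : cm (v / 2) = cm v / 2 by rewrite cm_div cm_nat.
apply: le_trans (cmD _ _) _.
have -> : M * cm v = M * cm (v / 2) + M * cm (v / 2) by rewrite cv; field.
apply: lerD; apply: IH => t t01.
  have := hG (t / 2); rewrite rmorphM /= -half.
  have -> : t%:C / 2 * v = t%:C * (v / 2) by rewrite mulrA mulrAC.
  by apply; lra.
have := hG (2^-1 + t / 2); rewrite rmorphD rmorphM /= -half.
have -> : p + (2^-1 + t%:C / 2) * v = p + v / 2 + t%:C * (v / 2) by ring.
by apply; lra.
Qed.

Lemma edge_periodic G T n p v : (forall w, G (w + T) = G w) ->
  edge G n (p + T) v = edge G n p v.
Proof.
move=> per; elim: n p v => [|n IH] p v /=; first by rewrite addrAC per.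
by rewrite IH addrAC IH.
Qed.

Lemma contour_split G n p u v : contour G n.+1 p u v =
  contour G n p (u / 2) (v / 2) + contour G n (p + u / 2) (u / 2) (v / 2)
  + contour G n (p + v / 2) (u / 2) (v / 2)
  + contour G n (p + u / 2 + v / 2) (u / 2) (v / 2).
Proof.
have dbl (q w : C) : q + w / 2 + w / 2 = q + w by field.
rewrite /contour /= !dbl.
rewrite [p + u / 2 + v / 2 + u / 2]addrAC dbl [p + v / 2 + u / 2]addrAC [p + v + u / 2]addrAC.
by ring.
Qed.

Lemma contour_le_split G n p u v : cm (contour G n.+1 p u v) <=
  cm (contour G n p (u / 2) (v / 2)) + cm (contour G n (p + u / 2) (u / 2) (v / 2))
  + cm (contour G n (p + v / 2) (u / 2) (v / 2))
  + cm (contour G n (p + u / 2 + v / 2) (u / 2) (v / 2)).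
Proof.
rewrite contour_split; apply: le_trans (cmD _ _) _; rewrite lerD2r.
by apply: le_trans (cmD _ _) _; rewrite lerD2r cmD.
Qed.

(** Subtracting an affine function does not change a contour sum, hence only
    the distance of [G] to affine functions counts. *)
Lemma contour_bound G n p u v (a b : C) (M : R) :
  (forall s t : R, 0 <= s <= 1 -> 0 <= t <= 1 ->
     cm (G (p + s%:C * u + t%:C * v) - (a + b * (p + s%:C * u + t%:C * v))) <= M) ->
  cm (contour G n p u v) <= 2 * M * (cm u + cm v).
Proof.
move=> hM; pose H w := G w - (a + b * w).
have -> : contour G n p u v = contour H n p u v.
  by rewrite /contour /H !edgeB !edge_affine; field.
have i0 : (fun s : R => 0 <= s <= 1) 0 by rewrite lexx ler01.
have i1 : (fun s : R => 0 <= s <= 1) 1 by rewrite ler01 lexx.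
have e1 : cm (edge H n p u) <= M * cm u.
  apply: edge_bound => t t01; have := hM t 0 t01 i0.
  by rewrite mul0r addr0.
have e2 : cm (edge H n (p + u) v) <= M * cm v.
  apply: edge_bound => t t01; have := hM 1 t i1 t01.
  by rewrite mul1r.
have e3 : cm (edge H n (p + v) u) <= M * cm u.
  apply: edge_bound => t t01; have := hM t 1 t01 i1.
  by rewrite mul1r [p + _ + v]addrAC.
have e4 : cm (edge H n p v) <= M * cm v.
  apply: edge_bound => t t01; have := hM 0 t i0 t01.
  by rewrite mul0r addr0.
rewrite /contour.
have := cmDB (edge H n p u + edge H n (p + u) v - edge H n (p + v) u) (edge H n p v).
have := cmDB (edge H n p u + edge H n (p + u) v) (edge H n (p + v) u).
have := cmD (edge H n p u) (edge H n (p + u) v).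
lra.
Qed.

(** Bisection: if the sums do not become small, a square with large sums for
    infinitely many levels has a quarter of the same kind. At the point to
    which these squares shrink, [G] differs from an affine function by [o(h)]
    on the square of side [h], so by [contour_bound] the sums are [o(h ^+ 2)],
    which contradicts their size. *)
Theorem goursat G p u v :
  (forall s t : R, 0 <= s <= 1 -> 0 <= t <= 1 ->
     exists d, hasd G (p + s%:C * u + t%:C * v) d) ->
  forall eta : R, 0 < eta ->
  exists N, forall n, (N <= n)%N -> cm (contour G n p u v) <= eta.
Proof.
move=> dG eta eta0; apply: contrapT => nex.
pose h k : R := 2^-1 ^+ k.
have hS k : (h k.+1)%:C = (h k)%:C / 2 :> C.
  by rewrite /h exprSr rmorphM /= fmorphV rmorph_nat.
(* Infinitely many levels are required because a bad sum of level [n.+1] only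
   gives a bad sum of level [n] on a quarter. *)
pose P k x y := forall N, exists2 n, (N <= n)%N &
  eta * h k ^+ 2 < cm (contour G n (p + x%:C * u + y%:C * v) ((h k)%:C * u) ((h k)%:C * v)).
have P0 : P 0%N 0 0.
  move=> N; apply: contrapT => nP; apply: nex; exists N => n Nn.
  rewrite leNgt; apply/negP => hn; apply: nP; exists n => //.
  by rewrite /h expr0 !mul0r !addr0 expr1n mulr1 !mul1r.
have step k x y : P k x y -> exists i j : bool,
    P k.+1 (x + i%:R * 2^-1 ^+ k.+1) (y + j%:R * 2^-1 ^+ k.+1).
  move=> Pk; apply: contrapT => nP.
  have bad (i j : bool) : exists N, forall n, (N <= n)%N ->
      cm (contour G n (p + (x + i%:R * h k.+1)%:C * u + (y + j%:R * h k.+1)%:C * v)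
        ((h k.+1)%:C * u) ((h k.+1)%:C * v)) <= eta * h k.+1 ^+ 2.
    apply: contrapT => nN; apply: nP; exists i, j => N.
    apply: contrapT => nN2; apply: nN; exists N => n Nn.
    by rewrite leNgt; apply/negP => hn; apply: nN2; exists n.
  have [N1 h1] := bad false false; have [N2 h2] := bad true false.
  have [N3 h3] := bad false true; have [N4 h4] := bad true true.
  have [[//|n]] := Pk (maxn (maxn N1 N2) (maxn N3 N4)).+1.
  rewrite ltnS !geq_max => /andP[/andP[n1 n2] /andP[n3 n4]].
  apply/negP; rewrite -leNgt; apply: le_trans (contour_le_split _ _ _ _ _) _.
  have hlf (w : C) : (h k)%:C * w / 2 = (h k.+1)%:C * w by rewrite hS mulrAC.
  have base (i j : bool) : p + (x + i%:R * h k.+1)%:C * u + (y + j%:R * h k.+1)%:C * v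
      = p + x%:C * u + y%:C * v + i%:R * ((h k.+1)%:C * u) + j%:R * ((h k.+1)%:C * v).
    by rewrite !rmorphD !rmorphM /= !rmorph_nat; ring.
  move: (h1 n n1) (h2 n n2) (h3 n n3) (h4 n n4).
  rewrite !hlf !base !mul0r !addr0 !mul1r.
  have -> : eta * h k.+1 ^+ 2 = eta * h k ^+ 2 / 4 by rewrite (_ : h k.+1 = h k / 2) ?/h ?exprSr //; field.
  by lra.
have [x [y [x01 y01 hxy]]] := dyadic_nested P0 step.
have [d dG'] := dG x y x01 y01.
pose S := cm u + cm v + 1.
have S0 : 0 < S by have := cm_ge0 u; have := cm_ge0 v; rewrite /S; lra.
have e0 : 0 < eta / (4 * S ^+ 2) by rewrite divr_gt0 // mulr_gt0 // exprn_gt0.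
have [r r0 hr] := hasdP dG' e0.
have [k hk] := pow_half_small (divr_gt0 r0 S0).
have [a [b [Pab xa yb]]] := hxy k.
have hk0 : 0 < h k by rewrite exprn_gt0.
set w := p + x%:C * u + y%:C * v in dG' hr.
have near_pt (q o z : R) : 0 <= q <= 1 -> o <= z <= o + h k -> `|o + q * h k - z| <= h k.
  move=> /andP[q0 q1] hz; rewrite ler_norml.
  have := mulr_ge0 q0 (ltW hk0); have := ler_piMl (ltW hk0) q1.
  by lra.
have [n _] := Pab 0%N; apply/negP; rewrite -leNgt.
have cu := cm_ge0 u; have cv := cm_ge0 v.
have hkS : h k * S < r by rewrite -ltr_pdivlMr.
apply: le_trans (@contour_bound G n _ _ _ (G w - d * w) d (eta / (4 * S ^+ 2) * (h k * S)) _) _.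
  move=> s t s01 t01; set q := (X in G X).
  have qw : cm (q - w) <= h k * S.
    have -> : q - w = (a + s * h k - x)%:C * u + (b + t * h k - y)%:C * v.
      by rewrite /q /w !rmorphB !rmorphD !rmorphM /=; ring.
    apply: le_trans (cmD _ _) _; rewrite !cmM !cm_real.
    have A1 := near_pt _ _ _ s01 xa; have A2 := near_pt _ _ _ t01 yb.
    have := ler_wpM2r cu A1; have := ler_wpM2r cv A2.
    by rewrite /S !mulrDr mulr1; lra.
  have -> : G q - (G w - d * w + d * q) = G q - G w - d * (q - w) by ring.
  apply: le_trans (hr q _) _; first exact: le_lt_trans qw hkS.
  by rewrite ler_wpM2l // ltW.
rewrite !cmM !cm_real (ger0_norm (ltW hk0)).
have -> : eta * h k ^+ 2 = 2 * (eta / (4 * S ^+ 2) * (h k * S)) * (h k * (2 * S)).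
  by field; rewrite gt_eqF.
rewrite -mulrDr; apply: ler_wpM2l.
  by rewrite mulr_ge0 // mulr_ge0 ?(ltW e0) // mulr_ge0 // ltW.
by apply: ler_wpM2l; [exact: ltW|rewrite /S; lra].
Qed.

End Goursat.

(** * The complex exponential *)

Section Exponential.
Variable R : realType.
Local Notation C := R[i].

Lemma hasdPr (f : C -> C) (z d : C) :
  (forall e : R, 0 < e -> exists2 r : R, 0 < r &
    forall w, cm (w - z) < r -> cm (f w - f z - d * (w - z)) <= e * cm (w - z)) ->
  hasd f z d.
Proof.
move=> h; exists (fun w => if w == z then d else (f w - f z) / (w - z)); split.
- move=> e e0; have [r r0 hr] := h (e / 2) (divr_gt0 e0 (ltr0n _ 2)).
  exists r => // w wr /=; rewrite eqxx; case: eqP => [_|/eqP wz] /=.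
    by rewrite subrr cm0.
  have wz0 : w - z != 0 by rewrite subr_eq0.
  have -> : (f w - f z) / (w - z) - d = (f w - f z - d * (w - z)) / (w - z) by field.
  rewrite cm_div ltr_pdivrMr ?cm_gt0 //; apply: le_lt_trans (hr w wr) _.
  by rewrite ltr_pM2r ?cm_gt0 //; lra.
- by rewrite eqxx.
- move=> w; case: eqP => [->|/eqP wz]; first by rewrite subrr mulr0 addr0.
  by rewrite divfK ?subr_eq0 // addrC subrK.
Qed.

Lemma real_derive_bound (f : R -> R) (x d : R) : is_derive x 1 f d ->
  forall e : R, 0 < e -> exists2 r : R, 0 < r &
    forall h, `|h| < r -> `|f (x + h) - f x - d * h| <= e * `|h|.
Proof.
move=> [df <-] e e0.
have /cvgrPdist_lt/(_ e e0) := df.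
rewrite -/('D_1 f x) => /nbhs_ballP[r /= r0 hr]; exists r => // h hr'.
have [->|h0] := eqVneq h 0; first by rewrite addr0 subrr mulr0 subrr normr0 mulr0.
have := hr h; rewrite /ball /= sub0r normrN => /(_ hr' h0).
rewrite /GRing.scale /= mulr1 [h + x]addrC => /ltW hh.
have -> : f (x + h) - f x - 'D_1 f x * h = - (('D_1 f x - h^-1 * (f (x + h) - f x)) * h).
  by field.
by rewrite normrN normrM ler_wpM2r.
Qed.

Definition cexp (w : C) : C :=
  Complex (expR (complex.Re w) * cos (complex.Im w)) (expR (complex.Re w) * sin (complex.Im w)).

Lemma cexpD w h : cexp (w + h) = cexp w * cexp h.
Proof.
case: w h => [a b] [c d]; rewrite /cexp /=; simpc.
by rewrite expRD cosD sinD; congr Complex; ring.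
Qed.

Lemma cm_cexp w : cm (cexp w) = expR (complex.Re w).
Proof.
rewrite /cm normc_def /= !exprMn -mulrDr cos2Dsin2 mulr1 sqrtr_sqr.
by rewrite ger0_norm // expR_ge0.
Qed.

Lemma cexp_periodic w : cexp (w + Complex 0 (pi *+ 2)) = cexp w.
Proof.
by case: w => a b; rewrite /cexp /= addr0 cosD2pi sinD2pi.
Qed.

(** By the addition formula it suffices to differentiate at 0, where the
    derivatives of the real functions exp, sin and cos at 0 give the claim. *)
Lemma hasd_cexp w : hasd cexp w (cexp w).
Proof.
have e0z : cexp 0 = 1 by rewrite /cexp /= expR0 cos0 sin0 mulr0 mulr1.
suff h0 : hasd cexp 0 1.
  have -> : cexp = (fun z => cexp w * cexp (z - w)).
    by apply/funext => z; rewrite -cexpD addrC subrK.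
  rewrite subrr e0z mulr1.
  have := hasdB (hasd_id w) (hasd_cst w w); rewrite subr0 => hs.
  have h0' : hasd cexp (w - w) 1 by rewrite subrr.
  have := hasdM (hasd_cst (cexp w) w) (hasd_comp hs h0').
  by rewrite mul0r add0r !mulr1.
have ReE (z : C) : complex.Re (cexp z - 1 - z)
    = expR (complex.Re z) * cos (complex.Im z) - 1 - complex.Re z by case: z.
have ImE (z : C) : complex.Im (cexp z - 1 - z)
    = expR (complex.Re z) * sin (complex.Im z) - complex.Im z.
  by case: z => x y /=; rewrite subr0.
apply: hasdPr => e e0; rewrite e0z.
(* The real and imaginary parts contribute at most [3 * e' * cm z] and [4 * e'
   * cm z] to the error. *)
have [e' [e'0 e'e e'1]] : exists e' : R, [/\ 0 < e', e' <= e / 12 & e' <= 1].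
  by exists (Num.min 1 (e / 12)); rewrite lt_min ltr01 divr_gt0 // !ge_min !lexx orbT.
have [r1 r10 h1] := real_derive_bound (is_derive_expR 0) e'0.
have [r2 r20 h2] := real_derive_bound (is_derive_sin 0) e'0.
have [r3 r30 h3] := real_derive_bound (is_derive_cos 0) e'0.
exists (Num.min (Num.min r1 r2) (Num.min r3 (Num.min e' (1/2)))).
  by rewrite !lt_min r10 r20 r30 e'0 divr_gt0.
move=> z; rewrite subr0 !lt_min => /andP[/andP[z1 z2] /andP[z3 /andP[z4 z5]]].
have xz := cm_Re z; have yz := cm_Im z.
set x := complex.Re z in xz; set y := complex.Im z in yz.
have hexp : `|expR x - 1 - x| <= e' * `|x|.
  by have := h1 x (le_lt_trans xz z1); rewrite add0r expR0 mul1r.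
have hsin : `|sin y - y| <= e' * `|y|.
  by have := h2 y (le_lt_trans yz z2); rewrite add0r sin0 cos0 mul1r subr0.
have hcos : `|cos y - 1| <= e' * `|y|.
  by have := h3 y (le_lt_trans yz z3); rewrite add0r sin0 cos0 oppr0 mul0r subr0.
have hc := cm_ReIm (cexp z - 1 - 1 * z); rewrite mul1r in hc *.
move: hc.
have -> : complex.Re (cexp z - 1 - z) = expR x * cos y - 1 - x by exact: ReE.
have -> : complex.Im (cexp z - 1 - z) = expR x * sin y - y by exact: ImE.
move=> hc.
set m := cm z in xz yz z4 z5 *.
have m0 : 0 <= m by exact: cm_ge0.
have em : e' * m <= e / 12 * m by apply: ler_wpM2r.
have em1 : e' * m <= m by rewrite ler_piMl.
have b1 : `|expR x - 1 - x| <= e' * m by apply: le_trans hexp _; rewrite ler_wpM2l // ltW.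
have b2 : `|sin y - y| <= e' * m by apply: le_trans hsin _; rewrite ler_wpM2l // ltW.
have b3 : `|cos y - 1| <= e' * m by apply: le_trans hcos _; rewrite ler_wpM2l // ltW.
have ex2 : 0 <= expR x <= 2.
  rewrite expR_ge0 /=; move: b1 xz; rewrite !ler_norml; lra.
have ex1 : `|expR x - 1| <= 2 * m.
  move: b1 xz; rewrite !ler_norml; lra.
have c1 : `|expR x * cos y - 1 - x| <= 3 * (e' * m).
  have -> : expR x * cos y - 1 - x = (expR x - 1 - x) + expR x * (cos y - 1) by ring.
  apply: le_trans (ler_normD _ _) _; rewrite normrM (ger0_norm (expR_ge0 x)).
  have : expR x * `|cos y - 1| <= 2 * (e' * m) by apply: ler_pM => //; case/andP: ex2.
  by lra.
have c2 : `|expR x * sin y - y| <= 4 * (e' * m).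
  have -> : expR x * sin y - y = expR x * (sin y - y) + (expR x - 1) * y by ring.
  apply: le_trans (ler_normD _ _) _; rewrite !normrM (ger0_norm (expR_ge0 x)).
  have : expR x * `|sin y - y| <= 2 * (e' * m) by apply: ler_pM => //; case/andP: ex2.
  have : `|expR x - 1| * `|y| <= 2 * m * m by apply: ler_pM.
  have : m * m <= e' * m by rewrite ler_wpM2r // ltW.
  by lra.
have em0 : 0 <= e * m by rewrite mulr_ge0 // ltW.
by clear -hc c1 c2 em em0; apply: le_trans hc _; lra.
Qed.

End Exponential.

(** * Bound at the centre of a circle *)

Section MaxCenter.
Variable R : realType.
Local Notation C := R[i].

(** Apply [goursat] to [h \o cexp] on a rectangle with real parts from [ln r']
    to [ln r] and imaginary parts from 0 to [pi *+ 2]. By periodicity the two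
    horizontal edges cancel, so the mean values of [h] on the circles of
    radius [r] and [r'] agree in the limit, and the latter is close to [h 0]
    for small [r']. As [h] need only be continuous at 0, the lemma applies to
    quotients whose singularity at 0 has been filled in; it plays the role of
    both Cauchy's formula and the maximum principle below. *)
Theorem center_bound (h : C -> C) (rho r M : R) : ccont h 0 ->
  (forall z, 0 < cm z < rho -> exists d, hasd h z d) -> 0 < r < rho ->
  (forall z, cm z = r -> cm (h z) <= M) -> cm (h 0) <= M.
Proof.
move=> hc hd /andP[r0 rr] hM; apply/ler_addgt0Pr => e e0.
have e2 : 0 < e / 2 by rewrite divr_gt0.
have [d d0 hcd] := hc _ e2.
have [r' [r'0 r'r r'd]] : exists r' : R, [/\ 0 < r', r' <= r & r' < d].
  exists (Num.min (d / 2) r); rewrite lt_min r0 divr_gt0 // ge_min lexx orbT.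
  by split=> //; rewrite gt_min; apply/orP; left; lra.
pose v : C := Complex 0 (pi *+ 2).
pose p : C := (ln r')%:C; pose u : C := (ln r - ln r')%:C.
pose G w := h (cexp w).
have per w : G (w + v) = G w by rewrite /G cexp_periodic.
have Re_pt (s t : R) : complex.Re (p + s%:C * u + t%:C * v) = ln r' + s * (ln r - ln r').
  by rewrite /p /u /v /= ; simpc => /=; ring.
have lnr' : expR (ln r') = r' by rewrite lnK.
have lnr : expR (ln r) = r by rewrite lnK.
have lnle : ln r' <= ln r by rewrite ler_ln.
have dG (s t : R) : 0 <= s <= 1 -> 0 <= t <= 1 -> exists d, hasd G (p + s%:C * u + t%:C * v) d.
  move=> /andP[s0 s1] _; set w := (X in hasd G X).
  have [|d' hd'] := hd (cexp w).
    rewrite cm_cexp expR_gt0 andTb; apply: le_lt_trans rr.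
    rewrite -[leRHS]lnr ler_expR Re_pt.
    have : s * (ln r - ln r') <= ln r - ln r' by rewrite ler_piMl // subr_ge0.
    by lra.
  by exists (d' * cexp w); apply: hasd_comp hd'; exact: hasd_cexp.
have [n hn] := goursat dG e2; have := hn n (leqnn n).
rewrite /contour (edge_periodic _ _ _ per) [X in X - _]addrAC subrr add0r => ctr.
have outer : cm (edge G n (p + u) v) <= M * cm v.
  apply: edge_bound => t t01; apply: hM; rewrite cm_cexp.
  by have := Re_pt 1 t; rewrite !mul1r => ->; rewrite addrC subrK.
have inner : cm (edge (fun w => G w - (h 0 + 0 * w)) n p v) <= e / 2 * cm v.
  apply: edge_bound => t t01; rewrite mul0r addr0 ltW //; apply: hcd.
  rewrite subr0 cm_cexp; have := Re_pt 0 t; rewrite !mul0r !addr0 => ->.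
  by rewrite lnr'.
rewrite edgeB edge_affine mul0r addr0 in inner.
have cv : cm v = pi *+ 2.
  have -> : v = (pi *+ 2)%:C * 'i%C by rewrite /v; simpc.
  have -> : cm ((pi *+ 2)%:C * 'i%C) = `|pi *+ 2| * 1 :> R.
    rewrite cmM cm_real; congr (_ * _).
    by rewrite /cm normc_def /= expr0n expr1n /= add0r sqrtr1.
  by rewrite mulr1 ger0_norm // mulrn_wge0 // pi_ge0.
have cv1 : 1 <= cm v by rewrite cv mulr2n; have := pi_ge2 R; lra.
have hv : cm (h 0 * v) <= cm (edge G n (p + u) v) + (cm (edge G n (p + u) v - edge G n p v)
    + cm (edge G n p v - h 0 * v)).
  set A := edge G n (p + u) v; set B := edge G n p v.
  have := cmDB A ((A - B) + (B - h 0 * v)); have := cmD (A - B) (B - h 0 * v).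
  have -> : A - ((A - B) + (B - h 0 * v)) = h 0 * v by ring.
  by lra.
rewrite cmM in hv.
rewrite -(ler_pM2r (x := cm v)); last by lra.
have : e / 2 <= e / 2 * cm v by rewrite ler_peMr // ltW.
by rewrite mulrDl; lra.
Qed.

End MaxCenter.

(** * Cauchy sequences and Cauchy difference quotients *)

Section Completeness.
Variable R : realType.

Lemma real_cauchy_limit (u : nat -> R) :
  (forall e, 0 < e -> exists N, forall m n, (N <= m)%N -> (N <= n)%N -> `|u m - u n| <= e) ->
  exists l, forall e, 0 < e -> exists N, forall n, (N <= n)%N -> `|u n - l| <= e.
Proof.
move=> cu; pose E := [set x | exists N, forall n, (N <= n)%N -> x <= u n].
have up N e : (forall m n, (N <= m)%N -> (N <= n)%N -> `|u m - u n| <= e) ->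
    ubound E (u N + e).
  move=> hN x [M hM]; apply: le_trans (hM (maxn M N) (leq_maxl _ _)) _.
  by have := hN (maxn M N) N (leq_maxr _ _) (leqnn _); rewrite ler_norml; lra.
have low N e : (forall m n, (N <= m)%N -> (N <= n)%N -> `|u m - u n| <= e) ->
    E (u N - e).
  move=> hN; exists N => n Nn.
  by have := hN N n (leqnn _) Nn; rewrite ler_norml; lra.
exists (sup E) => e e0; have [N hN] := cu _ (divr_gt0 e0 (ltr0n R 2)).
have l1 : u N - e / 2 <= sup E.
  by apply: ub_le_sup (low _ _ hN); exists (u N + e / 2); exact: up.
have l2 : sup E <= u N + e / 2.
  by apply: ge_sup; [exists (u N - e / 2); exact: low|exact: up].
exists N => n Nn; have := hN N n (leqnn _) Nn.
by rewrite !ler_norml; lra.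
Qed.

Lemma complex_cauchy_limit (u : nat -> R[i]) :
  (forall e, 0 < e -> exists N, forall m n, (N <= m)%N -> (N <= n)%N -> cm (u m - u n) <= e) ->
  exists l, forall e, 0 < e -> exists N, forall n, (N <= n)%N -> cm (u n - l) <= e.
Proof.
move=> cu.
have ReB (z w : R[i]) : complex.Re (z - w) = complex.Re z - complex.Re w by case: z w => [? ?] [].
have ImB (z w : R[i]) : complex.Im (z - w) = complex.Im z - complex.Im w by case: z w => [? ?] [].
have [x hx] := real_cauchy_limit (u := fun n => complex.Re (u n)) (fun e e0 =>
  let: ex_intro N hN := cu e e0 in ex_intro _ N (fun m n Nm Nn =>
    le_trans (eq_ind _ (fun z => `|z| <= cm (u m - u n)) (cm_Re _) _ (ReB _ _)) (hN m n Nm Nn))).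
have [y hy] := real_cauchy_limit (u := fun n => complex.Im (u n)) (fun e e0 =>
  let: ex_intro N hN := cu e e0 in ex_intro _ N (fun m n Nm Nn =>
    le_trans (eq_ind _ (fun z => `|z| <= cm (u m - u n)) (cm_Im _) _ (ImB _ _)) (hN m n Nm Nn))).
exists (Complex x y) => e e0.
have [N1 h1] := hx _ (divr_gt0 e0 (ltr0n R 2)).
have [N2 h2] := hy _ (divr_gt0 e0 (ltr0n R 2)).
exists (maxn N1 N2) => n; rewrite geq_max => /andP[/h1 r1 /h2 r2].
have := cm_ReIm (u n - Complex x y); rewrite ReB ImB /=; lra.
Qed.

(** By completeness the difference quotients have a limit along a sequence
    tending to 0, and the hypothesis compares all others with it. No candidate
    for the derivative has to be known beforehand: this yields the
    differentiability of derivatives and of pointwise limits. *)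
Lemma derivable_of_cauchy_quotients (f : R[i] -> R[i]) (z : R[i]) (L r : R) : 0 < r ->
  (forall h k, h != 0 -> k != 0 -> cm h < r -> cm k < r ->
    cm ((f (z + h) - f z) / h - (f (z + k) - f z) / k) <= L * (cm h + cm k)) ->
  exists d, hasd f z d.
Proof.
move=> r0 hq.
pose s n : R[i] := (r / 2 * 2^-1 ^+ n)%:C.
have cms n : cm (s n) = r / 2 * 2^-1 ^+ n.
  by rewrite cm_real ger0_norm // mulr_ge0 ?exprn_ge0 // divr_ge0 // ltW.
have s0 n : s n != 0 by rewrite -cm_gt0 cms mulr_gt0 ?exprn_gt0 // divr_gt0.
have pw n : 0 <= (2^-1 : R) ^+ n <= 1 by rewrite exprn_ge0 // exprn_ile1 // invf_le1 ?ler1n.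
have sr n : cm (s n) < r.
  rewrite cms; case/andP: (pw n) => p0 p1.
  have : r / 2 * 2^-1 ^+ n <= r / 2 by rewrite ler_piMr // divr_ge0 // ltW.
  by lra.
have L0 : 0 <= L.
  have := le_trans (cm_ge0 _) (hq _ _ (s0 0%N) (s0 0%N) (sr 0%N) (sr 0%N)).
  by rewrite pmulr_lge0 // addr_gt0 // cm_gt0.
have small e : 0 < e -> exists N, forall n, (N <= n)%N -> L * cm (s n) <= e.
  move=> e0; have e'0 : 0 < e / (L * r + 1) by rewrite divr_gt0 // ltr_wpDl // mulr_ge0 // ltW.
  have [N hN] := pow_half_small e'0; exists N => n Nn.
  have pn : 2^-1 ^+ n <= 2^-1 ^+ N :> R by apply: ler_wiXn2l => //; rewrite ?invr_ge0 ?invf_le1 ?ler1n.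
  move: hN; rewrite ltr_pdivlMr; last by rewrite ltr_wpDl // mulr_ge0 // ltW.
  have Lr : 0 <= L * r by rewrite mulr_ge0 // ltW.
  have := ler_wpM2l Lr pn; have /andP[pn0 _] := pw n; have /andP[pN0 _] := pw N.
  have := mulr_ge0 Lr pn0; rewrite cms (_ : L * (r / 2 * _) = L * r * 2^-1 ^+ n / 2); last by ring.
  by rewrite mulrDr mulr1 [_ * (L * r)]mulrC; lra.
have [|d hd] := complex_cauchy_limit (u := fun n => (f (z + s n) - f z) / s n).
  move=> e e0; have [N hN] := small _ (divr_gt0 e0 (ltr0n R 2)); exists N => m n Nm Nn.
  apply: le_trans (hq _ _ (s0 _) (s0 _) (sr _) (sr _)) _; rewrite mulrDr.
  by have := hN _ Nm; have := hN _ Nn; lra.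
have key h : h != 0 -> cm h < r -> cm ((f (z + h) - f z) / h - d) <= L * cm h.
  move=> h0 hr; apply/ler_addgt0Pr => e e0.
  have [N hN] := small _ (divr_gt0 e0 (ltr0n R 2)).
  have [M hM] := hd _ (divr_gt0 e0 (ltr0n R 2)).
  have := hN _ (leq_maxl N M); have := hM _ (leq_maxr N M).
  set n := maxn N M.
  have := hq _ _ h0 (s0 n) hr (sr n); rewrite mulrDr.
  have := cm_tri ((f (z + s n) - f z) / s n) ((f (z + h) - f z) / h) d.
  by lra.
exists d; apply: hasdPr => e e0.
exists (Num.min r (e / (L + 1))); first by rewrite lt_min r0 divr_gt0 // ltr_wpDl.
move=> w; rewrite lt_min => /andP[wr we].
have [->|wz] := eqVneq w z; first by rewrite !subrr mulr0 subrr cm0 mulr0.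
have wz0 : w - z != 0 by rewrite subr_eq0.
have := key _ wz0 wr; rewrite [z + _]addrC subrK => k.
have -> : f w - f z - d * (w - z) = ((f w - f z) / (w - z) - d) * (w - z) by field.
rewrite cmM ler_wpM2r ?cm_ge0 //; apply: le_trans k _.
move: we; rewrite ltr_pdivlMr ?ltr_wpDl // mulrDr mulr1 [_ * L]mulrC.
by have := cm_ge0 (w - z); lra.
Qed.

End Completeness.

(** * Mean value inequality and Cauchy estimate *)

Section Derivatives.
Variable R : realType.
Local Notation C := R[i].

(** Bisection: one half of a segment on which the inequality fails by a fixed
    proportion is again such a segment, and at the point to which these shrink
    the derivative is too large. *)
Lemma mean_value_ineq (f : C -> C) (p q : C) (L : R) :
  (forall t : R, 0 <= t <= 1 -> exists2 d, hasd f (p + t%:C * q) d & cm d <= L) ->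
  cm (f (p + q) - f p) <= L * cm q.
Proof.
move=> df; rewrite leNgt; apply/negP => big.
pose e := (cm (f (p + q) - f p) - L * cm q) / 2.
have e0 : 0 < e by rewrite divr_gt0 // subr_gt0.
have ee : cm (f (p + q) - f p) = L * cm q + 2 * e by rewrite /e; field.
pose h k : R := 2^-1 ^+ k.
have hS k : h k = h k.+1 + h k.+1 by rewrite /h exprS; lra.
pose g (x : R) := f (p + x%:C * q).
(* Both parts of the bound are proportional to the length, so one of the
   halves exceeds it. *)
pose P k (x y : R) := L * h k * cm q + e * h k < cm (g (x + h k) - g x).
have P0 : P 0%N 0 0.
  rewrite /P /g /h expr0 add0r mul0r addr0 !mul1r !mulr1 ee; lra.
have step k x y : P k x y -> exists i j : bool,
    P k.+1 (x + i%:R * 2^-1 ^+ k.+1) (y + j%:R * 2^-1 ^+ k.+1).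
  rewrite /P -/(h k.+1) => Pk; apply: contrapT => nP.
  have bad (i : bool) : cm (g (x + i%:R * h k.+1 + h k.+1) - g (x + i%:R * h k.+1))
       <= L * h k.+1 * cm q + e * h k.+1.
    by rewrite leNgt; apply/negP => hh; apply: nP; exists i, false.
  have := bad false; have := bad true; rewrite mul0r addr0 mul1r.
  rewrite -[x + _ + _]addrA -hS.
  have := cm_tri (g (x + h k.+1)) (g (x + h k)) (g x).
  by move: Pk; rewrite [h k]hS; lra.
have [x [y [x01 _ hxy]]] := dyadic_nested P0 step.
have [d hd dL] := df x x01.
have e'0 : 0 < e / (cm q + 1) by rewrite divr_gt0 // ltr_wpDl // cm_ge0.
have [r r0 hr] := hasdP hd e'0.
have q1 : 0 < cm q + 1 by rewrite ltr_wpDl // cm_ge0.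
have [k hk] := pow_half_small (divr_gt0 r0 q1).
have [a [b [Pab /andP[xa xb] _]]] := hxy k; rewrite -/(h k) in hk xb.
have hk0 : 0 < h k by rewrite exprn_gt0.
have cq := cm_ge0 q.
have hkr : h k * cm q < r by move: hk; rewrite ltr_pdivlMr //; nra.
set w := p + x%:C * q in hd hr.
have pt (t : R) : cm (p + t%:C * q - w) = `|t - x| * cm q.
  by rewrite -cm_real -cmM rmorphB /=; congr cm; rewrite /w; ring.
have close (t : R) : `|t - x| <= h k -> cm (g t - f w - d * ((t - x)%:C * q)) <= e / (cm q + 1) * (`|t - x| * cm q).
  move=> tx; have := hr (p + t%:C * q); rewrite pt.
  have -> : p + t%:C * q - w = (t - x)%:C * q by rewrite rmorphB /w /=; ring.
  by apply; apply: le_lt_trans hkr; apply: ler_wpM2r.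
have n1 : `|a - x| = x - a by rewrite ler0_norm ?subr_le0 // opprB.
have n2 : `|a + h k - x| = a + h k - x by rewrite ger0_norm // subr_ge0.
have c1 := close a; have c2 := close (a + h k).
rewrite n1 in c1; rewrite n2 in c2.
have {}c1 : cm (g a - f w - d * ((a - x)%:C * q)) <= e / (cm q + 1) * ((x - a) * cm q).
  by apply: c1; lra.
have {}c2 : cm (g (a + h k) - f w - d * ((a + h k - x)%:C * q)) <= e / (cm q + 1) * ((a + h k - x) * cm q).
  by apply: c2; lra.
have split3 : g (a + h k) - g a = (g (a + h k) - f w - d * ((a + h k - x)%:C * q))
   - (g a - f w - d * ((a - x)%:C * q)) + d * ((h k)%:C * q).
  by rewrite !rmorphB !rmorphD /=; ring.
move: Pab; rewrite /P split3; apply/negP; rewrite -leNgt.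
apply: le_trans (cmD _ _) _; rewrite !cmM cm_real (ger0_norm (ltW hk0)).
have t1 : cm d * (h k * cm q) <= L * h k * cm q.
  by rewrite mulrA; apply: ler_wpM2r => //; apply: ler_wpM2r => //; exact: ltW.
have t2 := cmDB (g (a + h k) - f w - d * ((a + h k - x)%:C * q)) (g a - f w - d * ((a - x)%:C * q)).
have t3 : e / (cm q + 1) * ((a + h k - x) * cm q) + e / (cm q + 1) * ((x - a) * cm q) <= e * h k.
  have -> : e / (cm q + 1) * ((a + h k - x) * cm q) + e / (cm q + 1) * ((x - a) * cm q)
     = e * h k * (cm q / (cm q + 1)) by field; rewrite gt_eqF.
  apply: ler_piMr; first by rewrite mulr_ge0 // ltW.
  by rewrite ler_pdivrMr // mul1r lerDl.
lra.
Qed.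

Lemma hasd_shift (f : C -> C) z w d : hasd f (z + w) d -> hasd (fun u => f (z + u)) w d.
Proof.
move=> hf; have := hasd_comp (hasdD (hasd_cst z w) (hasd_id w)) hf.
by rewrite add0r mulr1.
Qed.

Lemma quotient_hasd (f : C -> C) z d w d' : w != 0 -> hasd f (z + w) d' ->
  exists e, hasd (fun h => if h == 0 then d else (f (z + h) - f z) / h) w e.
Proof.
move=> w0 hf.
have := hasd_div w0 (hasdB (hasd_shift hf) (hasd_cst (f z) w)) (hasd_id w).
set e := (X in hasd _ _ X -> _) => he; exists e; apply: hasd_ext he.
exists (cm w); first by rewrite cm_gt0.
by move=> u; case: eqP => // ->; rewrite sub0r cmN ltxx.
Qed.

(** Cauchy's estimate: [center_bound] for the difference quotient of [f] at
    [z], whose value at the centre is [d]. *)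
Lemma derive_bound (f : C -> C) z d (rho r M : R) : hasd f z d ->
  (forall w, cm w < rho -> exists e, hasd f (z + w) e) -> 0 < r < rho ->
  (forall w, cm w = r -> cm (f (z + w) - f z) <= M) -> cm d <= M / r.
Proof.
move=> hf df /andP[r0 rr] hM.
have := @center_bound R (fun h => if h == 0 then d else (f (z + h) - f z) / h) rho r (M / r).
rewrite eqxx; apply.
- exact/hasd_quot.
- move=> w /andP[w0 /df[e he]]; apply: quotient_hasd he; by rewrite -cm_gt0.
- by rewrite r0.
- move=> w wr; have -> : (w == 0) = false by apply: negbTE; rewrite -cm_gt0 wr.
  by rewrite cm_div wr ler_pM2r ?invr_gt0 //; exact: hM.
Qed.

End Derivatives.

(** * The Schur class and removable singularities *)

Section SchurClass.
Variable R : realType.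
Local Notation C := R[i].
Implicit Types f g : C -> C.

Lemma hasd_eq f z d d' : hasd f z d -> d = d' -> hasd f z d'.
Proof. by move=> hf <-. Qed.

Definition hol f := forall z, cm z < 1 -> exists d, hasd f z d.

(** The functions of [Hinfty_ball], described with real moduli and without the
    topology carried by [disc_fun]. *)
Definition schur f := hol f /\ forall z, cm z < 1 -> cm (f z) <= 1.

(** Cauchy's estimate on the circle around [z] of radius half the distance to
    the boundary. *)
Lemma schur_derive_bound f z d : schur f -> cm z < 1 -> hasd f z d ->
  cm d <= 4 / (1 - cm z).
Proof.
move=> [hf bf] z1 hd.
have cz := cm_ge0 z.
have -> : 4 / (1 - cm z) = 2 / ((1 - cm z) / 2) by field; rewrite gt_eqF // subr_gt0.
apply: (derive_bound (rho := 1 - cm z) hd).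
- by move=> w hw; apply: hf; have := cmD z w; lra.
- by lra.
- move=> w hw; apply: le_trans (cmDB _ _) _.
  have h1 := bf z z1; have : cm (f (z + w)) <= 1 by apply: bf; have := cmD z w; lra.
  by lra.
Qed.

Lemma cm_segment (z h : C) (r t : R) : cm z <= r -> cm (z + h) <= r -> 0 <= t <= 1 ->
  cm (z + t%:C * h) <= r.
Proof.
move=> hz hzh /andP[t0 t1].
have -> : z + t%:C * h = (1 - t)%:C * z + t%:C * (z + h) by rewrite rmorphB rmorph1 /=; ring.
apply: le_trans (cmD _ _) _; rewrite !cmM !cm_real (ger0_norm t0) ger0_norm ?subr_ge0 //.
have t1' : 0 <= 1 - t by rewrite subr_ge0.
have := ler_wpM2l t0 hzh; have := ler_wpM2l t1' hz; lra.
Qed.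

Lemma schur_lip f (r : R) z h : schur f -> r < 1 -> cm z <= r -> cm (z + h) <= r ->
  cm (f (z + h) - f z) <= 4 / (1 - r) * cm h.
Proof.
move=> sf r1 hz hzh; apply: mean_value_ineq => t t01.
have ht := cm_segment hz hzh t01.
have ht1 := le_lt_trans ht r1.
have [d hd] := sf.1 _ ht1; exists d => //.
apply: le_trans (schur_derive_bound sf ht1 hd) _.
by rewrite ler_pM2l // lef_pV2 ?posrE ?subr_gt0 // lerB.
Qed.

Section SecondOrder.
Variables (f : C -> C) (r del : R).
Hypotheses (sf : schur f) (del0 : 0 < del) (rdel : r + 4 * del <= 1).

(** Cauchy's estimate for the increment [fun w => f (w + h) - f w], which
    [schur_lip] bounds by a multiple of [cm h]. The points involved have
    modulus at most [r + 3 * del], hence stay at distance [del] from the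
    circle. *)
Lemma schur_derive_lip z h d d' : cm z <= r + del -> cm h <= del ->
  hasd f z d -> hasd f (z + h) d' -> cm (d' - d) <= 16 / del ^+ 2 * cm h.
Proof.
have d0 := del0; have rd := rdel; move=> zr hdel hd hd'.
have -> : 16 / del ^+ 2 * cm h = 8 / del * cm h / (del / 2) by field; rewrite gt_eqF.
pose F w := f (w + h) - f w.
have hF w e e' : hasd f (w + h) e' -> hasd f w e -> hasd F w (e' - e).
  move=> he' he; apply: hasdB he.
  have -> : (fun w => f (w + h)) = (fun w => f (h + w)) by apply/funext => u; rewrite addrC.
  by apply: hasd_shift; rewrite addrC.
apply: (derive_bound (rho := del) (hF _ _ _ hd' hd)).
- move=> w wd.
  have [|e he] := sf.1 (z + w); first by have := cmD z w; lra.
  have [|e' he'] := sf.1 (z + w + h).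
    by have := cmD z w; have := cmD (z + w) h; lra.
  by exists (e' - e); exact: hF.
- by lra.
- move=> w wd; rewrite /F.
  have := cmD z w; have := cmD (z + w) h; have := cmD z h => A1 A2 A3.
  have l1 := @schur_lip f (r + 3 * del) (z + w) h sf ltac:(lra) ltac:(lra) ltac:(lra).
  have l2 := @schur_lip f (r + 3 * del) z h sf ltac:(lra) ltac:(lra) ltac:(lra).
  have ch := cm_ge0 h.
  have ib : 4 / (1 - (r + 3 * del)) <= 4 / del by rewrite ler_pM2l // lef_pV2 ?posrE; lra.
  have := ler_wpM2r ch ib; have := cmDB (f (z + w + h) - f (z + w)) (f (z + h) - f z).
  have -> : 8 / del = 4 / del + 4 / del by field; rewrite gt_eqF.
  lra.
Qed.

(** The mean value inequality for [fun w => f w - d * w], whose derivative is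
    small by [schur_derive_lip]. *)
Lemma schur_taylor z h d : cm z <= r + del -> cm h <= del -> hasd f z d ->
  cm (f (z + h) - f z - d * h) <= 16 / del ^+ 2 * cm h ^+ 2.
Proof.
have d0 := del0; have rd := rdel; move=> zr hdel hd; pose F w := f w - d * w.
have -> : f (z + h) - f z - d * h = F (z + h) - F z by rewrite /F; ring.
rewrite expr2 mulrA; apply: mean_value_ineq => t /andP[t0 t1].
have th : cm (t%:C * h) <= cm h.
  by rewrite cmM cm_real ger0_norm // ler_piMl // cm_ge0.
have [|e he] := sf.1 (z + t%:C * h).
  by have := cmD z (t%:C * h); lra.
exists (e - d).
  have H := hasdB he (hasdM (hasd_cst d _) (hasd_id (z + t%:C * h))).
  by apply: hasd_eq H _; rewrite mul0r add0r mulr1.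
have K0 : 0 <= 16 / del ^+ 2 by rewrite divr_ge0 // exprn_ge0 // ltW.
have := schur_derive_lip zr (le_trans th hdel) hd he.
by have := ler_wpM2l K0 th; lra.
Qed.

(** Cauchy's estimate for the difference of two difference quotients of [f];
    by [schur_taylor] both are close to [D]. It provides the second
    derivative, on which the differentiability of [f z / z] at the origin
    depends. *)
Lemma schur_derive_quotients (D : C -> C) z h k :
  (forall w, cm w < 1 -> hasd f w (D w)) -> cm z <= r -> h != 0 -> k != 0 -> cm h < del -> cm k < del ->
  cm ((D (z + h) - D z) / h - (D (z + k) - D z) / k)
  <= 64 / del ^+ 3 * (cm h + cm k).
Proof.
have d0 := del0; have rd := rdel; move=> dF zr h0 k0 hdel kdel.
have -> : 64 / del ^+ 3 * (cm h + cm k) = 32 / del ^+ 2 * (cm h + cm k) / (del / 2).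
  by field; rewrite gt_eqF.
pose F w := (f (h + w) - f w) / h - (f (k + w) - f w) / k.
have hF w : cm w < r + 2 * del -> hasd F w
   ((D (w + h) - D w) / h - (D (w + k) - D w) / k).
  move=> wr.
  have dw := dF w ltac:(lra).
  have dh := dF (h + w) ltac:(have := cmD h w; lra).
  have dk := dF (k + w) ltac:(have := cmD k w; lra).
  have H := hasdB (hasdM (hasdB (hasd_shift dh) dw) (hasd_cst h^-1 w))
                (hasdM (hasdB (hasd_shift dk) dw) (hasd_cst k^-1 w)).
  by apply: hasd_eq H _; rewrite [h + w]addrC [k + w]addrC; ring.
apply: (derive_bound (rho := del) (hF z ltac:(lra))).
- by move=> w wd; eexists; apply: hF; have := cmD z w; lra.
- by lra.
- move=> w wd; have zw : cm (z + w) <= r + del by have := cmD z w; lra.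
  have tq u v : cm u <= r + del -> v != 0 -> cm v < del ->
      cm ((f (v + u) - f u) / v - D u) <= 16 / del ^+ 2 * cm v.
    move=> ur v0 vd.
    have -> : (f (v + u) - f u) / v - D u = (f (u + v) - f u - D u * v) / v.
      by rewrite [v + u]addrC; field.
    rewrite cm_div ler_pdivrMr ?cm_gt0 // -[leRHS]mulrA -expr2.
    by apply: schur_taylor => //; [exact: ltW|apply: dF; lra].
  have zr' : cm z <= r + del by lra.
  have b1 := tq _ _ zw h0 hdel; have b2 := tq _ _ zw k0 kdel.
  have b3 := tq _ _ zr' h0 hdel; have b4 := tq _ _ zr' k0 kdel.
  rewrite /F.
  set A := (f (h + (z + w)) - _) / h in b1 *; set B := (f (k + (z + w)) - _) / k in b2 *.
  set A' := (f (h + z) - _) / h in b3 *; set B' := (f (k + z) - _) / k in b4 *.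
  set E := D (z + w) in b1 b2; set E' := D z in b3 b4.
  have -> : A - B - (A' - B') = ((A - E) - (B - E)) - ((A' - E') - (B' - E')) by ring.
  have := cmDB ((A - E) - (B - E)) ((A' - E') - (B' - E')).
  have := cmDB (A - E) (B - E); have := cmDB (A' - E') (B' - E').
  have -> : 32 / del ^+ 2 = 16 / del ^+ 2 + 16 / del ^+ 2 by field; rewrite gt_eqF.
  by lra.
Qed.

End SecondOrder.

Lemma schur_derive_hasd f D z : schur f -> (forall w, cm w < 1 -> hasd f w (D w)) ->
  cm z < 1 -> exists e, hasd D z e.
Proof.
move=> sf dF z1; pose del := (1 - cm z) / 4.
have d0 : 0 < del by rewrite divr_gt0 // subr_gt0.
have rd : cm z + 4 * del <= 1 by rewrite /del; lra.
apply: (derivable_of_cauchy_quotients d0) => h k h0 k0 hd kd.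
exact: (schur_derive_quotients sf d0 rd dF (lexx _)).
Qed.

(** Away from the origin this is a quotient of differentiable functions. At
    the origin [f] has a second derivative [e] (schur_derive_hasd), and the
    mean value inequality for [f u - d * u - e / 2 * u ^+ 2] shows that the
    quotient has derivative [e / 2] there. *)
Lemma hol_div f d : schur f -> f 0 = 0 -> hasd f 0 d ->
  hol (fun z => if z == 0 then d else f z / z).
Proof.
move=> sf f0 hd z z1.
have fq : (fun h => if h == 0 then d else (f (0 + h) - f 0) / h)
   = (fun z => if z == 0 then d else f z / z).
  by apply/funext => h; rewrite add0r f0 subr0.
have [->|z0] := eqVneq z 0; last first.
  have [e he] := sf.1 z z1; rewrite -fq; apply: (@quotient_hasd _ f 0 d z e z0).
  by rewrite add0r.
have [D dF] : exists D : C -> C, forall w, cm w < 1 -> hasd f w (D w).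
  have /choice[D hD] : forall w, exists d, cm w < 1 -> hasd f w d.
    move=> w; have [/sf.1[d' hd']|nw] := pselect (cm w < 1); first by exists d'.
    by exists 0.
  by exists D.
have [|e he] := schur_derive_hasd (z := 0) sf dF; first by rewrite cm0.
exists (e / 2); apply: hasdPr => eps eps0; rewrite eqxx.
have [r r0 hr] := hasdP he eps0.
exists (Num.min r 1) => [|w]; first by rewrite lt_min r0 ltr01.
rewrite subr0 lt_min => /andP[wr w1].
have [->|w0] /= := eqVneq w 0; first by rewrite subrr mulr0 subrr !cm0 mulr0.
have d0 : D 0 = d by apply: hasd_uniq hd; apply: dF; rewrite cm0.
have -> : f w / w - d - e / 2 * w = (f w - d * w - e / 2 * (w * w)) / w by field.
rewrite cm_div ler_pdivrMr ?cm_gt0 //.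
pose F u := f u - d * u - e / 2 * (u * u).
have -> : f w - d * w - e / 2 * (w * w) = F (0 + w) - F 0.
  by rewrite /F add0r f0; ring.
apply: mean_value_ineq => t /andP[t0 t1].
have tw : cm (t%:C * w) <= cm w.
  by rewrite cmM cm_real ger0_norm // ler_piMl // cm_ge0.
rewrite add0r; set u := t%:C * w in tw *.
have [g hg] := sf.1 u (le_lt_trans tw w1).
exists (g - d - e * u).
  have hu := hasd_id u.
  have H := hasdB (hasdB hg (hasdM (hasd_cst d u) hu)) (hasdM (hasd_cst (e / 2) u) (hasdM hu hu)).
  by apply: hasd_eq H _; field.
have gd : D u = g by apply: hasd_uniq hg; apply: dF; exact: le_lt_trans tw w1.
have := hr u; rewrite subr0 gd d0 => /(_ (le_lt_trans tw wr)).
by have := ler_wpM2l (ltW eps0) tw; lra.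
Qed.

End SchurClass.

(** * Automorphisms of the disc *)

Section Moebius.
Variable R : realType.
Local Notation C := R[i].
Implicit Types (a z w : C) (f g : C -> C).

Definition mob a z := (z + a) / (1 + a^* * z).

(** Every bound on [mob] comes from this identity; it also holds for [z]
    outside the disc, where its sign changes. *)
Lemma cm_mob_identity a z :
  cm (1 + a^* * z) ^+ 2 - cm (z + a) ^+ 2 = (1 - cm a ^+ 2) * (1 - cm z ^+ 2).
Proof.
apply: complexI; rewrite rmorphM !(rmorphB (real_complex R)) rmorph1 /= !cm_sqr.
rewrite !rmorphD !rmorphM /= rmorph1 conjCK.
by ring.
Qed.

Lemma mob_den a z : cm a < 1 -> cm z <= 1 -> 1 + a^* * z != 0.
Proof.
move=> a1 z1; rewrite -cm_gt0.
apply: lt_le_trans (cmBDD 1 (a^* * z)); rewrite cm1 subr_gt0 cmM cmJ.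
by apply: le_lt_trans a1; rewrite ler_piMr // cm_ge0.
Qed.

Lemma cm_mob a z : cm a < 1 -> cm z <= 1 ->
  1 - cm (mob a z) ^+ 2 = (1 - cm a ^+ 2) * (1 - cm z ^+ 2) / cm (1 + a^* * z) ^+ 2.
Proof.
move=> a1 z1; have d0 := mob_den a1 z1.
have c0 : cm (1 + a^* * z) != 0 by rewrite cm_eq0.
by rewrite -cm_mob_identity /mob cm_div; field.
Qed.

Lemma sqr1_gt0 (x : R) : 0 <= x -> (0 < 1 - x ^+ 2) = (x < 1).
Proof. by move=> x0; rewrite subr_gt0 expr_lt1. Qed.

Lemma sqr1_ge0 (x : R) : 0 <= x -> (0 <= 1 - x ^+ 2) = (x <= 1).
Proof. by move=> x0; rewrite subr_ge0 expr_le1. Qed.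

Lemma mob_lt1 a z : cm a < 1 -> cm z < 1 -> cm (mob a z) < 1.
Proof.
move=> a1 z1; rewrite -sqr1_gt0 ?cm_ge0 // cm_mob ?(ltW z1) // divr_gt0 //.
  by rewrite mulr_gt0 // sqr1_gt0 ?cm_ge0.
by rewrite exprn_gt0 // cm_gt0 mob_den // ltW.
Qed.

Lemma mob_le1 a z : cm a < 1 -> cm z <= 1 -> cm (mob a z) <= 1.
Proof.
move=> a1 z1; rewrite -sqr1_ge0 ?cm_ge0 // cm_mob // divr_ge0 ?exprn_ge0 ?cm_ge0 //.
by rewrite mulr_ge0 // sqr1_ge0 ?cm_ge0 // ltW.
Qed.

Lemma mob_eq1 a z : cm a < 1 -> cm z = 1 -> cm (mob a z) = 1.
Proof.
move=> a1 z1; have z1' : cm z <= 1 by rewrite z1.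
have := cm_mob a1 z1'; rewrite z1 expr1n subrr mulr0 mul0r => /eqP.
by rewrite subr_eq0 eq_sym sqrf_eq1 => /orP[/eqP //|/eqP h]; have := cm_ge0 (mob a z); lra.
Qed.

Lemma cmN_lt1 a : cm a < 1 -> cm (- a) < 1. Proof. by rewrite cmN. Qed.

Lemma mobK a z : cm a < 1 -> cm z <= 1 -> mob (- a) (mob a z) = z.
Proof.
move=> a1 z1; have d0 := mob_den a1 z1.
have d1 := mob_den (cmN_lt1 a1) (mob_le1 a1 z1).
have e0 : 1 - a^* * a != 0.
  have := mob_den (cmN_lt1 a1) (ltW a1).
  by rewrite rmorphN mulNr.
move: d1; rewrite /mob rmorphN /= => d1.
field; rewrite d0 andTb; apply: contra e0 => /eqP h; apply/eqP.
by rewrite -[RHS]h; ring.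
Qed.

Lemma mob0 a : mob a 0 = a. Proof. by rewrite /mob add0r mulr0 addr0 divr1. Qed.

Lemma mobN a : mob (- a) a = 0. Proof. by rewrite /mob subrr mul0r. Qed.

Lemma hasd_mob a z : cm a < 1 -> cm z <= 1 ->
  hasd (mob a) z ((1 - a * a^*) / (1 + a^* * z) ^+ 2).
Proof.
move=> a1 z1; have d0 := mob_den a1 z1.
have H := hasd_div (f := fun z => z + a) (g := fun z => 1 + a^* * z) d0 (hasdD (hasd_id z) (hasd_cst a z))
  (hasdD (hasd_cst 1 z) (hasdM (hasd_cst a^* z) (hasd_id z))).
by apply: hasd_eq H _; field.
Qed.

Lemma hol_comp f g : hol f -> hol g -> (forall z, cm z < 1 -> cm (g z) < 1) ->
  hol (fun z => f (g z)).
Proof.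
move=> hf hg g1 z z1; have [d hd] := hg z z1; have [e he] := hf _ (g1 z z1).
by exists (e * d); exact: hasd_comp.
Qed.

Lemma hol_mob a : cm a < 1 -> hol (mob a).
Proof. by move=> a1 z z1; eexists; apply: hasd_mob a1 (ltW z1). Qed.

Lemma schur_comp f g : schur f -> hol g -> (forall z, cm z < 1 -> cm (g z) < 1) ->
  schur (fun z => f (g z)).
Proof.
move=> [hf bf] hg g1; split; first exact: hol_comp.
by move=> z /g1; exact: bf.
Qed.

Lemma schur_mob a : cm a < 1 -> schur (mob a).
Proof.
move=> a1; split; first exact: hol_mob.
by move=> z z1; rewrite ltW // mob_lt1.
Qed.

Lemma schur_mob_comp a f : cm a < 1 -> schur f -> schur (fun z => mob a (f z)).
Proof.
move=> a1 [hf bf]; split=> [z z1|z /bf]; last exact: mob_le1.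
have [d hd] := hf z z1; eexists; apply: hasd_comp hd _.
exact: hasd_mob a1 (bf z z1).
Qed.

Lemma cm_mob_near1 a (e : R) : cm a < 1 -> 0 < e -> exists2 r : R, 0 < r < 1 &
  forall z, cm z = r -> 1 - e <= cm (mob a z).
Proof.
move=> a1 e0; have a0 := cm_ge0 a.
pose k := 1 - cm a; have k0 : 0 < k by rewrite subr_gt0.
(* On the circle of radius [r] the identity bounds [1 - cm (mob a z) ^+ 2] by
   [(2 * k) * (2 * (1 - r)) / k ^+ 2]; the minimum with [1/2] keeps [r]
   positive. *)
pose r := 1 - Num.min (1/2) (e * k / 4).
have [m0 [m1 m2]] : 0 < Num.min (1/2) (e * k / 4) /\
    Num.min (1/2) (e * k / 4) <= 1/2 /\ Num.min (1/2) (e * k / 4) <= e * k / 4.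
  by rewrite lt_min !ge_min !lexx orbT !divr_gt0 ?mulr_gt0.
exists r; first by rewrite /r; lra.
move=> z zr; have z1 : cm z <= 1 by rewrite zr /r; lra.
have den : k <= cm (1 + a^* * z).
  apply: le_trans (cmBDD 1 (a^* * z)); rewrite cm1 cmM cmJ /k lerB //.
  by rewrite ler_piMr.
have m1' := mob_le1 a1 z1; have m0' := cm_ge0 (mob a z).
suff : 1 - cm (mob a z) ^+ 2 <= e.
  have : cm (mob a z) ^+ 2 <= cm (mob a z) by rewrite expr2 ler_piMr.
  by lra.
rewrite cm_mob // ler_pdivrMr; last by rewrite exprn_gt0 // (lt_le_trans k0).
have p1 : (1 - cm a ^+ 2) * (1 - cm z ^+ 2) <= (2 * k) * (2 * (1 - r)).
  have r0 : 0 <= r by rewrite /r; lra.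
  have r1 : r <= 1 by rewrite /r; lra.
  rewrite zr; apply: ler_pM.
  - by rewrite sqr1_ge0 // ltW.
  - by rewrite sqr1_ge0.
  - by have := sqr_ge0 (1 - cm a); rewrite /k; nra.
  - by have := sqr_ge0 (1 - r); nra.
have p2 : k * k <= cm (1 + a^* * z) ^+ 2.
  by rewrite expr2; apply: ler_pM => //; exact: ltW.
have := ler_wpM2l (ltW e0) p2.
have : 2 * k * (2 * (1 - r)) <= e * (k * k).
  have -> : e * (k * k) = 2 * k * (2 * (e * k / 4)) by field.
  rewrite ler_pM2l; last by rewrite mulr_gt0.
  by rewrite /r; lra.
by lra.
Qed.

End Moebius.

(** * The Schwarz-Pick inequality and its consequences *)

Section SchwarzPick.
Variable R : realType.
Local Notation C := R[i].
Implicit Types (a z w : C) (f g : C -> C).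

(** The singularity at the origin is removable by [hol_div]. To bound the
    value at [z], move [z] to the centre by [mob z] and apply [center_bound]
    on circles of radius close to 1, on which [mob z] has modulus close to 1
    and the quotient is therefore almost bounded by 1. *)
Lemma schwarz_quotient f d : schur f -> f 0 = 0 -> hasd f 0 d ->
  schur (fun z => if z == 0 then d else f z / z).
Proof.
move=> sf f0 hd; have hg := hol_div sf f0 hd; split=> // z z1.
set g := (fun z => _) in hg *; apply/ler_addgt0Pr => e e0.
pose e' := e / (1 + e).
have e1 : 0 < 1 + e by rewrite addr_gt0.
have e'0 : 0 < e' by rewrite divr_gt0.
have [r r01 hr] := cm_mob_near1 z1 e'0.
have h1 : hol (fun u => g (mob z u)) by apply: hol_comp hg (hol_mob z1) _ => u; exact: mob_lt1.
have := @center_bound R (fun u => g (mob z u)) 1 r (1 + e).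
rewrite mob0; apply => //.
- by have [|d0 hd0] := h1 0; [rewrite cm0|exact: hasd_ccont hd0].
- by move=> u /andP[_]; exact: h1.
- move=> u ur; have := hr u ur.
  have -> : 1 - e' = (1 + e)^-1 by rewrite /e'; field; rewrite gt_eqF.
  move=> hu; have m0 : 0 < cm (mob z u) by apply: lt_le_trans hu; rewrite invr_gt0.
  have mz : mob z u != 0 by rewrite -cm_gt0.
  rewrite /g (negbTE mz) cm_div ler_pdivrMr //.
  apply: le_trans (sf.2 _ (mob_lt1 z1 _)) _; first by rewrite ur; case/andP: r01.
  by rewrite -ler_pdivrMl // mulr1.
Qed.

Lemma schwarz f z : schur f -> f 0 = 0 -> cm z < 1 -> cm (f z) <= cm z.
Proof.
move=> sf f0 z1; have [|d hd] := sf.1 0; first by rewrite cm0.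
have [_ /(_ z z1)] := schwarz_quotient sf f0 hd.
have [->|z0] := eqVneq z 0; first by rewrite f0.
by rewrite cm_div ler_pdivrMr ?cm_gt0 // mul1r.
Qed.

(** Schwarz's lemma for the composition of [mob w], [f] and [mob (- f w)]. *)
Lemma schwarz_pick_strict f z w : schur f -> cm z < 1 -> cm w < 1 -> cm (f w) < 1 ->
  cm (f z - f w) * cm (1 - w^* * z) <= cm (z - w) * cm (1 - (f w)^* * f z).
Proof.
move=> sf z1 w1 fw1.
have s1 : schur (fun u => mob (- f w) (f (mob w u))).
  apply: (schur_mob_comp (f := fun u => f (mob w u))); first exact: cmN_lt1.
  by apply: schur_comp sf (hol_mob w1) _ => u; exact: mob_lt1.
have := schwarz (z := mob (- w) z) s1; rewrite mob0 mobN => /(_ erefl).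
have wN := cmN_lt1 w1.
have := mobK wN (ltW z1); rewrite opprK => ->.
move=> /(_ (mob_lt1 wN z1)).
have d1 := mob_den wN (ltW z1); have d2 := mob_den (cmN_lt1 fw1) (sf.2 z z1).
rewrite /mob !rmorphN !mulNr in d1 d2 *.
rewrite !cm_div ler_pdivrMr ?cm_gt0 // mulrAC ler_pdivlMr ?cm_gt0 //.
Qed.

(** If [f w] lies on the circle, [mob (- f w)] is degenerate; so the strict
    case is applied to [(1 - t)%:C * f] with [t] tending to 0. *)
Theorem schwarz_pick f z w : schur f -> cm z < 1 -> cm w < 1 ->
  cm (f z - f w) * cm (1 - w^* * z) <= cm (z - w) * cm (1 - (f w)^* * f z).
Proof.
move=> sf z1 w1; apply/ler_addgt0Pr => e e0.
set A := cm (f z - f w) * _; set B := cm (z - w).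
have A0 : 0 <= A by rewrite mulr_ge0 ?cm_ge0.
have B0 : 0 <= B by exact: cm_ge0.
have [t [t0 t1 t2]] : exists t, [/\ 0 < t, t <= 1/2 & t * (A + 2 * B + 1) <= e].
  exists (Num.min (1/2) (e / (A + 2 * B + 1))); have AB : 0 < A + 2 * B + 1 by lra.
  by rewrite lt_min !divr_gt0 // -ler_pdivlMr // !ge_min !lexx orbT.
have bd u : cm u < 1 -> cm ((1 - t)%:C * f u) <= 1 - t.
  move=> u1; rewrite cmM cm_real ger0_norm ?subr_ge0; last by lra.
  by rewrite ler_piMr ?(sf.2 u u1) //; lra.
have st : schur (fun u => (1 - t)%:C * f u).
  split=> u u1; last by apply: le_trans (bd u u1) _; lra.
  have [d hd] := sf.1 u u1; exists ((1 - t)%:C * d).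
  by apply: hasd_eq (hasdM (hasd_cst _ u) hd) _; rewrite mul0r add0r.
have bw : cm ((1 - t)%:C * f w) < 1 by apply: le_lt_trans (bd w w1) _; lra.
have := schwarz_pick_strict st z1 w1 bw.
rewrite -mulrBr cmM cm_real ger0_norm; last by lra.
have cj : ((1 - t)%:C * f w)^* = (1 - t)%:C * (f w)^* by rewrite rmorphM /= conj_real.
rewrite cj -mulrA -/A.
have : cm (1 - (1 - t)%:C * (f w)^* * ((1 - t)%:C * f z)) <= cm (1 - (f w)^* * f z) + 2 * t.
  have -> : 1 - (1 - t)%:C * (f w)^* * ((1 - t)%:C * f z)
      = (1 - (f w)^* * f z) + (1 - (1 - t) ^+ 2)%:C * ((f w)^* * f z).
    by rewrite !rmorphB rmorphXn rmorphB rmorph1 /=; ring.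
  apply: le_trans (cmD _ _) _; rewrite lerD2l cmM cm_real ger0_norm; last by nra.
  rewrite cmM cmJ; have p : cm (f w) * cm (f z) <= 1.
    by apply: mulr_ile1; rewrite ?cm_ge0 ?sf.2.
  apply: (@le_trans _ _ (1 - (1 - t) ^+ 2)); last by nra.
  by rewrite ler_piMr //; nra.
move=> /(ler_wpM2l B0); rewrite mulrDr.
move: t2; rewrite !mulrDr mulr1 => t2 h1 h2.
have tA : 0 <= t * A by rewrite mulr_ge0 // ltW.
have tB : 0 <= t * B by rewrite mulr_ge0 // ltW.
have : A = (1 - t) * A + t * A by ring.
by nra.
Qed.

(** A quantitative maximum principle: by Schwarz-Pick, values that are close
    to the circle cannot move much. The errors in the construction and the
    rigidity in the converse are both controlled by it. *)
Lemma schur_close0 f z (r : R) : schur f -> r < 1 -> cm z <= r ->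
  cm (f z - f 0) <= 2 / (1 - r) * (1 - cm (f 0)) /\
  cm (f z - f 0) <= 2 / (1 - r) * (1 - cm (f z)).
Proof.
move=> sf r1 zr; have z1 := le_lt_trans zr r1.
have o1 : cm (0 : C) < 1 by rewrite cm0.
have main (u v : C) : cm u <= 1 -> cm v <= 1 -> cm (u - v) <= r * cm (1 - v^* * u) ->
    cm (u - v) <= 2 / (1 - r) * (1 - cm v).
  move=> u1 v1 h.
  have r0 : 0 <= r := le_trans (cm_ge0 z) zr.
  rewrite mulrAC ler_pdivlMr ?subr_gt0 // mulrBr mulr1.
  have : cm (1 - v^* * u) <= 2 * (1 - cm v) + cm (u - v).
    have -> : 1 - v^* * u = (1 - cm v ^+ 2)%:C - v^* * (u - v).
      by rewrite rmorphB rmorph1 /= cm_sqr; ring.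
    apply: le_trans (cmDB _ _) _; have v0 := cm_ge0 v.
    rewrite cm_real ger0_norm ?sqr1_ge0 // cmM cmJ.
    apply: lerD; first by nra.
    by rewrite ler_piMl // cm_ge0.
  move=> /(ler_wpM2l r0); rewrite mulrDr.
  have : r * (2 * (1 - cm v)) <= 2 * (1 - cm v) by rewrite ler_piMl ?(ltW r1) // mulr_ge0 // subr_ge0.
  by lra.
have f0 := sf.2 _ o1; have fz := sf.2 _ z1.
split.
  apply: main => //; have := schwarz_pick sf z1 o1.
  rewrite conjC0 mul0r !subr0 cm1 mulr1 => h; apply: le_trans h _.
  by rewrite ler_wpM2r // cm_ge0.
rewrite cmB; apply: main => //; have := schwarz_pick sf o1 z1.
rewrite mulr0 !sub0r subr0 cm1 mulr1 cmN => h; apply: le_trans h _.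
by rewrite ler_wpM2r // cm_ge0.
Qed.

(** The constant in [schur_taylor] is the same for the whole Schur class, so
    the difference quotients of a pointwise limit still satisfy the hypothesis
    of [derivable_of_cauchy_quotients]. *)
Lemma schur_limit (u : nat -> C -> C) f : (forall n, schur (u n)) ->
  (forall z, cm z < 1 -> forall e : R, 0 < e ->
     exists N, forall n, (N <= n)%N -> cm (u n z - f z) <= e) -> schur f.
Proof.
move=> su lim; split=> z z1; last first.
  apply/ler_addgt0Pr => e e0; have [N hN] := lim z z1 e e0.
  have := hN N (leqnn N); have := (su N).2 z z1; have := cm_tri (u N z) (f z) 0.
  by rewrite !subr0 [cm (f z - _)]cmB; lra.
pose del := (1 - cm z) / 4.
have d0 : 0 < del by rewrite divr_gt0 // subr_gt0.
have rd : cm z + 4 * del <= 1 by rewrite /del; lra.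
apply: (derivable_of_cauchy_quotients d0 (L := 16 / del ^+ 2)) => h k h0 k0 hd kd.
have q n : cm ((u n (z + h) - u n z) / h - (u n (z + k) - u n z) / k) <= 16 / del ^+ 2 * (cm h + cm k).
  have [d hd'] := (su n).1 z z1.
  have one v : v != 0 -> cm v < del -> cm ((u n (z + v) - u n z) / v - d) <= 16 / del ^+ 2 * cm v.
    move=> v0 vd.
    have -> : (u n (z + v) - u n z) / v - d = (u n (z + v) - u n z - d * v) / v by field.
    rewrite cm_div ler_pdivrMr ?cm_gt0 // -[leRHS]mulrA -expr2.
    by apply: (schur_taylor (su n) d0 rd) (ltW vd) hd'; lra.
  have := cmDB ((u n (z + h) - u n z) / h - d) ((u n (z + k) - u n z) / k - d).
  have := one h h0 hd; have := one k k0 kd.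
  rewrite opprB addrA subrK mulrDr; lra.
have zh : cm (z + h) < 1 by have := cmD z h; lra.
have zk : cm (z + k) < 1 by have := cmD z k; lra.
apply/ler_addgt0Pr => e e0.
have ch : 0 < cm h by rewrite cm_gt0. have ck : 0 < cm k by rewrite cm_gt0.
pose e' := e * Num.min (cm h) (cm k) / 4.
have [m0 m1 m2] : [/\ 0 < Num.min (cm h) (cm k), Num.min (cm h) (cm k) <= cm h &
    Num.min (cm h) (cm k) <= cm k] by rewrite lt_min ch ck !ge_min !lexx orbT.
have e'0 : 0 < e' by rewrite divr_gt0 // mulr_gt0.
have [N1 H1] := lim _ z1 _ e'0; have [N2 H2] := lim _ zh _ e'0; have [N3 H3] := lim _ zk _ e'0.
pose n := maxn N1 (maxn N2 N3).
have {}H1 := H1 n (leq_maxl _ _).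
have {}H2 := H2 n (leq_trans (leq_maxl _ _) (leq_maxr _ _)).
have {}H3 := H3 n (leq_trans (leq_maxr _ _) (leq_maxr _ _)).
have part v : 0 < cm v -> Num.min (cm h) (cm k) <= cm v -> cm (u n (z + v) - f (z + v)) <= e' ->
    cm ((f (z + v) - f z) / v - (u n (z + v) - u n z) / v) <= e / 2.
  move=> v0 mv Hv; rewrite -mulrBl cm_div ler_pdivrMr //.
  have -> : f (z + v) - f z - (u n (z + v) - u n z) = (u n z - f z) - (u n (z + v) - f (z + v)) by ring.
  apply: le_trans (cmDB _ _) _.
  have : e * Num.min (cm h) (cm k) <= e * cm v by rewrite ler_wpM2l // ltW.
  by move: H1 Hv; rewrite /e'; lra.
have P1 := part h ch m1 H2; have P2 := part k ck m2 H3.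
set A := (f (z + h) - f z) / h in P1 *; set B := (f (z + k) - f z) / k in P2 *.
have := q n; set A' := (u n (z + h) - _) / h in P1 *; set B' := (u n (z + k) - _) / k in P2 *.
have -> : A - B = (A - A') - (B - B') + (A' - B') by ring.
have := cmD ((A - A') - (B - B')) (A' - B'); have := cmDB (A - A') (B - B').
by lra.
Qed.

End SchwarzPick.

(** * Finite Blaschke products and the Schur step *)

Section FiniteBlaschke.
Variable R : realType.
Local Notation C := R[i].
Implicit Types (c x y z w : C) (X : seq C) (f : C -> C).

Definition fbp c X z := c * \prod_(x <- X) mob (- x) z.

Definition in_disc X := forall x, x \in X -> cm x < 1.

Lemma in_disc_cons x X : in_disc (x :: X) <-> cm x < 1 /\ in_disc X.
Proof.
split=> [h|[h1 h2] y].
  by split=> [|y yX]; apply: h; rewrite inE ?eqxx // yX orbT.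
by rewrite inE => /orP[/eqP->//|/h2].
Qed.

Lemma fbp_le1 c X z : cm c = 1 -> in_disc X -> cm z <= 1 -> cm (fbp c X z) <= 1.
Proof.
move=> c1 X1 z1; rewrite /fbp cmM c1 mul1r cm_prod.
elim: X X1 => [|x X IH]; first by rewrite big_nil.
move=> /in_disc_cons[x1 X1]; rewrite big_cons mulr_ile1 ?cm_ge0 ?IH //.
  by rewrite prodr_ge0 // => i _; exact: cm_ge0.
by rewrite mob_le1 ?cmN.
Qed.

Lemma fbp_eq1 c X z : cm c = 1 -> in_disc X -> cm z = 1 -> cm (fbp c X z) = 1.
Proof.
move=> c1 X1 z1; rewrite /fbp cmM c1 mul1r cm_prod.
elim: X X1 => [|x X IH]; first by rewrite big_nil.
by move=> /in_disc_cons[x1 X1]; rewrite big_cons IH // mob_eq1 ?cmN // mul1r.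
Qed.

Lemma fbp_hasd c X z : in_disc X -> cm z <= 1 -> exists d, hasd (fbp c X) z d.
Proof.
move=> X1 z1.
suff [d hd] : exists d, hasd (fun z => \prod_(x <- X) mob (- x) z) z d.
  by exists (0 * (\prod_(x <- X) mob (- x) z) + c * d); exact: hasdM (hasd_cst c z) hd.
elim: X X1 => [_|x X IH /in_disc_cons[x1 /IH[d hd]]].
  exists 0; have -> : (fun z => \prod_(x <- [::]) mob (- x) z) = (fun=> 1).
    by apply/funext => u; rewrite big_nil.
  exact: hasd_cst.
have -> : (fun z => \prod_(x <- x :: X) mob (- x) z) = (fun z => mob (- x) z * \prod_(x <- X) mob (- x) z).
  by apply/funext => u; rewrite big_cons.
by eexists; apply: hasdM hd; apply: hasd_mob z1; rewrite cmN.
Qed.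

Lemma schur_fbp c X : cm c = 1 -> in_disc X -> schur (fbp c X).
Proof.
move=> c1 X1; split=> z z1; first by apply: fbp_hasd => //; exact: ltW.
by apply: fbp_le1 => //; exact: ltW.
Qed.

(** With the next lemma: the reflection of [z] in the unit circle exchanges
    the numerator and the denominator of a Blaschke product. *)
Lemma prod_subC_conj X z : z != 0 ->
  z ^+ size X * (\prod_(x <- X) (z^*^-1 - x))^* = \prod_(x <- X) (1 - x^* * z).
Proof.
move=> z0; elim: X => [|x X IH]; first by rewrite !big_nil conjC1 mulr1.
rewrite !big_cons -IH exprS rmorphM rmorphB fmorphV /= conjCK.
by rewrite -[RHS]mulr1 -(divff z0); field.
Qed.

Lemma prod_1subC_conj X z : z != 0 ->
  z ^+ size X * (\prod_(x <- X) (1 - x^* * z^*^-1))^* = \prod_(x <- X) (z - x).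
Proof.
move=> z0; elim: X => [|x X IH]; first by rewrite !big_nil conjC1 mulr1.
rewrite !big_cons -IH exprS rmorphM rmorphB rmorphM fmorphV rmorph1 /= !conjCK.
by rewrite -[RHS]mulr1 -(divff z0); field.
Qed.

(** Outside the disc the modulus of a Blaschke product is at least 1, stated
    without dividing. *)
Lemma cm_prod_ge X y : in_disc X -> 1 <= cm y ->
  cm (\prod_(x <- X) (1 - x^* * y)) <= cm (\prod_(x <- X) (y - x)).
Proof.
move=> X1 y1; rewrite !cm_prod; elim: X X1 => [|x X IH]; first by rewrite !big_nil.
move=> /in_disc_cons[x1 /IH h]; rewrite !big_cons; apply: ler_pM h => //.
- exact: cm_ge0.
- by rewrite prodr_ge0 // => i _; exact: cm_ge0.
rewrite -ler_sqr ?nnegrE ?cm_ge0 // -subr_le0.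
have := cm_mob_identity (- x) y; rewrite rmorphN mulNr cmN => ->.
by rewrite mulr_ge0_le0 ?sqr1_ge0 ?cm_ge0 ?(ltW x1) // subr_le0 exprn_ege1.
Qed.

Lemma prod_sub_neq0 X y : in_disc X -> 1 <= cm y -> \prod_(x <- X) (y - x) != 0.
Proof.
move=> X1 y1; rewrite prodf_seq_neq0; apply/allP => x /X1 x1 /=.
by rewrite subr_eq0; apply/eqP => e; move: y1; rewrite e leNgt x1.
Qed.

Lemma prod_1sub_neq0 X z : in_disc X -> cm z <= 1 -> \prod_(x <- X) (1 - x^* * z) != 0.
Proof.
move=> X1 z1; rewrite prodf_seq_neq0; apply/allP => x /X1 x1 /=.
by have := mob_den (cmN_lt1 x1) z1; rewrite rmorphN mulNr.
Qed.

Lemma fbpE c X z : fbp c X z = c * \prod_(x <- X) (z - x) / \prod_(x <- X) (1 - x^* * z).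
Proof.
rewrite /fbp -mulrA -prodf_div; congr (_ * _); apply: eq_bigr => x _.
by rewrite /mob rmorphN mulNr.
Qed.

(** Up to its denominator, the left-hand side is [z * B z + g] for the
    Blaschke product [B] with constant [c] and zeros [X]. At a root outside
    the open disc the first term would have modulus at least 1 by
    [cm_prod_ge], and [g] is smaller. *)
Lemma schur_step_roots c g X : cm c = 1 -> cm g < 1 -> in_disc X ->
  exists Y, [/\ size Y = (size X).+1, in_disc Y &
    forall z, c * z * \prod_(x <- X) (z - x) + g * \prod_(x <- X) (1 - x^* * z)
      = c * \prod_(y <- Y) (z - y)].
Proof.
move=> c1 g1 X1; have c0 : c != 0 by rewrite -cm_gt0 c1.
pose P := \prod_(x <- X) ('X - x%:P); pose S := \prod_(x <- X) (1 - x^* *: 'X : {poly C}).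
have hP z : P.[z] = \prod_(x <- X) (z - x).
  by rewrite /P horner_prod; apply: eq_bigr => x _; rewrite !hornerE.
have hS z : S.[z] = \prod_(x <- X) (1 - x^* * z).
  by rewrite /S horner_prod; apply: eq_bigr => x _; rewrite !hornerE.
have sP : size P = (size X).+1 by rewrite size_prod_XsubC.
have lP : lead_coef P = 1 by rewrite lead_coef_prod_XsubC.
have sS : (size S <= (size X).+1)%N.
  rewrite /S; elim: (X) => [|x s IH]; first by rewrite big_nil size_poly1.
  rewrite big_cons; apply: leq_trans (size_polyMleq _ _) _.
  have s2 : (size (1 - x^* *: 'X : {poly C})%R <= 2)%N.
    apply: leq_trans (size_polyD _ _) _; rewrite size_polyN geq_max size_poly1 /=.
    by apply: leq_trans (size_scale_leq _ _) _; rewrite size_polyX.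
  by rewrite -subn1 leq_subLR; exact: leq_add s2 IH.
pose Q := c *: (P * 'X) + g *: S.
have sPX : size (c *: (P * 'X)) = (size X).+2.
  by rewrite size_scale // size_mulX ?sP // -size_poly_gt0 sP.
have slt : (size (g *: S) < size (c *: (P * 'X))%R)%N.
  by rewrite sPX ltnS (leq_trans (size_scale_leq _ _)).
have sQ : size Q = (size X).+2 by rewrite /Q size_polyDl.
have lQ : lead_coef Q = c by rewrite /Q lead_coefDl // lead_coefZ lead_coefMX lP mulr1.
have [Y QY] := closed_field_poly_normal Q.
rewrite lQ in QY.
have hQ z : c * z * \prod_(x <- X) (z - x) + g * \prod_(x <- X) (1 - x^* * z)
      = c * \prod_(y <- Y) (z - y).
  have -> : c * \prod_(y <- Y) (z - y) = Q.[z].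
    rewrite QY hornerZ horner_prod; congr (_ * _).
    by apply: eq_bigr => x _; rewrite !hornerE.
  by rewrite /Q hornerD !hornerZ hornerM hornerX hP hS; ring.
have sY : size Y = (size X).+1.
  by apply: succn_inj; rewrite -sQ QY size_scale // size_prod_XsubC.
exists Y; split=> // y yY; rewrite ltNge; apply/negP => y1.
have := hQ y; have -> : \prod_(u <- Y) (y - u) = 0.
  by apply/eqP; rewrite prodf_seq_eq0; apply/hasP; exists y; rewrite //= subrr.
rewrite mulr0 => /eqP; rewrite addr_eq0 => /eqP /(congr1 (@cm R)).
rewrite cmN !cmM c1 mul1r.
have p0 : 0 < cm (\prod_(x <- X) (y - x)) by rewrite cm_gt0 prod_sub_neq0.
have := cm_prod_ge X1 y1; have := cm_ge0 (\prod_(x <- X) (1 - x^* * y)).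
have := cm_ge0 g; nra.
Qed.

(** Finite Blaschke products are stable under the inverse of a Schur step:
    [schur_step_roots] factors the numerator, and the denominator is its
    reflection in the circle. *)
Lemma fbp_schur_step c g X : cm c = 1 -> cm g < 1 -> in_disc X ->
  exists Y, [/\ size Y = (size X).+1, in_disc Y &
    forall z, cm z <= 1 -> mob g (z * fbp c X z) = fbp c Y z].
Proof.
move=> c1 g1 X1; have [Y [sY Y1 hY]] := schur_step_roots c1 g1 X1.
exists Y; split=> // z z1; rewrite !fbpE.
have cc : c * c^* = 1 by rewrite -cm_sqr c1 expr1n.
have D0 := prod_1sub_neq0 X1 z1; have E0 := prod_1sub_neq0 Y1 z1.
(* The denominator: conjugate the factored numerator at the reflected point.
   At [z = 0], where there is no such point, both sides are 1. *)
have star : \prod_(x <- X) (1 - x^* * z) + g^* * c * z * \prod_(x <- X) (z - x)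
    = \prod_(y <- Y) (1 - y^* * z).
  have [->|z0] := eqVneq z 0.
    rewrite mulr0 mul0r addr0 !big1 // => i _; by rewrite mulr0 subr0.
  rewrite -(prod_subC_conj Y z0) sY.
  have /(congr1 (fun u => u^*)) := hY (z^*^-1).
  rewrite rmorphD !rmorphM fmorphV /= conjCK => h.
  have -> : z ^+ (size X).+1 * (\prod_(x <- Y) (z^*^-1 - x))^*
     = c * z ^+ (size X).+1 * (c^* * (\prod_(x <- Y) (z^*^-1 - x))^*).
    by rewrite mulrACA cc mul1r.
  rewrite -h -(prod_subC_conj X z0) -(prod_1subC_conj X z0) exprS.
  set A := (\prod_(x <- X) (_ - x))^*; set B := (\prod_(x <- X) (1 - _))^*.
  have -> : c * (z * z ^+ size X) * (c^* / z * A + g^* * B)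
     = (c * c^*) * (z / z) * (z ^+ size X * A) + g^* * c * z * (z ^+ size X * B) by ring.
  by rewrite cc divff // !mul1r.
rewrite -hY -star /mob.
by rewrite -star in E0; field; rewrite D0 E0 /=.
Qed.

End FiniteBlaschke.

(** * Caratheodory approximation with boundary interpolation *)

Section Caratheodory.
Variable R : realType.
Local Notation C := R[i].
Implicit Types (c x y z w p q : C) (X : seq C) (f : C -> C).

Lemma circle_conj p : cm p = 1 -> p * p^* = 1.
Proof. by move=> p1; rewrite -cm_sqr p1 expr1n. Qed.

Lemma circle_conjV p : cm p = 1 -> p^* = p^-1.
Proof.
move=> p1; have p0 : p != 0 by rewrite -cm_gt0 p1.
by apply: (mulfI p0); rewrite circle_conj // divff.
Qed.

(** In the half-plane model of the disc with 1 at infinity, these are the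
    preimages of the base point under horizontal translations. *)
Lemma disc_of_real (t : C) : t^* = t -> t - 2 * 'i != 0 /\ cm (t / (t - 2 * 'i)) < 1.
Proof.
move=> tr.
have sq : cm (t - 2 * 'i) ^+ 2 = cm t ^+ 2 + 4.
  apply: complexI; rewrite (rmorphD (real_complex R)) /= !cm_sqr.
  rewrite rmorphB rmorphM /= conjCi tr rmorph_nat.
  have -> : (t - 2 * 'i) * (t - 2 * - 'i) = t * t - 4 * 'i ^+ 2 by ring.
  by rewrite sqrCi rmorph_nat; ring.
have s0 : 0 < cm (t - 2 * 'i).
  rewrite lt_def cm_ge0 andbT; apply/eqP => h; move: sq; rewrite h expr0n /=.
  by have := sqr_ge0 (cm t); lra.
split; first by rewrite -cm_gt0.
rewrite cm_div ltr_pdivrMr // mul1r -ltr_sqr ?nnegrE ?cm_ge0 // sq.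
by rewrite ltrDl.
Qed.

(** One Blaschke factor suffices if both pairs are distinct. Rotations reduce
    to the case [p1 = q1 = 1]; the automorphisms that fix only 1 are
    translations in the half-plane model, and the one sending [p2] to [q2] has
    zero [t / (t - 2 * 'i)] for the real number [t] below. *)
Lemma circle_interpolation p1 p2 q1 q2 : cm p1 = 1 -> cm p2 = 1 -> cm q1 = 1 -> cm q2 = 1 ->
  (p1 = p2 -> q1 = q2) ->
  exists c X, [/\ cm c = 1, in_disc X, fbp c X p1 = q1 & fbp c X p2 = q2].
Proof.
move=> P1 P2 Q1 Q2 hpq.
have [->|q12] := eqVneq q1 q2.
  by exists q2, [::]; split=> //; rewrite /fbp big_nil mulr1.
have p12 : p1 != p2 by apply: contra q12 => /eqP /hpq ->.
have nz (u : C) : cm u = 1 -> u != 0 by move=> u1; rewrite -cm_gt0 u1.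
have [p10 p20 q10 q20] := And4 (nz _ P1) (nz _ P2) (nz _ Q1) (nz _ Q2).
pose p := p2 / p1; pose q := q2 / q1.
have p_1 : cm p = 1 by rewrite cm_div P1 P2 divr1.
have q_1 : cm q = 1 by rewrite cm_div Q1 Q2 divr1.
have p0 := nz _ p_1; have q0 := nz _ q_1.
have p1' : 1 - p != 0 by rewrite subr_eq0 eq_sym /p; apply: contra p12 => /eqP h;
  rewrite eq_sym -[p2](divfK p10) h mul1r.
have q1' : 1 - q != 0 by rewrite subr_eq0 eq_sym /q; apply: contra q12 => /eqP h;
  rewrite eq_sym -[q2](divfK q10) h mul1r.
have i0 : ('i : C) != 0 by rewrite neq0Ci.
have i2 : ('i : C) * 'i = -1 by rewrite -expr2 sqrCi.
pose t : C := 2 * 'i * (q - p) / ((1 - q) * (1 - p)).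
have tr : t^* = t.
  rewrite /t rmorphM rmorphM rmorphM rmorph_nat /= conjCi fmorphV rmorphM !rmorphB rmorph1 /=.
  rewrite (circle_conjV p_1) (circle_conjV q_1).
  have e1 : 1 - q^-1 = - (1 - q) / q by field.
  have e2 : 1 - p^-1 = - (1 - p) / p by field.
  by rewrite e1 e2; field; rewrite p0 q0 p1' q1'.
have tE : t = 2 * 'i * (q - p) / ((1 - q) * (1 - p)) by [].
clearbody t.
have [D0 x1] := disc_of_real tr.
have D0' : t + 2 * 'i != 0.
  apply: contra D0 => /eqP /(congr1 (fun u => u^*)).
  rewrite rmorphD rmorphM rmorph_nat /= conjCi tr rmorph0 mulrN => ->; exact: eqxx.
pose x := t / (t - 2 * 'i).
have xc : x^* = t / (t + 2 * 'i).
  by rewrite /x rmorphM fmorphV rmorphB rmorphM rmorph_nat /= conjCi !tr mulrN opprK.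
pose y := p1 * x; have y1 : cm y < 1 by rewrite cmM P1 mul1r.
have m1 : cm (mob (- y) p1) = 1 by rewrite mob_eq1 ?cmN.
have m0 := nz _ m1.
exists (q1 / mob (- y) p1), [:: y]; split.
- by rewrite cm_div Q1 m1 divr1.
- by move=> u; rewrite inE => /eqP ->.
- by rewrite /fbp big_seq1 divfK.
rewrite /fbp big_seq1.
suff -> : mob (- y) p2 = q * mob (- y) p1 by rewrite /q; field; rewrite q10 m0.
have p2E : p2 = p1 * p by rewrite /p; field.
have den (u : C) : 1 + (- y)^* * (p1 * u) = 1 - x^* * u.
  rewrite rmorphN /y rmorphM /= (circle_conjV P1); field.
  exact: p10.
have E1 : 1 - x = - (2 * 'i) / (t - 2 * 'i) by rewrite /x; field.
have E2 : 1 - x^* * 1 = 2 * 'i / (t + 2 * 'i) by rewrite xc; field.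
have tp : t * (1 - p) = 2 * 'i * (q - p) / (1 - q) by rewrite tE; field; rewrite q1' p1'.
have E3 : p - x = (- (2 * 'i) * q * (1 - p) / (1 - q)) / (t - 2 * 'i).
  have -> : p - x = (- (t * (1 - p)) - p * (2 * 'i)) / (t - 2 * 'i) by rewrite /x; field.
  by congr (_ / _); rewrite tp; field.
have E4 : 1 - x^* * p = (2 * 'i * (1 - p) / (1 - q)) / (t + 2 * 'i).
  have -> : 1 - x^* * p = (t * (1 - p) + 2 * 'i) / (t + 2 * 'i) by rewrite xc; field.
  by congr (_ / _); rewrite tp; field.
have -> : mob (- y) p2 = p1 * (p - x) / (1 - x^* * p).
  by rewrite p2E /mob den; congr (_ / _); rewrite /y; ring.
have -> : mob (- y) p1 = p1 * (1 - x) / (1 - x^* * 1).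
  by rewrite -{1 2}[p1]mulr1 /mob den; congr (_ / _); rewrite /y; ring.
rewrite E1 E2 E3 E4; have two0 : (2 : C) != 0 by rewrite pnatr_eq0.
by field; rewrite D0 D0' i0 q1' p1'.
Qed.

Lemma cm_1D_sqr (k : R) z : cm (1 + k%:C * z) ^+ 2
  = 1 + 2 * k * complex.Re z + k ^+ 2 * cm z ^+ 2.
Proof.
have sq (u : C) : cm u ^+ 2 = complex.Re u ^+ 2 + complex.Im u ^+ 2.
  by rewrite /cm normc_def /= sqr_sqrtr // addr_ge0 ?sqr_ge0.
by rewrite !sq; case: z => a b /=; ring.
Qed.

(** A bound on the pseudo-hyperbolic distance that avoids dividing, since the
    denominator may vanish for [u] and [v] on the circle. *)
Definition rho_le (k : R) u v := cm (u - v) <= k * cm (1 - v^* * u).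

Lemma rho_le1 u v : cm u <= 1 -> cm v <= 1 -> rho_le 1 u v.
Proof.
move=> u1 v1; rewrite /rho_le mul1r -ler_sqr ?nnegrE ?cm_ge0 // -subr_ge0.
have := cm_mob_identity (- v) u; rewrite rmorphN mulNr cmN => ->.
by rewrite mulr_ge0 ?sqr1_ge0 ?cm_ge0.
Qed.

Lemma rho_le_mob g k u v : cm g < 1 -> cm u <= 1 -> cm v <= 1 -> 0 <= k ->
  rho_le k u v -> rho_le k (mob g u) (mob g v).
Proof.
move=> g1 u1 v1 k0 h; have du := mob_den g1 u1; have dv := mob_den g1 v1.
have dvc : (1 + g^* * v)^* != 0 by rewrite conjC_eq0.
have e1 : mob g u - mob g v = (1 - g * g^*) * (u - v) / ((1 + g^* * u) * (1 + g^* * v)).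
  by rewrite /mob; field; rewrite du dv.
have e2 : 1 - (mob g v)^* * mob g u
    = (1 - g * g^*) * (1 - v^* * u) / ((1 + g^* * u) * (1 + g^* * v)^*).
  move: dvc; rewrite /mob rmorphM fmorphV !rmorphD rmorphM rmorph1 /= conjCK => dvc.
  by field; rewrite du dvc.
rewrite /rho_le e1 e2 !cm_div ![cm (_ * _)]cmM cmJ mulrA.
rewrite ler_pM2r; last by rewrite invr_gt0 mulr_gt0 ?cm_gt0.
by rewrite mulrCA ler_wpM2l ?cm_ge0.
Qed.

(** The pseudo-hyperbolic distance of [r] and [- r]: multiplication by numbers
    of modulus at most [r] contracts distances at least by this factor. *)
Definition kap (r : R) : R := 2 * r / (1 + r ^+ 2).

Lemma kap_bounds (r : R) : 0 <= r < 1 -> 0 <= kap r < 1.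
Proof.
move=> /andP[r0 r1]; have d : 0 < 1 + r ^+ 2 by rewrite ltr_wpDr ?sqr_ge0.
rewrite /kap divr_ge0 ?(ltW d) ?mulr_ge0 //= ltr_pdivrMr // mul1r.
have : 0 < (1 - r) ^+ 2 by rewrite exprn_gt0 // subr_gt0.
by rewrite sqrrB expr1n mul1r; lra.
Qed.

(** The contraction is weakest for opposite points of the circle. With [ze]
    the product of [u] and the conjugate of [v], the claim reduces to [key],
    where the difference of the squares of the two sides is a sum of
    nonnegative terms. *)
Lemma rho_le_scale (r k : R) z u v : cm z <= r -> r < 1 -> cm u <= 1 -> cm v <= 1 -> 0 <= k ->
  rho_le k u v -> rho_le (kap r * k) (z * u) (z * v).
Proof.
move=> zr r1 u1 v1 k0 h; have z0 := cm_ge0 z.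
have kb : 0 <= kap r < 1 by apply: kap_bounds; rewrite (le_trans z0 zr).
set ze := v^* * u in h.
pose t := cm z.
have t2 : (t ^+ 2)%:C = z * z^* by rewrite cm_sqr.
have key : (1 + t ^+ 2) * cm (1 - ze) <= 2 * cm (1 - (t ^+ 2)%:C * ze).
  have d0 : 0 <= 1 + t ^+ 2 by rewrite addr_ge0 ?sqr_ge0.
  rewrite -ler_sqr ?nnegrE ?mulr_ge0 ?cm_ge0 // -subr_ge0 !exprMn.
  have ze1 : cm ze ^+ 2 <= 1.
    by rewrite expr_le1 ?cm_ge0 // cmM cmJ mulr_ile1 ?cm_ge0.
  have -> : 2 ^+ 2 * cm (1 - (t ^+ 2)%:C * ze) ^+ 2 - (1 + t ^+ 2) ^+ 2 * cm (1 - ze) ^+ 2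
     = (1 - t ^+ 2) ^+ 2 * cm (1 + ze) ^+ 2 + 2 * (1 - t ^+ 4) * (1 - cm ze ^+ 2).
    have -> : 1 - ze = 1 + (-1)%:C * ze by rewrite rmorphN rmorph1 mulN1r.
    have -> : 1 - (t ^+ 2)%:C * ze = 1 + (- t ^+ 2)%:C * ze by rewrite rmorphN mulNr.
    have -> : 1 + ze = 1 + 1%:C * ze by rewrite mul1r.
    by rewrite !cm_1D_sqr; ring.
  have t1 : t ^+ 4 <= 1 by rewrite exprn_ile1 // (le_trans zr) // ltW.
  by rewrite addr_ge0 // mulr_ge0 ?sqr_ge0 // ?subr_ge0 // mulr_ge0 // subr_ge0.
have tk : t * 2 <= kap r * (1 + t ^+ 2).
  rewrite /kap mulrAC ler_pdivlMr; last by rewrite ltr_wpDr ?sqr_ge0.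
  have : 0 <= (r - t) * (1 - r * t).
    rewrite mulr_ge0 ?subr_ge0 // mulr_ile1 //; first exact: le_trans zr.
      exact: ltW.
    by rewrite /t (le_trans zr) // ltW.
  by rewrite !expr2; nra.
rewrite /rho_le -mulrBr cmM.
have -> : 1 - (z * v)^* * (z * u) = 1 - (t ^+ 2)%:C * ze.
  by rewrite t2 rmorphM /= /ze; ring.
have cm1 := cm_ge0 (1 - ze); have cm2 := cm_ge0 (1 - (t ^+ 2)%:C * ze).
have d1 : 0 < 1 + t ^+ 2 by rewrite ltr_wpDr ?sqr_ge0.
apply: (@le_trans _ _ (t * (k * cm (1 - ze)))); first by rewrite ler_wpM2l.
rewrite -(ler_pM2l d1).
have -> : (1 + t ^+ 2) * (t * (k * cm (1 - ze))) = t * k * ((1 + t ^+ 2) * cm (1 - ze)) by ring.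
apply: (@le_trans _ _ (t * k * (2 * cm (1 - (t ^+ 2)%:C * ze)))).
  by rewrite ler_wpM2l // mulr_ge0.
have -> : t * k * (2 * cm (1 - (t ^+ 2)%:C * ze)) = t * 2 * (k * cm (1 - (t ^+ 2)%:C * ze)) by ring.
have -> : (1 + t ^+ 2) * (kap r * k * cm (1 - (t ^+ 2)%:C * ze))
   = kap r * (1 + t ^+ 2) * (k * cm (1 - (t ^+ 2)%:C * ze)) by ring.
by rewrite ler_wpM2r // mulr_ge0.
Qed.

Lemma mob_strict_bound (s : R) g w : s < 1 -> cm g <= s -> cm w <= s ->
  cm (mob (- g) w) <= 1 - (1 - s ^+ 2) ^+ 2 / 8.
Proof.
move=> s1 gs ws; have s0 := le_trans (cm_ge0 g) gs.
have g1 : cm (- g) < 1 by rewrite cmN (le_lt_trans gs).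
have w1 : cm w <= 1 by rewrite (le_trans ws) // ltW.
have m := cm_mob g1 w1; have d0 := mob_den g1 w1.
have s2 : 0 <= 1 - s ^+ 2 by rewrite sqr1_ge0 // ltW.
have s2' : 1 - s ^+ 2 <= 1 by rewrite gerBl sqr_ge0.
have sq (x : R) : 0 <= x -> x <= s -> 1 - s ^+ 2 <= 1 - x ^+ 2.
  by move=> x0 xs; rewrite lerB // ler_sqr ?nnegrE.
have dd : cm (1 + (- g)^* * w) <= 2.
  apply: le_trans (cmD _ _) _; rewrite cm1 cmM cmJ.
  have : cm (- g) * cm w <= 1 by rewrite mulr_ile1 ?cm_ge0 // ltW.
  by lra.
have dp : 0 < cm (1 + (- g)^* * w) by rewrite cm_gt0.
set x := (1 - s ^+ 2) ^+ 2 / 4.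
have x1 : x <= 1 - cm (mob (- g) w) ^+ 2.
  rewrite m ler_pdivlMr ?exprn_gt0 // /x cmN.
  apply: (@le_trans _ _ ((1 - s ^+ 2) ^+ 2 / 4 * 2 ^+ 2)).
    by rewrite ler_wpM2l ?divr_ge0 ?sqr_ge0 // ler_sqr ?nnegrE ?cm_ge0.
  have -> : (1 - s ^+ 2) ^+ 2 / 4 * 2 ^+ 2 = (1 - s ^+ 2) * (1 - s ^+ 2) by field.
  by apply: ler_pM => //; apply: sq; rewrite ?cm_ge0.
have xx : x <= 1 by rewrite /x ler_pdivrMr // mul1r expr2; nra.
have x0 : 0 <= x by rewrite /x divr_ge0 ?sqr_ge0.
have -> : (1 - s ^+ 2) ^+ 2 / 8 = x / 2 by rewrite /x; field.
rewrite -ler_sqr ?nnegrE ?cm_ge0 //; last by lra.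
have : 0 <= (x / 2) ^+ 2 by rewrite sqr_ge0.
by rewrite [(1 - _) ^+ 2]sqrrB expr1n mul1r; lra.
Qed.

(** Schur's step: divide [mob (- f 0) \o f] by [z]. A strict bound on [f]
    passes to the new function (mob_strict_bound, then Schwarz's lemma), so
    the step can be repeated. *)
Lemma schur_algorithm_step f (s : R) : hol f -> s < 1 -> (forall z, cm z < 1 -> cm (f z) <= s) ->
  exists f1 (s1 : R), [/\ hol f1, s1 < 1, forall z, cm z < 1 -> cm (f1 z) <= s1 &
    forall z, cm z < 1 -> f z = mob (f 0) (z * f1 z)].
Proof.
move=> hf s1 bf; have o1 : cm (0 : C) < 1 by rewrite cm0.
have g1 := le_lt_trans (bf 0 o1) s1.
pose s' := 1 - (1 - s ^+ 2) ^+ 2 / 8.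
have s0 : 0 <= s := le_trans (cm_ge0 _) (bf 0 o1).
have sq0 : 0 < 1 - s ^+ 2 by rewrite sqr1_gt0.
have s'1 : s' < 1 by rewrite /s' ltrBlDr ltrDl divr_gt0 // exprn_gt0.
have s'0 : 0 < s'.
  have : (1 - s ^+ 2) ^+ 2 <= 1 by rewrite exprn_ile1 ?(ltW sq0) // gerBl sqr_ge0.
  by rewrite /s'; lra.
pose s'c := s'%:C : C; have s'c0 : s'c != 0 by rewrite -cm_gt0 cm_real gtr0_norm.
pose F z := mob (- f 0) (f z) / s'c.
have schF : schur F.
  have sf : schur f by split=> // z /bf h; rewrite (le_trans h) // ltW.
  have [hF _] := schur_mob_comp (cmN_lt1 g1) sf.
  split=> z z1.
    have [d hd] := hF z z1; eexists; apply: hasdM hd (hasd_cst s'c^-1 z).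
  rewrite /F cm_div [cm s'c]cm_real gtr0_norm // ler_pdivrMr // mul1r.
  by apply: mob_strict_bound => //; exact: bf.
have F0 : F 0 = 0 by rewrite /F mobN mul0r.
have [d hd] := schF.1 0 o1.
have [hG bG] := schwarz_quotient schF F0 hd.
set G := (fun z => _) in hG bG.
exists (fun z => s'c * G z), s'; split=> //.
- by move=> z z1; have [e he] := hG z z1; eexists; apply: hasdM (hasd_cst s'c z) he.
- by move=> z z1; rewrite cmM [cm s'c]cm_real gtr0_norm // ler_piMr ?bG // ltW.
move=> z z1; have -> : z * (s'c * G z) = mob (- f 0) (f z).
  rewrite /G; case: eqP => [->|/eqP z0].
    by rewrite mobN mul0r.
  by rewrite /F; field; rewrite ?z0 ?s'c0.
have := mobK (cmN_lt1 g1) (ltW (le_lt_trans (bf z z1) s1)).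
by rewrite opprK => ->.
Qed.

(** After [n] Schur steps the remaining function is replaced by a Blaschke
    product with suitable values at the two boundary points. Undoing a step
    multiplies by [z], which contracts distances by [kap r], and applies an
    automorphism, which preserves them; the boundary values are transported by
    bijections of the circle. *)
Lemma schur_algorithm (r : R) n f (s : R) p1 p2 q1 q2 : 0 <= r < 1 ->
  hol f -> s < 1 -> (forall z, cm z < 1 -> cm (f z) <= s) ->
  cm p1 = 1 -> cm p2 = 1 -> cm q1 = 1 -> cm q2 = 1 -> (p1 = p2 -> q1 = q2) ->
  exists c X, [/\ cm c = 1, in_disc X /\ (n <= size X)%N, fbp c X p1 = q1, fbp c X p2 = q2 &
    forall z, cm z <= r -> rho_le (kap r ^+ n) (fbp c X z) (f z)].
Proof.
move=> r01; have [k0 _] := andP (kap_bounds r01); case/andP: (r01) => r0 r1.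
elim: n f s q1 q2 => [|n IH] f s q1 q2 hf s1 bf P1 P2 Q1 Q2 hpq.
  have [c [X [c1 X1 h1 h2]]] := circle_interpolation P1 P2 Q1 Q2 hpq.
  exists c, X; split=> // z zr; have z1 := le_lt_trans zr r1.
  rewrite expr0; apply: rho_le1; first by apply: fbp_le1 => //; exact: ltW.
  by rewrite (le_trans (bf z z1)) // ltW.
have [f1 [s' [hf1 s'1 bf1 ff1]]] := schur_algorithm_step hf s1 bf.
have o1 : cm (0 : C) < 1 by rewrite cm0.
have g1 := le_lt_trans (bf 0 o1) s1; set g := f 0 in g1 ff1.
have gN := cmN_lt1 g1.
pose q' p q := p^* * mob (- g) q.
have Q' p q : cm p = 1 -> cm q = 1 -> cm (q' p q) = 1.
  by move=> p_1 q_1; rewrite cmM cmJ p_1 mul1r mob_eq1.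
have hq' : p1 = p2 -> q' p1 q1 = q' p2 q2 by move=> e; rewrite /q' (hpq e) e.
have [c [X [c1 [X1 sX] h1 h2 hX]]] := IH f1 s' _ _ hf1 s'1 bf1 P1 P2 (Q' _ _ P1 Q1) (Q' _ _ P2 Q2) hq'.
have [Y [sY Y1 hY]] := fbp_schur_step c1 g1 X1.
have back p q : cm p = 1 -> cm q = 1 -> fbp c X p = q' p q -> fbp c Y p = q.
  move=> p_1 q_1 hp; rewrite -hY ?p_1 // hp /q' mulrA circle_conj // mul1r.
  by have := mobK gN (eq_ind_r (fun u => u <= 1) (lexx 1) q_1); rewrite opprK.
exists c, Y; split=> //; first by rewrite sY ltnS.
- exact: back h1.
- exact: back h2.
move=> z zr; have z1 := le_lt_trans zr r1.
have B1 : cm (fbp c X z) <= 1 by apply: fbp_le1 => //; exact: ltW.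
have F1 : cm (f1 z) <= 1 by rewrite (le_trans (bf1 z z1)) // ltW.
rewrite -hY ?(ltW z1) // ff1 // exprS; apply: rho_le_mob => //.
- by rewrite cmM mulr_ile1 ?cm_ge0 // ltW.
- by rewrite cmM mulr_ile1 ?cm_ge0 // ltW.
- by rewrite mulr_ge0 // exprn_ge0.
- by apply: rho_le_scale => //; [rewrite exprn_ge0|exact: hX].
Qed.

Lemma pow_small (x e : R) : 0 <= x < 1 -> 0 < e -> exists n, x ^+ n < e.
Proof.
move=> /andP[x0 x1] e0.
have /cvgrPdist_lt/(_ e e0) : (GRing.exp x : R^nat) @ \oo --> (0 : R).
  by apply: cvg_expr; rewrite ger0_norm.
move=> [N _ hN]; exists N; have := hN N (leqnn N).
by rewrite sub0r normrN ger0_norm // exprn_ge0.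
Qed.

(** Caratheodory's theorem with prescribed values at two points of the circle.
    The Schur algorithm runs for [(1 - t)%:C * f], a small perturbation of [f]
    with a strict bound. The boundary values make it possible, in [stage], to
    treat two targets almost independently; the nonempty list of zeros keeps
    the lists of zeros growing strictly. *)
Theorem caratheodory f (r e : R) p1 p2 q1 q2 : schur f -> r < 1 -> 0 < e ->
  cm p1 = 1 -> cm p2 = 1 -> cm q1 = 1 -> cm q2 = 1 -> (p1 = p2 -> q1 = q2) ->
  exists c X, [/\ cm c = 1, in_disc X /\ X != [::], fbp c X p1 = q1, fbp c X p2 = q2 &
    forall z, cm z <= r -> cm (fbp c X z - f z) <= e].
Proof.
move=> sf r1 e0 P1 P2 Q1 Q2 hpq.
pose r' := Num.max r 0.
have r'01 : 0 <= r' < 1 by rewrite le_max lexx orbT gt_max r1 ltr01.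
have [t [t0 t1 te]] : exists t : R, [/\ 0 < t, t <= 1/2 & t <= e / 2].
  by exists (Num.min (1/2) (e / 2)); rewrite lt_min !divr_gt0 // !ge_min !lexx orbT.
have cmt : cm (1 - t)%:C = 1 - t by rewrite cm_real ger0_norm //; lra.
have h1 : hol (fun z => (1 - t)%:C * f z).
  by move=> z /sf.1[d hd]; eexists; apply: hasdM (hasd_cst _ z) hd.
have b1 z : cm z < 1 -> cm ((1 - t)%:C * f z) <= 1 - t.
  by move=> z1; rewrite cmM cmt ler_piMr ?(sf.2 z z1) //; lra.
have [n hn] : exists n, kap r' ^+ n < e / 4 by apply: pow_small (kap_bounds r'01) _; rewrite divr_gt0.
have t1' : 1 - t < 1 by lra.
have [c [X [c1 [X1 sX] i1 i2 hX]]] := schur_algorithm n.+1 r'01 h1 t1' b1 P1 P2 Q1 Q2 hpq.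
exists c, X; split=> //; first by split=> //; case: (X) sX.
move=> z zr; have zr' : cm z <= r' by rewrite le_max zr.
have z1 := le_lt_trans zr r1.
have := hX z zr'; rewrite /rho_le.
set A := fbp c X z; set B := f z; set D := (1 - t)%:C * B.
have D1 : cm D <= 1 by apply: le_trans (b1 z z1) _; lra.
have A1 : cm A <= 1 by apply: fbp_le1 => //; exact: ltW.
have den : cm (1 - D^* * A) <= 2.
  apply: le_trans (cmDB _ _) _; rewrite cm1 cmM cmJ.
  have : cm D * cm A <= 1 by rewrite mulr_ile1 ?cm_ge0.
  by lra.
have kn : kap r' ^+ n.+1 <= e / 4.
  have /andP[k0 k1] := kap_bounds r'01.
  by rewrite exprS (le_trans _ (ltW hn)) // ler_piMl ?exprn_ge0 // ltW.
have k0 : 0 <= kap r' ^+ n.+1 by rewrite exprn_ge0 //; case/andP: (kap_bounds r'01).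
have : kap r' ^+ n.+1 * cm (1 - D^* * A) <= e / 4 * 2 by apply: ler_pM => //; exact: cm_ge0.
have DB : cm (D - B) <= t.
  have -> : D - B = - (t%:C * B) by rewrite /D rmorphB rmorph1 /=; ring.
  by rewrite cmN cmM cm_real ger0_norm ?(ltW t0) // ler_piMr ?(ltW t0) // (sf.2 z z1).
have := cm_tri D A B; lra.
Qed.

End Caratheodory.

(** * Infinite Blaschke products from growing lists of zeros *)

Section InfiniteBlaschke.
Variable R : realType.
Local Notation C := R[i].
Implicit Types (c x y z w a : C) (X : seq C) (f : C -> C).

Local Notation bl := (@blaschke_factor R).

(** At [x = 0] the normalization of [blaschke_factor] degenerates to 0. *)
Definition punctured X := forall x, x \in X -> cm x < 1 /\ x != 0.

Definition bprod X z := \prod_(x <- X) bl x z.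

Definition defect X : R := \sum_(x <- X) (1 - cm x).

Lemma punctured_disc X : punctured X -> in_disc X.
Proof. by move=> h x /h[]. Qed.

Lemma blaschke_factorE x z : bl x z = - ((cm x)%:C / x) * mob (- x) z.
Proof.
by rewrite /blaschke_factor cmE /mob rmorphN !mulNr; ring.
Qed.

Lemma cm_rotation x : x != 0 -> cm (- ((cm x)%:C / x)) = 1.
Proof.
move=> x0; rewrite cmN cm_div cm_real ger0_norm ?cm_ge0 // divff //.
by rewrite cm_eq0.
Qed.

Lemma bprod_fbp X : punctured X ->
  exists2 c, cm c = 1 & forall z, bprod X z = fbp c X z.
Proof.
elim: X => [|x X IH] pX.
  by exists 1; [rewrite cm1|move=> z; rewrite /bprod /fbp !big_nil mulr1].
have [x1 x0] := pX x (mem_head _ _).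
have [|c c1 hc] := IH; first by move=> y yX; apply: pX; rewrite inE yX orbT.
exists (- ((cm x)%:C / x) * c); first by rewrite cmM cm_rotation // c1 mulr1.
move=> z; have := hc z; rewrite /bprod /fbp !big_cons => ->.
by rewrite blaschke_factorE mulrACA.
Qed.

Lemma bprod_le1 X z : punctured X -> cm z <= 1 -> cm (bprod X z) <= 1.
Proof.
move=> pX z1; have [c c1 ->] := bprod_fbp pX.
by apply: fbp_le1 => //; exact: punctured_disc.
Qed.

Lemma schur_bprod X : punctured X -> schur (bprod X).
Proof.
move=> pX; have [c c1 hc] := bprod_fbp pX.
have -> : bprod X = fbp c X by apply/funext.
by apply: schur_fbp => //; exact: punctured_disc.
Qed.

(** The rotation in [blaschke_factor] makes [1 - blaschke_factor x z] a
    multiple of [1 - cm x]. *)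
Lemma blaschke_factor_near1 x z (r : R) : cm x < 1 -> x != 0 -> r < 1 -> cm z <= r ->
  cm (1 - bl x z) <= 2 / (1 - r) * (1 - cm x).
Proof.
move=> x1 x0 r1 zr; have z1 := le_lt_trans zr r1.
have d0 := mob_den (cmN_lt1 x1) (ltW z1).
rewrite rmorphN mulNr in d0.
have E : 1 - bl x z = (1 - cm x)%:C * ((x + (cm x)%:C * z) / x) / (1 - x^* * z).
  have xx : x * x^* = (cm x)%:C * (cm x)%:C by rewrite -cm_sqr expr2 rmorphM.
  rewrite /blaschke_factor cmE rmorphB rmorph1.
  have -> : 1 - (cm x)%:C / x * ((x - z) / (1 - x^* * z))
     = (x - x * x^* * z - (cm x)%:C * (x - z)) / (x * (1 - x^* * z)) by field; rewrite x0 d0.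
  by rewrite xx; field; rewrite x0 d0.
rewrite E [cm (_ / (1 - _))]cm_div cmM cm_real ger0_norm; last by rewrite subr_ge0 ltW.
have num : cm ((x + (cm x)%:C * z) / x) <= 2.
  rewrite cm_div ler_pdivrMr ?cm_gt0 //; apply: le_trans (cmD _ _) _.
  rewrite cmM cm_real ger0_norm ?cm_ge0 //.
  by have : cm x * cm z <= cm x; [rewrite ler_piMr ?cm_ge0 // ltW|lra].
have den : 1 - r <= cm (1 - x^* * z).
  apply: le_trans (cmBD _ _); rewrite cm1 cmM cmJ lerB //.
  by apply: le_trans zr; rewrite ler_piMl ?cm_ge0 // ltW.
have r0 : 0 < 1 - r by rewrite subr_gt0.
rewrite ler_pdivrMr ?cm_gt0 //.
have x2 : 0 <= 1 - cm x by rewrite subr_ge0 ltW.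
apply: (@le_trans _ _ ((1 - cm x) * 2)); first by rewrite ler_wpM2l.
have -> : 2 / (1 - r) * (1 - cm x) * cm (1 - x^* * z)
   = (1 - cm x) * 2 * (cm (1 - x^* * z) / (1 - r)) by ring.
by rewrite ler_peMr ?mulr_ge0 // ler_pdivlMr // mul1r.
Qed.

(** Factors with small total defect hardly change a product on a smaller disc.
    The convergence of infinite products and the stability of earlier
    approximations both rest on this. *)
Lemma bprod_near1 X z (r : R) : punctured X -> r < 1 -> cm z <= r ->
  cm (1 - bprod X z) <= 2 / (1 - r) * defect X.
Proof.
move=> pX r1 zr; rewrite /bprod /defect.
elim: X pX => [|x X IH] pX; first by rewrite !big_nil subrr cm0 mulr0.
have [x1 x0] := pX x (mem_head _ _).
have pX' : punctured X by move=> y yX; apply: pX; rewrite inE yX orbT.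
rewrite !big_cons mulrDr.
set P := \prod_(_ <- X) _.
have -> : 1 - bl x z * P = (1 - bl x z) + bl x z * (1 - P) by ring.
apply: le_trans (cmD _ _) _; apply: lerD; first exact: blaschke_factor_near1.
rewrite cmM; apply: le_trans _ (IH pX').
rewrite ler_piMl ?cm_ge0 // blaschke_factorE cmM cm_rotation // mul1r.
by rewrite mob_le1 ?cmN // ltW // (le_lt_trans zr).
Qed.

Lemma bprod_cat X Y z : bprod (X ++ Y) z = bprod X z * bprod Y z.
Proof. by rewrite /bprod big_cat. Qed.

Lemma defect_cat X Y : defect (X ++ Y) = defect X + defect Y.
Proof. by rewrite /defect big_cat. Qed.

Lemma defect_ge0 X : in_disc X -> 0 <= defect X.
Proof. by move=> X1; rewrite /defect big_seq sumr_ge0 // => x /X1 x1; rewrite subr_ge0 ltW. Qed.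

(** Both sides are automorphisms of the disc with the zero [mob a x]; they
    differ by a rotation. *)
Lemma mob_mob x a z : cm x < 1 -> cm a < 1 -> cm z <= 1 ->
  mob (- x) (mob (- a) z) = (1 + a^* * x) / (1 + a^* * x)^* * mob (- mob a x) z.
Proof.
move=> x1 a1 z1; have y1 : cm (mob a x) < 1 by exact: mob_lt1.
have m0 := mob_den a1 (ltW x1).
have m0c : (1 + a^* * x)^* != 0 by rewrite conjC_eq0.
have m1 := mob_den (cmN_lt1 y1) z1.
have m2 := mob_den (cmN_lt1 a1) z1.
move: m0 m0c m1 m2.
rewrite /mob !rmorphN !rmorphM fmorphV !rmorphD rmorphM rmorph1 /= !conjCK.
move: (x^*) (a^*) => xc ac m0 m0c m1 m2.
have k1 : 1 + a * xc + - (xc + ac) * z != 0.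
  by apply: contra m1 => /eqP h; apply/eqP; rewrite -[RHS](mul0r (1 + a * xc)^-1) -h; field.
by field; rewrite m0c k1 m0 m2.
Qed.

Lemma fbp_mob c X a : cm c = 1 -> in_disc X -> cm a < 1 ->
  exists2 c', cm c' = 1 &
    forall z, cm z <= 1 -> fbp c X (mob (- a) z) = fbp c' (map (mob a) X) z.
Proof.
move=> + + a1; elim: X => [|x X IH] c1 X1.
  by exists c => // z _; rewrite /fbp !big_nil.
case/in_disc_cons: X1 => x1 X1; have [c' c'1 hc'] := IH c1 X1.
have dx := mob_den a1 (ltW x1).
exists ((1 + a^* * x) / (1 + a^* * x)^* * c').
  by rewrite cmM c'1 cm_div cmJ mulr1 divff // cm_eq0.
move=> z z1; have := hc' z z1; rewrite /fbp /= !big_cons => h.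
by rewrite mulrCA h mob_mob // mulrACA.
Qed.

(** As [a] approaches the circle all the points [mob a x] approach it as well:
    [1 - cm (mob a x) ^+ 2] has the factor [1 - cm a ^+ 2]. *)
Lemma defect_mob_small X (e : R) : in_disc X -> 0 < e ->
  exists2 d : R, 0 < d & forall a, cm a < 1 -> 1 - cm a < d -> defect (map (mob a) X) <= e.
Proof.
elim: X e => [|x X IH] e X1 e0.
  by exists 1 => // a _ _; rewrite /defect big_nil ltW.
case/in_disc_cons: X1 => x1 X1.
have e2 : 0 < e / 2 by rewrite divr_gt0.
have [d d0 hd] := IH _ X1 e2.
have k0 : 0 < 1 - cm x by rewrite subr_gt0.
exists (Num.min d (e / 4 * (1 - cm x) ^+ 2)).
  by rewrite lt_min d0 mulr_gt0 ?exprn_gt0 // divr_gt0.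
move=> a a1; rewrite lt_min => /andP[ad ae].
have := hd a a1 ad; rewrite /defect /= big_cons => h.
suff : 1 - cm (mob a x) <= e / 2 by lra.
have m1 := mob_lt1 a1 x1; have m0 := cm_ge0 (mob a x).
have : 1 - cm (mob a x) <= 1 - cm (mob a x) ^+ 2.
  by rewrite lerB // expr2 ler_piMr // ltW.
move=> /le_trans; apply; rewrite (cm_mob a1 (ltW x1)).
have a0 := cm_ge0 a; have x0 := cm_ge0 x.
have den : 1 - cm x <= cm (1 + a^* * x).
  apply: le_trans (cmBDD _ _); rewrite cm1 cmM cmJ lerB //.
  by rewrite ler_piMl // ltW.
have dp : 0 < cm (1 + a^* * x) by apply: lt_le_trans den.
rewrite ler_pdivrMr ?exprn_gt0 //.
have n1 : 1 - cm a ^+ 2 <= 2 * (e / 4 * (1 - cm x) ^+ 2).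
  set Q := e / 4 * _ in ae *; clearbody Q.
  by have := sqr_ge0 (1 - cm a); rewrite sqrrB expr1n mul1r; lra.
have n2 : 1 - cm x ^+ 2 <= 1 by rewrite gerBl sqr_ge0.
have n3 : 0 <= 1 - cm a ^+ 2 by rewrite sqr1_ge0 // ltW.
have n4 : (1 - cm x) ^+ 2 <= cm (1 + a^* * x) ^+ 2.
  by rewrite ler_sqr ?nnegrE // ltW.
apply: (@le_trans _ _ (1 - cm a ^+ 2)); first by rewrite ler_piMr.
apply: le_trans n1 _; have := ler_wpM2l (ltW e2) n4.
have -> : 2 * (e / 4 * (1 - cm x) ^+ 2) = e / 2 * (1 - cm x) ^+ 2 by field.
by [].
Qed.

Section GrowingLists.
Variable L : nat -> seq C.
Hypothesis L_grow : forall j, exists2 s, L j.+1 = L j ++ s & s != [::].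
Hypothesis L_disc : forall j, punctured (L j).
Variable S : R.
Hypothesis L_defect : forall j, defect (L j) <= S.

Let a k := nth 0 (L k.+1) k.

Lemma L_prefix i j : (i <= j)%N -> exists s, L j = L i ++ s.
Proof.
elim: j => [|j IH]; first by rewrite leqn0 => /eqP ->; exists [::]; rewrite cats0.
rewrite leq_eqVlt => /orP[/eqP ->|]; first by exists [::]; rewrite cats0.
rewrite ltnS => /IH[s hs]; have [t -> _] := L_grow j.
by exists (s ++ t); rewrite hs catA.
Qed.

Lemma L_size j : (j <= size (L j))%N.
Proof.
elim: j => // j IH; have [s -> s0] := L_grow j.
rewrite size_cat -addn1 leq_add //; by case: s s0.
Qed.

(** The lists are prefixes of one infinite sequence. *)
Lemma nth_L j k : (k < size (L j))%N -> a k = nth 0 (L j) k.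
Proof.
move=> kj; rewrite /a; case: (leqP k.+1 j) => h.
  by have [s ->] := L_prefix h; rewrite nth_cat (leq_trans (ltnSn k) (L_size k.+1)).
by have [s ->] := L_prefix (ltnW h); rewrite nth_cat kj.
Qed.

Lemma a_punctured k : cm (a k) < 1 /\ a k != 0.
Proof. by apply: (L_disc (j := k.+1)); rewrite mem_nth // L_size. Qed.

Let pprod n z := \prod_(0 <= k < n) bl (a k) z.
Let psum n : R := \sum_(0 <= k < n) (1 - cm (a k)).

Lemma big_L (T : Type) (idx : T) (op : T -> T -> T) (F : C -> T) j :
  \big[op/idx]_(0 <= k < size (L j)) F (a k) = \big[op/idx]_(x <- L j) F x.
Proof.
rewrite [RHS](big_nth 0); apply: eq_big_nat => k /andP[_ kj].
by rewrite (nth_L kj).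
Qed.

Lemma psum_mono m n : (m <= n)%N -> psum m <= psum n.
Proof.
move=> mn; rewrite /psum (@big_cat_nat _ _ _ m 0 n) //= lerDl.
by apply: sumr_ge0 => k _; rewrite subr_ge0 ltW //; case: (a_punctured k).
Qed.

Lemma psum_le n : psum n <= S.
Proof.
apply: le_trans (psum_mono (L_size n)) _.
by rewrite /psum (big_L _ _ (fun x => 1 - cm x)); exact: L_defect.
Qed.

Lemma pprod_diff m n z (r : R) : (m <= n)%N -> r < 1 -> cm z <= r ->
  cm (pprod n z - pprod m z) <= 2 / (1 - r) * (psum n - psum m).
Proof.
move=> mn r1 zr; have z1 := ltW (le_lt_trans zr r1).
have punct i j : punctured (map a (index_iota i j)).
  by move=> x /mapP[k _ ->]; exact: a_punctured.
have pE i j : \prod_(i <= k < j) bl (a k) z = bprod (map a (index_iota i j)) z.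
  by rewrite /bprod big_map.
have sE : psum n - psum m = defect (map a (index_iota m n)).
  by rewrite /psum (@big_cat_nat _ _ _ m 0 n) //= addrAC subrr add0r /defect big_map.
rewrite sE /pprod (@big_cat_nat _ _ _ m 0 n) //= !pE.
have -> (A B : C) : A * B - A = A * (B - 1) by ring.
rewrite cmM [cm (_ - 1)]cmB.
apply: le_trans (bprod_near1 (punct _ _) r1 zr).
by rewrite ler_piMl ?cm_ge0 // bprod_le1.
Qed.

Lemma psum_cauchy (e : R) : 0 < e -> exists N, forall n, (N <= n)%N -> psum n - psum N <= e.
Proof.
move=> e0.
have hs : has_sup (range psum).
  by split; [exists (psum 0%N); exists 0%N|exists S => _ [n _ <-]; exact: psum_le].
have [_ [N _ <-] hN] := sup_adherent e0 hs.
exists N => n _; have : psum n <= sup (range psum).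
  by apply: sup_upper_bound => //; exists n.
by lra.
Qed.

(** Bounded defects make the partial products Cauchy on smaller discs
    (pprod_diff), and the limit is in the Schur class by [schur_limit]. The
    last clause bounds the effect of all the zeros added after [L j] by their
    total defect. *)
Lemma infinite_blaschke_exists : exists f : C -> C,
  [/\ infinite_blaschke_product f, schur f &
    forall j (r : R) z (D : R), r < 1 -> cm z <= r ->
      (forall i, (j <= i)%N -> defect (L i) - defect (L j) <= D) ->
      cm (f z - bprod (L j) z) <= 2 / (1 - r) * D].
Proof.
have coef (r : R) : r < 1 -> 0 < 2 / (1 - r) by move=> r1; rewrite divr_gt0 // subr_gt0.
have lim z : exists l, cm z < 1 -> forall e : R, 0 < e ->
    exists N, forall n, (N <= n)%N -> cm (pprod n z - l) <= e.
  have [z1|nz] := pselect (cm z < 1); last by exists 0.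
  have [|l hl] := @complex_cauchy_limit R (fun n => pprod n z); last by exists l.
  move=> e e0; have e'0 : 0 < e / 2 / (2 / (1 - cm z)) 
    by apply: divr_gt0 (coef _ z1); rewrite divr_gt0.
  have [N hN] := psum_cauchy e'0; exists N => m n Nm Nn.
  have h k : (N <= k)%N -> cm (pprod k z - pprod N z) <= e / 2.
    move=> Nk; apply: le_trans (pprod_diff Nk z1 (lexx _)) _.
    by have := hN k Nk; rewrite ler_pdivlMr ?coef // mulrC.
  have := h m Nm; have := h n Nn; rewrite [cm (pprod n z - _)]cmB.
  have := cm_tri (pprod N z) (pprod m z) (pprod n z); lra.
have [f hf] := choice lim.
have near_f j (r : R) z (D : R) : r < 1 -> cm z <= r ->
    (forall n, (j <= n)%N -> psum n - psum j <= D) ->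
    cm (f z - pprod j z) <= 2 / (1 - r) * D.
  move=> r1 zr hD; have z1 := le_lt_trans zr r1.
  apply/ler_addgt0Pr => e e0; have [N hN] := hf z z1 e e0.
  have := hN _ (leq_maxl N j); have jn := leq_maxr N j; set n := maxn N j in jn *.
  have := pprod_diff jn r1 zr; have := ler_wpM2l (ltW (coef r r1)) (hD n jn).
  have := cm_tri (pprod n z) (f z) (pprod j z); rewrite [cm (f z - pprod n z)]cmB; lra.
exists f; split.
- exists 1, 0%N, a; split.
  + by rewrite unit_circleE cm1.
  + by move=> k; have [a1 a0] := a_punctured k; split=> //; rewrite unit_discE.
  + have [|l hl] := @complex_cauchy_limit R (fun n => (psum n)%:C).
      move=> e e0; have [N hN] := psum_cauchy e0; exists N => m n Nm Nn.
      rewrite -rmorphB /= cm_real ler_norml.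
      have := hN m Nm; have := hN n Nn.
      have := psum_mono Nm; have := psum_mono Nn; lra.
    apply/cvg_ex; exists l; apply/(cvg_cmP eventually_filter) => e e0.
    have [N hN] := hl _ (divr_gt0 e0 (ltr0n R 2)).
    exists N => // n /= Nn; apply: le_lt_trans (_ : e / 2 < e); last by lra.
    apply: le_trans (hN n Nn); rewrite /series /= /psum rmorph_sum /=.
    rewrite (eq_bigr (fun k => (1 - cm (a k))%:C)) // => k _.
    by rewrite cmE rmorphB rmorph1.
  + move=> z /unit_discE z1.
    apply/(cvg_cmP eventually_filter) => e e0.
    have [N hN] := hf z z1 _ (divr_gt0 e0 (ltr0n R 2)).
    exists N => // n /= Nn; have := hN n Nn; rewrite mul1r expr0 mul1r -/(pprod n z).
    lra.
- apply: (@schur_limit R pprod) => // n.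
  have -> : pprod n = bprod (map a (index_iota 0 n)).
    by apply/funext => z; rewrite /bprod big_map.
  by apply: schur_bprod => x /mapP[k _ ->]; exact: a_punctured.
- move=> j r z D r1 zr hD.
  rewrite /bprod -(big_L _ _ (fun x => bl x z)) -/(pprod (size (L j)) z).
  apply: near_f => // n jn; apply: le_trans _ (hD (maxn n j) (leq_maxr _ _)).
  rewrite /defect -!(big_L _ _ (fun x => 1 - cm x)) -!/(psum _) lerD2r.
  apply: psum_mono; exact: leq_trans (leq_maxl _ _) (L_size _).
Qed.

End GrowingLists.

End InfiniteBlaschke.

(** * Limits and subsequences *)

Section Limits.
Variable R : realType.
Local Notation C := R[i].

Definition clim (u : nat -> C) (l : C) :=
  forall e : R, 0 < e -> exists N, forall n, (N <= n)%N -> cm (u n - l) <= e.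

Definition eventually_nat (P : nat -> Prop) := exists N, forall n, (N <= n)%N -> P n.

Lemma eventually_and P Q : eventually_nat P -> eventually_nat Q ->
  eventually_nat (fun n => P n /\ Q n).
Proof.
move=> [N hN] [M hM]; exists (maxn N M) => n.
by rewrite geq_max => /andP[/hN ? /hM ?].
Qed.

Lemma eventually_subseq (P : nat -> Prop) (s : nat -> nat) : {homo s : i j / (i < j)%N} ->
  eventually_nat P -> eventually_nat (fun n => P (s n)).
Proof.
move=> hs [N hN]; exists N => n Nn; apply: hN; apply: leq_trans Nn _.
by elim: n => // n IH; apply: leq_ltn_trans IH _; exact: hs.
Qed.

Lemma clim_comp u l (f : C -> C) : clim u l -> ccont f l -> clim (fun n => f (u n)) (f l).
Proof.
move=> ul fl e /fl[d d0 hd]; have [N hN] := ul _ (divr_gt0 d0 (ltr0n R 2)).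
by exists N => n /hN h; apply: ltW; apply: hd; apply: le_lt_trans h _; lra.
Qed.

Lemma clim_subseq u l (s : nat -> nat) : clim u l -> {homo s : i j / (i < j)%N} ->
  clim (fun n => u (s n)) l.
Proof.
by move=> ul hs e /ul; exact: eventually_subseq hs.
Qed.

Lemma extract_subseq (P : nat -> nat -> Prop) :
  (forall k N, exists2 n, (N <= n)%N & P k n) ->
  exists s, {homo s : i j / (i < j)%N} /\ forall k, P k (s k).
Proof.
move=> h; have [n0 _ P0] := h 0%N 0%N.
have [|s [_ hs]] := @dependent_seq nat P (fun _ m n => (m < n)%N) n0 P0.
  by move=> k m _; have [n mn Pn] := h k.+1 m.+1; exists n.
exists s; split=> [|k]; last by have [] := hs k.
by apply: (homo_ltn (r := fun i j => (i < j)%N)) => [y x z|i]; [exact: ltn_trans|have [] := hs i].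
Qed.

(** By bisection: a square that contains terms of arbitrarily large index has
    a quarter that does. *)
Lemma bolzano_weierstrass_disc (u : nat -> C) : (forall n, cm (u n) <= 1) ->
  exists s l, {homo s : i j / (i < j)%N} /\ clim (fun n => u (s n)) l.
Proof.
move=> u1.
pose x n := (complex.Re (u n) + 1) / 2; pose y n := (complex.Im (u n) + 1) / 2.
have x01 n : 0 <= x n <= 1.
  by have := cm_Re (u n); have := u1 n; rewrite /x ler_norml; lra.
have y01 n : 0 <= y n <= 1.
  by have := cm_Im (u n); have := u1 n; rewrite /y ler_norml; lra.
pose h k : R := 2^-1 ^+ k.
have hS k : h k = h k.+1 + h k.+1 by rewrite /h exprS; lra.
pose P k p q := forall N, exists2 n, (N <= n)%N & p <= x n <= p + h k /\ q <= y n <= q + h k.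
have P0 : P 0%N 0 0 by move=> N; exists N; rewrite // /h expr0 !add0r.
have step k p q : P k p q -> exists i j : bool, P k.+1 (p + i%:R * 2^-1 ^+ k.+1) (q + j%:R * 2^-1 ^+ k.+1).
  rewrite -/(h k.+1) => Pk; apply: contrapT => nP.
  have bad (i j : bool) : exists N, forall n, (N <= n)%N ->
      ~ (p + i%:R * h k.+1 <= x n <= p + i%:R * h k.+1 + h k.+1 /\
         q + j%:R * h k.+1 <= y n <= q + j%:R * h k.+1 + h k.+1).
    apply: contrapT => nN; apply: nP; exists i, j => N.
    by apply: contrapT => nN2; apply: nN; exists N => n Nn hn; apply: nN2; exists n.
  have [N1 h1] := bad false false; have [N2 h2] := bad true false.
  have [N3 h3] := bad false true; have [N4 h4] := bad true true.
  have [n] := Pk (maxn (maxn N1 N2) (maxn N3 N4)).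
  rewrite !geq_max => /andP[/andP[n1 n2] /andP[n3 n4]] [/andP[xa xb] /andP[ya yb]].
  move: (h1 n n1) (h2 n n2) (h3 n n3) (h4 n n4).
  rewrite !mul0r !addr0 !mul1r -!addrA -!(hS k) xa ya xb yb !andbT /=.
  by case: (leP (x n) (p + h k.+1)) => [|/ltW ->]; case: (leP (y n) (q + h k.+1)) => [|/ltW ->];
    intuition.
have [p [q [_ _ hpq]]] := dyadic_nested P0 step.
pose l := Complex (2 * p - 1) (2 * q - 1).
have close k N : exists2 n, (N <= n)%N & cm (u n - l) <= 4 * h k.
  have [p' [q' [Pk pk qk]]] := hpq k; rewrite -/(h k) in pk qk.
  have [n Nn [xn yn]] := Pk N; exists n => //.
  apply: le_trans (cm_ReIm _) _.
  have -> : complex.Re (u n - l) = 2 * (x n - p) by rewrite /l /x; case: (u n) => c d /=; field.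
  have -> : complex.Im (u n - l) = 2 * (y n - q) by rewrite /l /y; case: (u n) => c d /=; field.
  have : `|2 * (x n - p)| <= 2 * h k by rewrite ler_norml; lra.
  have : `|2 * (y n - q)| <= 2 * h k by rewrite ler_norml; lra.
  by lra.
have [s [hs sP]] := extract_subseq close.
exists s, l; split=> // e e0.
have [N hN] := pow_half_small (divr_gt0 e0 (ltr0n R 4)).
exists N => n Nn; apply: le_trans (sP n) _.
have : h n <= h N by rewrite /h ler_wiXn2l // ?invr_ge0 ?invf_le1 ?ler1n.
by move: hN; rewrite -/(h N); lra.
Qed.

Lemma clim_cm1 u l : clim u l -> (forall e : R, 0 < e -> eventually_nat (fun n => `|cm (u n) - 1| <= e)) ->
  cm l = 1.
Proof.
move=> ul u1; apply/eqP; rewrite -subr_eq0 -normr_eq0; apply/eqP/le_anti; rewrite normr_ge0 andbT.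
apply/ler_addgt0Pr => e e0; rewrite add0r.
have [N hN] := eventually_and (u1 _ (divr_gt0 e0 (ltr0n R 2))) (ul _ (divr_gt0 e0 (ltr0n R 2))).
have [h1 h2] := hN N (leqnn N); move: h1; rewrite !ler_norml.
have := cmBD (u N) l; have := cmBD l (u N); rewrite [cm (l - _)]cmB; lra.
Qed.

End Limits.

(** * Approximating two targets by adding finitely many zeros *)

Section Stage.
Variable R : realType.
Local Notation C := R[i].
Implicit Types (c x y z w a : C) (X Y : seq C) (f G H : C -> C).

Lemma cm_prod_diff x x' y y' : cm x <= 1 -> cm y' <= 1 ->
  cm (x * y - x' * y') <= cm (x - x') + cm (y - y').
Proof.
move=> x1 y1; have -> : x * y - x' * y' = (x - x') * y' + x * (y - y') by ring.
by apply: le_trans (cmD _ _) _; rewrite !cmM lerD // ?ler_piMr ?ler_piMl ?cm_ge0.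
Qed.

(** In all uses [F 0] is known to be close to a point of the circle, and this
    spreads to a smaller disc. *)
Lemma schur_near_unimodular F w z (r eta : R) : schur F -> r < 1 -> cm z <= r -> cm w = 1 ->
  cm (F 0 - w) <= eta -> cm (F z - w) <= (2 / (1 - r) + 1) * eta.
Proof.
move=> sF r1 zr w1 h.
have [c0 _] := schur_close0 sF r1 zr.
have : 1 - cm (F 0) <= eta by apply: le_trans h; rewrite -w1 cmB cmBD.
have k0 : 0 <= 2 / (1 - r) by rewrite divr_ge0 // subr_ge0 ltW.
move=> /(ler_wpM2l k0); have := cm_tri (F 0) (F z) w; lra.
Qed.

Lemma schur_rotate c w G : cm c = 1 -> cm w = 1 -> schur G -> schur (fun z => c * G (w * z)).
Proof.
move=> c1 w1 [hG bG]; have wz z : cm (w * z) = cm z by rewrite cmM w1 mul1r.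
split=> z z1; last by rewrite cmM c1 mul1r; apply: bG; rewrite wz.
have [|d hd] := hG (w * z); first by rewrite wz.
eexists; apply: hasdM (hasd_cst c z) _.
exact: hasd_comp (hasdM (hasd_cst w z) (hasd_id z)) hd.
Qed.

(** The sum of the errors in [stage_half], with [K = 2 / (1 - r) + 1] from
    [schur_near_unimodular]: twice [K] for [F] and [H2], 5 for [k] and for the
    approximation by [H1], and [K] times a Lipschitz constant for replacing [z
    * q z] by [w * z]. *)
Definition stage_const (r : R) : R := 2 * (2 / (1 - r) + 1) + 5 + 4 / (1 - r) * (2 / (1 - r) + 1).

(** The approximation of one of the two targets; the other follows by
    exchanging the roles of the two self-maps. Write [ze = z * q z]. The
    functions [F (mob a ze)], [H2 (mob (- b) (mob a ze))] and [q z] of [z] are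
    close to the unimodular numbers [u], 1 and [w] at the origin, hence on the
    disc of radius [r]. There [F * B] is thus close to [u * H1 (w * z)], and
    [H1] was chosen so that this is close to [G z]. *)
Lemma stage_half F B G H1 H2 q k a b u w (r eta : R) : r < 1 -> 0 <= eta ->
  schur F -> schur G -> schur H1 -> schur H2 -> schur q ->
  cm a < 1 -> cm b < 1 -> cm u = 1 -> cm w = 1 -> cm k = 1 ->
  (forall z, cm z < 1 -> k * B z = H1 (mob (- a) z) * H2 (mob (- b) z)) ->
  (forall z, cm z <= r -> cm (H1 z - u^* * G (w^* * z)) <= eta) ->
  cm (F a - u) <= eta -> cm (H2 (mob (- b) a) - 1) <= eta -> cm (q 0 - w) <= eta ->
  cm (k - 1) <= 4 * eta ->
  forall z, cm z <= r ->
    cm (F (mob a (z * q z)) * B (mob a (z * q z)) - G z) <= stage_const r * eta.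
Proof.
move=> r1 eta0 sF sG sH1 sH2 sq a1 b1 u1 w1 k1 hB hH1 hF hH2 hq hk z zr.
have z1 := le_lt_trans zr r1.
pose ze := z * q z.
have zer : cm ze <= r.
  by rewrite cmM; apply: le_trans zr; rewrite ler_piMr ?cm_ge0 ?(sq.2 z z1).
have ze1 := le_lt_trans zer r1.
pose K := 2 / (1 - r) + 1.
have K2 : 0 < 2 / (1 - r) by rewrite divr_gt0 // subr_gt0.
have mz : cm (mob a ze) < 1 by exact: mob_lt1.
have c1 : cm (1 : C) = 1 by exact: cm1.
have e1 : cm (F (mob a ze) - u) <= K * eta.
  apply: (schur_near_unimodular (F := fun z => F (mob a z))) => //.
    by apply: schur_comp sF (hol_mob a1) _ => v; exact: mob_lt1.
  by rewrite mob0.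
have e2 : cm (H2 (mob (- b) (mob a ze)) - 1) <= K * eta.
  apply: (schur_near_unimodular (F := fun z => H2 (mob (- b) (mob a z)))) => //.
    apply: (schur_comp (f := fun z => H2 (mob (- b) z))) (hol_mob a1) _; last by move=> v; exact: mob_lt1.
    by apply: schur_comp sH2 (hol_mob (cmN_lt1 b1)) _ => v; apply: mob_lt1; rewrite cmN.
  by rewrite mob0.
have wz : cm (w * z) <= r by rewrite cmM w1 mul1r.
have e3 : cm (ze - w * z) <= K * eta.
  have -> : ze - w * z = z * (q z - w) by rewrite /ze; ring.
  rewrite cmM; apply: le_trans (schur_near_unimodular sq r1 zr w1 hq).
  by rewrite ler_piMl ?cm_ge0 // ltW.
pose h v := u^* * G (w^* * v).
have sh : schur h by apply: schur_rotate; rewrite ?cmJ.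
have e4 : cm (H1 ze - h (w * z)) <= eta + 4 / (1 - r) * (K * eta).
  have := schur_lip (h := ze - w * z) sh r1 wz; rewrite addrC subrK => /(_ zer).
  have k4 : 0 <= 4 / (1 - r) by rewrite divr_ge0 // subr_ge0 ltW.
  have := ler_wpM2l k4 e3; have := hH1 ze zer; rewrite -/(h ze).
  have := cm_tri (h ze) (H1 ze) (h (w * z)); lra.
have hwz : h (w * z) = u^* * G z.
  by rewrite /h mulrA [w^* * w]mulrC circle_conj // mul1r.
have k0 : k != 0 by rewrite -cm_gt0 k1.
have BE : B (mob a ze) = k^-1 * (H1 ze * H2 (mob (- b) (mob a ze))).
  by have := hB _ mz; rewrite mobK ?(ltW ze1) // => <-; rewrite mulKf.
have e5 : cm (k^-1 - 1) <= 4 * eta.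
  have -> : k^-1 - 1 = (1 - k) / k by field.
  by rewrite cm_div k1 divr1 cmB.
have -> : G z = u * (1 * ((u^* * G z) * 1)).
  by rewrite mulr1 mul1r mulrA circle_conj // mul1r.
rewrite BE /stage_const -/K.
have G1 : cm (u^* * G z) <= 1 by rewrite cmM cmJ u1 mul1r (sG.2 z z1).
have F1 : cm (F (mob a ze)) <= 1 by apply: sF.2.
have H11 : cm (H1 ze) <= 1 by apply: sH1.2.
have k1' : cm k^-1 <= 1 by rewrite cmV k1 invr1.
have l1 : cm (1 * (u^* * G z * 1)) <= 1 by rewrite mulr1 mul1r.
have l2 : cm (u^* * G z * 1) <= 1 by rewrite mulr1.
have l3 : cm (1 : C) <= 1 by rewrite cm1.
have := cm_prod_diff u (k^-1 * (H1 ze * H2 (mob (- b) (mob a ze)))) F1 l1.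
have := cm_prod_diff 1 (H1 ze * H2 (mob (- b) (mob a ze))) k1' l2.
have := cm_prod_diff (u^* * G z) (H2 (mob (- b) (mob a ze))) H11 l3.
rewrite hwz in e4; rewrite -/ze; lra.
Qed.

Variables (al be : nat -> C) (q1 q2 : nat -> C -> C) (a b w1 w2 g1 g2 : C).
Hypotheses (al1 : forall k, cm (al k) < 1) (be1 : forall k, cm (be k) < 1).
Hypotheses (sq1 : forall k, schur (q1 k)) (sq2 : forall k, schur (q2 k)).
Hypotheses (ha : clim al a) (hb : clim be b).
Hypotheses (hw1 : clim (fun k => q1 k 0) w1) (hw2 : clim (fun k => q2 k 0) w2).
Hypotheses (hg1 : clim (fun k => mob (- al k) (be k)) g1).
Hypotheses (hg2 : clim (fun k => mob (- be k) (al k)) g2).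
Hypotheses (a1 : cm a = 1) (b1 : cm b = 1) (w11 : cm w1 = 1) (w21 : cm w2 = 1).
Hypotheses (g11 : cm g1 = 1) (g21 : cm g2 = 1).

Lemma fbp_ccont c X z : in_disc X -> cm z <= 1 -> ccont (fbp c X) z.
Proof. by move=> X1 z1; have [d /hasd_ccont] := fbp_hasd c X1 z1. Qed.

Lemma clim_cm_near1 (v : nat -> C) l (e : R) : clim v l -> cm l = 1 -> 0 < e ->
  eventually_nat (fun n => 1 - cm (v n) < e).
Proof.
move=> vl l1 e0; have [N hN] := vl _ (divr_gt0 e0 (ltr0n R 2)).
exists N => n /hN h; have := cmBD l (v n); rewrite cmB l1; lra.
Qed.

Lemma clim_fbp c X v l : in_disc X -> cm l = 1 -> clim v l ->
  clim (fun k => fbp c X (v k)) (fbp c X l).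
Proof. by move=> X1 l1 vl; apply: clim_comp vl _; apply: fbp_ccont => //; rewrite l1. Qed.

Lemma climN (v : nat -> C) l : clim v l -> clim (fun k => - v k) (- l).
Proof.
move=> vl e /vl[N hN]; exists N => n /hN h.
by rewrite -opprD cmN.
Qed.

(** Near [al k] and [be k] the product over [X] is almost equal to unimodular
    constants [u] and [v]. The new zeros [Y k] are those of [H1 (mob (- al k)
    z) * H2 (mob (- be k) z)], where [H1] and [H2] approximate the targets
    corrected by [u], [v] and the rotations [w1], [w2]. Each of the two
    factors must be close to 1 where the other one does its work: [al k] and
    [be k] are far apart in the hyperbolic sense, so seen from [al k] the
    point [be k] is close to the boundary point [g1], and there [H1] is given
    the value 1. It is also given the value 1 at [- a], the limit of the image
    of 0; the same for [H2]. Then the product of both is close to 1 at 0,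
    which shows that the rotation normalizing [bprod (Y k)] is harmless. *)
Theorem stage X (del r eps : R) G1 G2 : punctured X -> 0 < del -> r < 1 -> 0 < eps ->
  schur G1 -> schur G2 ->
  exists k Y, [/\ punctured Y /\ Y != [::], defect Y <= del,
    forall z, cm z <= r -> cm (bprod (X ++ Y) (mob (al k) (z * q1 k z)) - G1 z) <= eps &
    forall z, cm z <= r -> cm (bprod (X ++ Y) (mob (be k) (z * q2 k z)) - G2 z) <= eps].
Proof.
move=> pX del0 r1 eps0 sG1 sG2.
have M0 : 0 < stage_const r.
  have k1 : 0 < 2 / (1 - r) by rewrite divr_gt0 // subr_gt0.
  have k2 : 0 < 4 / (1 - r) by rewrite divr_gt0 // subr_gt0.
  have : 0 < 4 / (1 - r) * (2 / (1 - r) + 1) by rewrite mulr_gt0 // addr_gt0.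
  by rewrite /stage_const; lra.
pose eta := eps / stage_const r.
have eta0 : 0 < eta by rewrite divr_gt0.
have etaE : stage_const r * eta = eps by rewrite /eta; field; rewrite gt_eqF.
have X1 := punctured_disc pX.
have [cX cX1 hX] := bprod_fbp pX.
pose u := bprod X a; pose v := bprod X b.
have u1 : cm u = 1 by rewrite /u hX fbp_eq1.
have v1 : cm v = 1 by rewrite /v hX fbp_eq1.
have one : cm (1 : C) = 1 by exact: cm1.
have rotated G w y : schur G -> cm w = 1 -> cm y = 1 -> schur (fun z => y^* * G (w^* * z)).
  by move=> sG w_1 y_1; apply: schur_rotate; rewrite ?cmJ.
have na1 : cm (- a) = 1 by rewrite cmN.
have nb1 : cm (- b) = 1 by rewrite cmN.
have [c1 [X1' [c11 [D1 X1n] i1 i2 hH1]]] :=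
  caratheodory (rotated G1 w1 u sG1 w11 u1) r1 eta0 na1 g11 one one (fun _ => erefl).
have [c2 [X2' [c21 [D2 _] j1 j2 hH2]]] :=
  caratheodory (rotated G2 w2 v sG2 w21 v1) r1 eta0 nb1 g21 one one (fun _ => erefl).
pose Y k := map (mob (al k)) X1' ++ map (mob (be k)) X2'.
(* A zero at the origin would have defect 1; the bound [1/2] excludes it. *)
have m0 : 0 < Num.min (1/2) (Num.min eta del).
  by rewrite !lt_min eta0 del0 divr_gt0.
have m02 : 0 < Num.min (1/2) (Num.min eta del) / 2 by rewrite divr_gt0.
have [d1 d10 hd1] := defect_mob_small D1 m02.
have [d2 d20 hd2] := defect_mob_small D2 m02.
have E1 := clim_cm_near1 ha a1 d10; have E2 := clim_cm_near1 hb b1 d20.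
have E3 := clim_fbp cX X1 a1 ha eta0; have E4 := clim_fbp cX X1 b1 hb eta0.
have E5 := clim_fbp c1 D1 na1 (climN ha) eta0; have E6 := clim_fbp c2 D2 nb1 (climN hb) eta0.
have E7 := clim_fbp c1 D1 g11 hg1 eta0; have E8 := clim_fbp c2 D2 g21 hg2 eta0.
have [k hk] := eventually_and (eventually_and (eventually_and E1 E2) (eventually_and E3 E4))
  (eventually_and (eventually_and (eventually_and E5 E6) (eventually_and E7 E8))
     (eventually_and (hw1 eta0) (hw2 eta0))).
have [[[{}E1 {}E2] [{}E3 {}E4]] [[[{}E5 {}E6] [{}E7 {}E8]] [E9 E10]]] := hk k (leqnn k).
have {}hd1 := hd1 _ (al1 k) E1; have {}hd2 := hd2 _ (be1 k) E2.
rewrite i1 in E5; rewrite i2 in E7; rewrite j1 in E6; rewrite j2 in E8.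
rewrite -!hX -/u in E3; rewrite -!hX -/v in E4.
have dY : defect (Y k) <= Num.min (1/2) (Num.min eta del).
  by rewrite /Y defect_cat; lra.
have dY1 : defect (Y k) <= 1/2 by apply: le_trans dY _; rewrite ge_min lexx.
have dY2 : defect (Y k) <= eta by apply: le_trans dY _; rewrite !ge_min lexx !orbT.
have dY3 : defect (Y k) <= del by apply: le_trans dY _; rewrite !ge_min lexx !orbT.
have Y1 : in_disc (Y k).
  by move=> y; rewrite mem_cat => /orP[] /mapP[x xX ->]; apply: mob_lt1 => //; [exact: D1|exact: D2].
have pY : punctured (Y k).
  move=> y yY; split; first exact: Y1.
  apply/eqP => y0; move: dY1; rewrite /defect (big_rem y) //= y0 cm0.
  have : 0 <= \sum_(x <- rem y (Y k)) (1 - cm x).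
    by apply: (@defect_ge0 R (rem y (Y k))) => x /mem_rem; exact: Y1.
  by rewrite y0; lra.
have [c1' c1'1 hc1] := fbp_mob c11 D1 (al1 k).
have [c2' c2'1 hc2] := fbp_mob c21 D2 (be1 k).
have [cY cY1 hY] := bprod_fbp pY.
pose kk := c1' * c2' / cY.
have kk1 : cm kk = 1 by rewrite cm_div cmM c1'1 c2'1 cY1 mulr1 divr1.
have cY0 : cY != 0 by rewrite -cm_gt0 cY1.
have hB z : cm z < 1 -> kk * bprod (Y k) z = fbp c1 X1' (mob (- al k) z) * fbp c2 X2' (mob (- be k) z).
  move=> z1; rewrite hc1 ?(ltW z1) // hc2 ?(ltW z1) // hY /fbp /Y big_cat /kk /=.
  by field.
have o1 : cm (0 : C) < 1 by rewrite cm0.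
(* Evaluate at 0, where [bprod (Y k)] is close to 1 because of its small
   defect and the two factors are close to 1 by the values at [- a] and [- b].
   *)
have kk4 : cm (kk - 1) <= 4 * eta.
  have := hB 0 o1; rewrite !mob0 => h0.
  have -> : kk - 1 = kk * (1 - bprod (Y k) 0) + (kk * bprod (Y k) 0 - 1 * 1) by ring.
  rewrite h0; apply: le_trans (cmD _ _) _; rewrite cmM kk1 mul1r.
  have z0 : cm (0 : C) <= 0 by rewrite cm0.
  have := bprod_near1 pY (ltr01 : (0 : R) < 1) z0; rewrite subr0 divr1.
  have f1 : cm (fbp c1 X1' (- al k)) <= 1.
    by apply: fbp_le1 => //; rewrite cmN ltW.
  have lone : cm (1 : C) <= 1 by rewrite one.
  have := cm_prod_diff 1 (fbp c2 X2' (- be k)) f1 lone.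
  by lra.
have sF := schur_bprod pX.
have sH1 := schur_fbp c11 D1; have sH2 := schur_fbp c21 D2.
exists k, (Y k); split=> //.
- by split=> //; rewrite /Y; case: (X1') X1n.
- move=> z zr; rewrite bprod_cat -etaE.
  exact: (stage_half r1 (ltW eta0) sF sG1 sH1 sH2 (sq1 k) (al1 k) (be1 k) u1 w11 kk1 hB hH1 E3 E8 E9 kk4).
- move=> z zr; rewrite bprod_cat -etaE.
  have hB' y : cm y < 1 -> kk * bprod (Y k) y = fbp c2 X2' (mob (- be k) y) * fbp c1 X1' (mob (- al k) y).
    by move=> y1; rewrite mulrC -mulrC hB // mulrC.
  exact: (stage_half r1 (ltW eta0) sF sG2 sH2 sH1 (sq2 k) (be1 k) (al1 k) v1 w21 kk1 hB' hH2 E4 E7 E10 kk4).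
Qed.

End Stage.

(** * Universality in terms of estimates on discs and finite sets *)

Section DiscTopology.
Variable R : realType.
Local Notation C := (R[i]^o).

Lemma entourage_cm (E : set (C * C)) : entourage E ->
  exists2 e : R, 0 < e & forall x y, cm (x - y) < e -> E (x, y).
Proof.
rewrite -entourage_ballE => -[e /= e0 sE].
have er : e = (complex.Re e)%:C by rewrite RRe_real // realE (ltW e0).
exists (complex.Re e); first by rewrite -ltcR -er.
move=> x y xy; apply: sE; rewrite /ball /= er.
by rewrite -[_ < _]/(`|x - y| < _) cmE ltcR.
Qed.

Lemma entourage_cm_lt (e : R) : 0 < e -> entourage [set xy : C * C | cm (xy.1 - xy.2) < e].
Proof.
move=> e0; rewrite -entourage_ballE; exists e%:C; first by rewrite /= ltcR.
move=> [x y]; rewrite /ball /= -[_ < _]/(`|x - y| < _) cmE ltcR; exact.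
Qed.

Lemma compact_disc_radius (K : set C) : compact_in_disc K ->
  exists2 r : R, r < 1 & forall z, K z -> cm z <= r.
Proof.
move=> [/compact_near_coveringP cK KD].
have [|N _ hN] := cK nat \oo (fun n z => cm (z : R[i]) <= 1 - n.+1%:R^-1) eventually_filter.
  move=> z /KD /unit_discE z1.
  have d0 : 0 < (1 - cm z) / 2 by rewrite divr_gt0 // subr_gt0.
  exists ([set w | cm (w - z) < (1 - cm z) / 2], [set n | n.+1%:R^-1 < (1 - cm z) / 2]) => /=.
    split; first by apply/near_cmP; exists ((1 - cm z) / 2).
    exact: (near_infty_natSinv_lt (PosNum d0)).
  move=> [w n] /= [h1 h2].
  have h3 : cm w <= cm ((w : R[i]) - z) + cm z by have := cmD ((w : R[i]) - z) z; rewrite subrK.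
  have h4 : cm ((w : R[i]) - z) < (1 - cm z) / 2 := h1.
  have h5 : (n.+1%:R^-1 : R) < (1 - cm z) / 2 := h2.
  move: (cm (_ - _)) (n.+1%:R^-1 : R) h3 h4 h5 => y q h3 h4 h5; lra.
exists (1 - N.+1%:R^-1); first by rewrite ltrBlDr ltrDl invr_gt0.
by move=> z Kz; exact: (hN N (leqnn N)).
Qed.

Lemma disc_fun_cvg (h : nat -> disc_fun R) (G : disc_fun R) :
  (forall r e : R, r < 1 -> 0 < e -> exists N, forall n, (N <= n)%N ->
     forall z, cm z <= r -> cm (h n z - G z) <= e) -> h @ \oo --> G.
Proof.
move=> hG; apply/fam_cvgP => K cK P /uniform_nbhs[E [entE subP]].
have [r r1 Kr] := compact_disc_radius cK.
have [e e0 hE] := entourage_cm entE.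
have [N hN] := hG r (e / 2) r1 (divr_gt0 e0 (ltr0n R 2)).
exists N => // n /= Nn; apply: subP => z Kz; apply: hE; rewrite cmB.
apply: le_lt_trans (hN n Nn z (Kr z Kz)) _; lra.
Qed.

(** Finite sets are compact. *)
Lemma disc_fun_nbhs (G : disc_fun R) (s : seq R[i]) (e : R) : 0 < e ->
  (forall z, z \in s -> cm z < 1) ->
  nbhs G [set g : disc_fun R | forall z, z \in s -> cm (g z - G z) < e].
Proof.
move=> e0 s1.
have cs : compact_in_disc [set z : C | z \in s].
  split; last by move=> z /s1 /unit_discE.
  elim: s {s1} => [|x s IH].
    have -> : [set z : C | z \in [::]] = set0 by apply/seteqP; split.
    exact: compact0.
  have -> : [set z : C | z \in x :: s] = [set x] `|` [set z : C | z \in s].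
    apply/seteqP; split=> z /=; first by rewrite inE => /orP[/eqP|]; [left|right].
    by case=> [->|zs]; rewrite inE ?eqxx ?zs ?orbT.
  by apply: compactU IH; exact: compact_set1.
have := fam_nbhs G (entourage_cm_lt e0) cs.
by apply: filterS => g hg z /hg /=; rewrite cmB.
Qed.

Lemma schur_Hinfty (f : disc_fun R) : Hinfty_ball f <-> schur f.
Proof.
split=> [[hf bf]|[hf bf]]; split=> z.
- by move=> /unit_discE /hf /derive_hasd h; exists (cderive f z).
- by move=> /unit_discE /bf; rewrite cmE -(lecR _ 1).
- by move=> /unit_discE /hf[d /hasd_derive[]].
- by move=> /unit_discE /bf; rewrite cmE -(lecR _ 1).
Qed.

Lemma self_map_hol (phi : R[i] -> R[i]) : holomorphic_self_map phi ->
  hol phi /\ forall z, cm z < 1 -> cm (phi z) < 1.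
Proof.
move=> [h1 h2]; split=> z /unit_discE z1; last by apply/unit_discE; exact: h2.
by have /derive_hasd h := h1 z z1; exists (cderive phi z).
Qed.

Lemma composition_schur (phi : R[i] -> R[i]) (f : disc_fun R) :
  holomorphic_self_map phi -> schur f -> Hinfty_ball (composition_operator phi f).
Proof.
move=> /self_map_hol[h1 h2] sf; apply/schur_Hinfty.
exact: (schur_comp (f := f) sf h1 h2).
Qed.

(** Approximation on all smaller discs is convergence in [disc_fun], as every
    compact subset of the disc lies in one of them. *)
Lemma universal_of_approx (phi1 phi2 : nat -> R[i] -> R[i]) (f : disc_fun R) :
  (forall n, holomorphic_self_map (phi1 n)) -> (forall n, holomorphic_self_map (phi2 n)) ->
  schur f ->
  (forall G1 G2 : R[i] -> R[i], schur G1 -> schur G2 -> forall r e : R, r < 1 -> 0 < e ->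
    exists n, forall z, cm z <= r ->
      cm (f (phi1 n z) - G1 z) <= e /\ cm (f (phi2 n z) - G2 z) <= e) ->
  disjointly_universal phi1 phi2 f.
Proof.
move=> hphi1 hphi2 sf approx; split; first exact/schur_Hinfty.
split; first by move=> _ [n _ <-]; split; exact: composition_schur.
move=> [G1 G2] [/= /schur_Hinfty s1 /schur_Hinfty s2].
have inv0 (m : nat) : 0 < m.+1%:R^-1 :> R by rewrite invr_gt0.
have hn m : exists n, forall z, cm z <= 1 - m.+1%:R^-1 ->
    cm (f (phi1 n z) - G1 z) <= m.+1%:R^-1 /\ cm (f (phi2 n z) - G2 z) <= m.+1%:R^-1.
  by apply: approx; rewrite ?ltrBlDr ?ltrDl.
have [s hs] := choice hn.
have conv (phi : nat -> R[i] -> R[i]) G : (forall m z, cm z <= 1 - m.+1%:R^-1 ->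
      cm (f (phi (s m) z) - G z) <= m.+1%:R^-1) ->
    (fun m => composition_operator (phi (s m)) f) @ \oo --> (G : disc_fun R).
  move=> hphi; apply: disc_fun_cvg => r e r1 e0.
  have d0 : 0 < Num.min (1 - r) e by rewrite lt_min subr_gt0 r1.
  have [N _ hN] := near_infty_natSinv_lt (PosNum d0).
  exists N => n Nn z zr; have /= := hN n Nn; rewrite lt_min => /andP[n1 n2].
  apply: le_trans (hphi n z _) (ltW n2); apply: le_trans zr _.
  by rewrite lerBrDr addrC -lerBrDr; exact: ltW n1.
have c1 := conv phi1 G1 (fun m z zm => (hs m z zm).1).
have c2 := conv phi2 G2 (fun m z zm => (hs m z zm).2).
move=> B /(cvg_pair c1 c2) [N _ hN].
exists (composition_operator (phi1 (s N)) f, composition_operator (phi2 (s N)) f).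
by split; [exists (s N)|exact: (hN N (leqnn N))].
Qed.

(** Finite sets of points are the only compact sets for which universality is
    exploited in the converse. *)
Lemma approx_of_universal (phi1 phi2 : nat -> R[i] -> R[i]) (f : disc_fun R) :
  disjointly_universal phi1 phi2 f -> schur f /\
  forall G1 G2 : R[i] -> R[i], schur G1 -> schur G2 ->
  forall (s : seq R[i]) (e : R), 0 < e -> (forall z, z \in s -> cm z < 1) ->
  exists n, forall z, z \in s ->
    cm (f (phi1 n z) - G1 z) < e /\ cm (f (phi2 n z) - G2 z) < e.
Proof.
move=> [/schur_Hinfty sf [_ dn]]; split=> // G1 G2 s1 s2 s e e0 sD.
have [|_ [[n _ <-] /= [h1 h2]]] := dn (G1, G2) _ _ (ex_intro2 _ _
  ([set g : disc_fun R | forall z, z \in s -> cm (g z - G1 z) < e],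
   [set g : disc_fun R | forall z, z \in s -> cm (g z - G2 z) < e])
  (conj (disc_fun_nbhs G1 e0 sD) (disc_fun_nbhs G2 e0 sD)) (fun x hx => hx)).
  by split; exact/schur_Hinfty.
by exists n => z zs; split; [exact: h1|exact: h2].
Qed.

End DiscTopology.

(** * Countably many targets *)

Section Separability.
Variable R : realType.
Local Notation C := R[i].
Implicit Types (z : C) (G : C -> C).

(** On the disc of radius [1 - 1 / (2 * m.+1)] the Schur class has Lipschitz
    constant [8 * m.+1]; points at distance twice the mesh of the grid then
    have values within [1 / (4 * m.+1)]. *)
Definition fineness (m : nat) : nat := (64 * m.+1 ^ 2)%N.

Definition grid_point (m k l : nat) : C :=
  Complex (k%:R / (fineness m)%:R - 1) (l%:R / (fineness m)%:R - 1).

Definition grid (m : nat) : seq C :=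
  [seq grid_point m k l | k <- iota 0 (2 * fineness m).+1, l <- iota 0 (2 * fineness m).+1].

(** The values on the grid, rounded to the mesh. The grid has points outside
    the disc, with arbitrary values; [code_close] only compares the values at
    points inside. *)
Definition code (m : nat) G : seq (int * int) :=
  [seq (Num.floor ((fineness m)%:R * complex.Re (G z)),
        Num.floor ((fineness m)%:R * complex.Im (G z))) | z <- grid m].

Lemma fineness_gt0 m : 0 < (fineness m)%:R :> R.
Proof. by rewrite ltr0n /fineness muln_gt0 expn_gt0. Qed.

Lemma grid_near m z : cm z < 1 -> exists2 p, p \in grid m & cm (p - z) <= 2 / (fineness m)%:R.
Proof.
move=> z1; have N0 := fineness_gt0 m; set N := (fineness m)%:R in N0 *.
have coord (x : R) : `|x| <= 1 -> exists2 k : nat, (k \in iota 0 (2 * fineness m).+1) &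
    `|k%:R / N - 1 - x| <= 1 / N.
  rewrite ler_norml => /andP[x1 x2].
  have y0 : 0 <= N * (x + 1) by rewrite mulr_ge0 ?(ltW N0) //; lra.
  have /andP[t1 t2] := truncn_itv y0.
  exists (Num.truncn (N * (x + 1))).
    rewrite mem_iota add0n ltnS /= -(ler_nat R); apply: le_trans t1 _.
    by rewrite natrM -/N mulrC ler_wpM2r ?(ltW N0) //; lra.
  set k := (Num.truncn _)%:R in t1 *; rewrite -natr1 -/k in t2.
  have -> : k / N - 1 - x = (k - N * (x + 1)) / N by field; rewrite gt_eqF.
  rewrite normrM [`|N^-1|]gtr0_norm ?invr_gt0 // ler_pM2r ?invr_gt0 // ler_norml; lra.
have [k hk kx] := coord _ (le_trans (cm_Re z) (ltW z1)).
have [l hl ly] := coord _ (le_trans (cm_Im z) (ltW z1)).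
exists (grid_point m k l); first by apply/allpairsP; exists (k, l).
apply: le_trans (cm_ReIm _) _.
have -> : complex.Re (grid_point m k l - z) = k%:R / N - 1 - complex.Re z by case: (z).
have -> : complex.Im (grid_point m k l - z) = l%:R / N - 1 - complex.Im z by case: (z).
have -> : 2 / N = 1 / N + 1 / N by ring.
exact: lerD.
Qed.

Lemma code_close m G H : schur G -> schur H -> code m G = code m H ->
  forall z, cm z <= 1 - m.+1%:R^-1 -> cm (G z - H z) <= m.+1%:R^-1.
Proof.
move=> sG sH /eq_in_map eqc z zr.
have [M ME M1] : exists2 M : R, M = m.+1%:R & 1 <= M by exists m.+1%:R; rewrite // ler1n.
have M0 : 0 < M by lra.
rewrite -ME in zr *.
have iM : 0 < M^-1 by rewrite invr_gt0.
have z1 : cm z < 1 by lra.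
have [p pg pz] := grid_near m z1.
have NE : (fineness m)%:R = 64 * M ^+ 2 :> R by rewrite /fineness natrM natrX ME.
have N0 := fineness_gt0 m.
have [e1 e2] := eqc p pg.
have fl (x y : R) : Num.floor ((fineness m)%:R * x) = Num.floor ((fineness m)%:R * y) ->
    `|x - y| <= 1 / (fineness m)%:R.
  move=> e; have := floor_itv ((fineness m)%:R * x); have := floor_itv ((fineness m)%:R * y).
  rewrite e intrD; set f := (_%:~R : R) => h1 h2.
  rewrite ler_pdivlMr // -[X in _ * X](gtr0_norm N0) -normrM ler_norml mulrBl.
  move: h1 h2; rewrite ![_ * (fineness m)%:R]mulrC; lra.
have vals : cm (G p - H p) <= 2 / (fineness m)%:R.
  apply: le_trans (cm_ReIm _) _.
  have -> : complex.Re (G p - H p) = complex.Re (G p) - complex.Re (H p) by case: (G p) (H p) => ? ? [].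
  have -> : complex.Im (G p - H p) = complex.Im (G p) - complex.Im (H p) by case: (G p) (H p) => ? ? [].
  have -> : 2 / (fineness m)%:R = 1 / (fineness m)%:R + 1 / (fineness m)%:R :> R by ring.
  by apply: lerD; exact: fl.
have small : 2 / (fineness m)%:R <= M^-1 / 32.
  rewrite NE; have -> : 2 / (64 * M ^+ 2) = M^-1 / 32 * M^-1 by field; rewrite gt_eqF.
  by apply: ler_piMr; [rewrite divr_ge0 // ltW|rewrite invf_le1].
have pr : cm p <= 1 - M^-1 / 2 by have := cmD (p - z) z; rewrite subrK; lra.
have r1 : 1 - M^-1 / 2 < 1 by lra.
have zr2 : cm z <= 1 - M^-1 / 2 by lra.
have lip F : schur F -> cm (F p - F z) <= M^-1 / 4.
  move=> sF; have := schur_lip (h := p - z) sF r1 zr2; rewrite addrC subrK => /(_ pr) h.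
  apply: le_trans h _.
  have k0 : 0 <= 4 / (1 - (1 - M^-1 / 2)) by rewrite divr_ge0 //; lra.
  apply: le_trans (ler_wpM2l k0 pz) _; rewrite NE.
  have -> : 1 - (1 - M^-1 / 2) = M^-1 / 2 by ring.
  have -> : 4 / (M^-1 / 2) * (2 / (64 * M ^+ 2)) = M^-1 / 4 by field; rewrite gt_eqF.
  exact: lexx.
have l1 := lip G sG; have l2 := lip H sH.
have := cm_tri (G p) (G z) (H z); have := cm_tri (H p) (G p) (H z).
rewrite [cm (G z - G p)]cmB; lra.
Qed.

(** There are only countably many codes; one function for each code that
    occurs gives countably many targets, which suffice for the whole Schur
    class. *)
Lemma code_representative : exists rep : nat -> seq (int * int) -> C -> C,
  (forall m c, schur (rep m c)) /\
  forall m G, schur G -> code m (rep m (code m G)) = code m G.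
Proof.
have /choice[rep hrep] : forall mc : nat * seq (int * int), exists G : C -> C,
    schur G /\ forall H, schur H -> code mc.1 H = mc.2 -> code mc.1 G = mc.2.
  move=> [m c]; have [[G [sG eG]]|nG] := pselect (exists G, schur G /\ code m G = c).
    by exists G.
  exists (fun=> 0); split=> [|H sH eH]; last by case: nG; exists H.
  split=> z z1; last by rewrite cm0.
  by exists 0; exact: hasd_cst.
exists (fun m c => rep (m, c)); split=> [m c|m G sG]; first by case: (hrep (m, c)).
by case: (hrep (m, code m G)) => _ /(_ G sG erefl).
Qed.

End Separability.

(** * Self-maps of the disc *)

Section SelfMaps.
Variable R : realType.
Local Notation C := R[i].
Implicit Types (z w : C) (phi : C -> C).

Definition self_map phi := hol phi /\ forall z, cm z < 1 -> cm (phi z) < 1.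

(** The hyperbolic derivative at the origin. *)
Definition distortion phi : R := cm (cderive phi 0) / (1 - cm (phi 0) ^+ 2).

Definition rho z w : R := cm ((z - w) / (1 - z^* * w)).

Lemma self_map_schur phi : self_map phi -> schur phi.
Proof. by move=> [h1 h2]; split=> // z z1; rewrite ltW // h2. Qed.

(** Schwarz's lemma for [mob (- phi 0) \o phi]. When the distortion is close
    to 1, the function [q] is almost a unimodular constant, and [phi] almost
    an automorphism. *)
Lemma self_map_normal_form phi : self_map phi -> exists q, [/\ schur q,
  forall z, cm z < 1 -> phi z = mob (phi 0) (z * q z) & cm (q 0) = distortion phi].
Proof.
move=> [hphi b]; have o1 : cm (0 : C) < 1 by rewrite cm0.
have sphi := self_map_schur (conj hphi b).
set al := phi 0; have al1 : cm al < 1 := b 0 o1.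
have alN := cmN_lt1 al1.
have [d0 hd0] := hphi 0 o1; have [_ dE] := hasd_derive hd0.
pose psi z := mob (- al) (phi z).
have spsi : schur psi := schur_mob_comp alN sphi.
have hpsi := hasd_comp hd0 (hasd_mob alN (ltW (b 0 o1))).
set D := (X in hasd _ _ X) in hpsi.
have psi0 : psi 0 = 0 by rewrite /psi mobN.
have sq := schwarz_quotient spsi psi0 hpsi.
exists (fun z => if z == 0 then D else psi z / z); split=> //.
  move=> z z1; have back : mob al (psi z) = phi z.
    by have := mobK alN (ltW (b z z1)); rewrite opprK.
  case: eqP => [->|/eqP z0]; first by rewrite mul0r mob0.
  by rewrite mulrC divfK.
rewrite eqxx /D /distortion dE -/al.
have nn : 1 - al * al^* = (1 - cm al ^+ 2)%:C by rewrite rmorphB rmorph1 /= cm_sqr.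
have -> : (1 - - al * (- al)^*) / (1 + (- al)^* * al) ^+ 2 * d0
   = d0 / (1 - cm al ^+ 2)%:C.
  have n0 : 1 - al * al^* != 0.
    by rewrite nn -cm_gt0 cm_real gtr0_norm ?sqr1_gt0 ?cm_ge0.
  rewrite -nn rmorphN mulrNN.
  have -> : 1 + - al^* * al = 1 - al * al^* by ring.
  by field.
by rewrite cm_div cm_real ger0_norm // sqr1_ge0 ?cm_ge0 // ltW.
Qed.

Lemma distortion_le1 phi : self_map phi -> distortion phi <= 1.
Proof.
move=> /self_map_normal_form[q [sq _ <-]]; apply: sq.2; by rewrite cm0.
Qed.

(** By [schur_close0] the distance of [phi z] to the circle is comparable to
    that of [phi 0]. *)
Lemma self_map_image_radius phi (r : R) : self_map phi -> r < 1 ->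
  exists2 r' : R, r' < 1 & forall z, cm z <= r -> cm (phi z) <= r'.
Proof.
move=> sm r1; have sphi := self_map_schur sm.
have o1 : cm (0 : C) < 1 by rewrite cm0.
have p0 := sm.2 0 o1.
pose k := 2 / (1 - r) + 1.
have k0 : 0 < k by rewrite addr_gt0 // divr_gt0 // subr_gt0.
exists (1 - (1 - cm (phi 0)) / k); first by rewrite ltrBlDr ltrDl divr_gt0 // subr_gt0.
move=> z zr; have [_ h] := schur_close0 sphi r1 zr.
rewrite lerBrDr -lerBrDl ler_pdivrMr // /k mulrDr mulr1 [_ * (2 / _)]mulrC.
have := cmBD (phi 0) (phi z); have := cmBD (phi z) (phi 0); rewrite [cm (phi 0 - _)]cmB.
by lra.
Qed.

Lemma rho_mob z w : rho z w = cm (mob (- z) w).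
Proof.
by rewrite /rho /mob !cm_div cmB rmorphN mulNr.
Qed.

Lemma rhoC z w : rho z w = rho w z.
Proof.
rewrite /rho !cm_div cmB -[cm (1 - z^* * w)]cmJ rmorphB rmorphM rmorph1 /= conjCK.
by rewrite mulrC [z * _]mulrC mulrC.
Qed.

Lemma rho_lt1 z w : cm z < 1 -> cm w < 1 -> rho z w < 1.
Proof. by move=> z1 w1; rewrite rho_mob mob_lt1 ?cmN. Qed.

Lemma cvg_clim (u : nat -> R[i]) (l : R[i]) :
  ((fun n => u n : R[i]^o) @ \oo --> (l : R[i]^o)) -> clim u l.
Proof.
move=> /(cvg_cmP eventually_filter) h e /h[N _ hN].
by exists N => n Nn; apply: ltW; exact: hN.
Qed.

Lemma real_cvg1 (x : nat -> R) (u : nat -> R[i]) : (forall n, u n = (x n)%:C) ->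
  ((fun n => u n : R[i]^o) @ \oo --> (1 : R[i]^o)) <->
  forall e : R, 0 < e -> eventually_nat (fun n => `|x n - 1| <= e).
Proof.
move=> ux; have e1 n : cm (u n - 1) = `|x n - 1| by rewrite ux -cm_real rmorphB rmorph1.
split.
  by move=> /cvg_clim h e /h[N hN]; exists N => n /hN; rewrite e1.
move=> h; apply/(cvg_cmP eventually_filter) => e e0.
have [N hN] := h _ (divr_gt0 e0 (ltr0n R 2)).
by exists N => // n /= /hN; rewrite e1; lra.
Qed.

Lemma distortionE phi : `|cderive phi 0| / (1 - `|phi 0| ^+ 2) = (distortion phi)%:C.
Proof.
by rewrite !cmE /distortion rmorphM fmorphV rmorphB rmorph1 rmorphXn.
Qed.

Lemma pseudo_hyperbolicE z w : pseudo_hyperbolic z w = (rho z w)%:C.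
Proof. by rewrite /pseudo_hyperbolic cmE. Qed.

Lemma homo_comp (s t : nat -> nat) : {homo s : i j / (i < j)%N} ->
  {homo t : i j / (i < j)%N} -> {homo (fun n => s (t n)) : i j / (i < j)%N}.
Proof. by move=> hs ht i j /ht /hs. Qed.

(** After passing to subsequences, the values [q 0] of the normal forms and
    the positions of [f n 0] and [g n 0] relative to each other converge. The
    limits are unimodular, because distortions and [rho] tend to 1, so that
    [stage] applies. *)
Lemma stage_self_maps (f g : nat -> C -> C) (a b : C) :
  (forall n, self_map (f n)) -> (forall n, self_map (g n)) -> cm a = 1 -> cm b = 1 ->
  clim (fun n => f n 0) a -> clim (fun n => g n 0) b ->
  (forall e : R, 0 < e -> eventually_nat (fun n => `|distortion (f n) - 1| <= e)) ->
  (forall e : R, 0 < e -> eventually_nat (fun n => `|distortion (g n) - 1| <= e)) ->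
  (forall e : R, 0 < e -> eventually_nat (fun n => `|rho (f n 0) (g n 0) - 1| <= e)) ->
  forall X (del r eps : R) (G1 G2 : C -> C), punctured X -> 0 < del -> r < 1 -> 0 < eps ->
  schur G1 -> schur G2 ->
  exists n Y, [/\ punctured Y /\ Y != [::], defect Y <= del,
    forall z, cm z <= r -> cm (bprod (X ++ Y) (f n z) - G1 z) <= eps &
    forall z, cm z <= r -> cm (bprod (X ++ Y) (g n z) - G2 z) <= eps].
Proof.
move=> sf sg a1 b1 fa gb df dg rfg X del r eps G1 G2 pX del0 r1 eps0 sG1 sG2.
have o1 : cm (0 : C) < 1 by rewrite cm0.
have f1 n : cm (f n 0) < 1 := (sf n).2 0 o1.
have g1 n : cm (g n 0) < 1 := (sg n).2 0 o1.
have [q1 hq1] := choice (fun n => self_map_normal_form (sf n)).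
have [q2 hq2] := choice (fun n => self_map_normal_form (sg n)).
have q11 n : cm (q1 n 0) <= 1 by have [sq _ _] := hq1 n; exact: sq.2.
have q21 n : cm (q2 n 0) <= 1 by have [sq _ _] := hq2 n; exact: sq.2.
have [s1 [w1 [hs1 lw1]]] := bolzano_weierstrass_disc q11.
have [s2 [w2 [hs2 lw2]]] := bolzano_weierstrass_disc (fun n => q21 (s1 n)).
pose s12 n := s1 (s2 n).
have hs12 : {homo s12 : i j / (i < j)%N} := homo_comp hs1 hs2.
have m1 n : cm (mob (- f (s12 n) 0) (g (s12 n) 0)) <= 1 by rewrite ltW // mob_lt1 // cmN.
have [s3 [g1' [hs3 lg1]]] := bolzano_weierstrass_disc m1.
have m2 n : cm (mob (- g (s12 (s3 n)) 0) (f (s12 (s3 n)) 0)) <= 1 by rewrite ltW // mob_lt1 // cmN.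
have [s4 [g2' [hs4 lg2]]] := bolzano_weierstrass_disc m2.
have hs34 : {homo (fun n => s3 (s4 n)) : i j / (i < j)%N} := homo_comp hs3 hs4.
pose s n := s12 (s3 (s4 n)).
have hs : {homo s : i j / (i < j)%N} := homo_comp hs12 hs34.
have lw1' : clim (fun n => q1 (s n) 0) w1 := clim_subseq (clim_subseq lw1 hs2) hs34.
have lw2' : clim (fun n => q2 (s n) 0) w2 := clim_subseq lw2 hs34.
have lg1' : clim (fun n => mob (- f (s n) 0) (g (s n) 0)) g1' := clim_subseq lg1 hs4.
have lg2' : clim (fun n => mob (- g (s n) 0) (f (s n) 0)) g2' := lg2.
have w11 : cm w1 = 1.
  apply: (clim_cm1 lw1') => e /df /(eventually_subseq hs) [N hN].
  by exists N => n /hN; have [_ _ ->] := hq1 (s n).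
have w21 : cm w2 = 1.
  apply: (clim_cm1 lw2') => e /dg /(eventually_subseq hs) [N hN].
  by exists N => n /hN; have [_ _ ->] := hq2 (s n).
have g11 : cm g1' = 1.
  apply: (clim_cm1 lg1') => e /rfg /(eventually_subseq hs) [N hN].
  by exists N => n /hN; rewrite rho_mob.
have g21 : cm g2' = 1.
  apply: (clim_cm1 lg2') => e /rfg /(eventually_subseq hs) [N hN].
  by exists N => n /hN; rewrite rhoC rho_mob.
have sq1 n : schur (q1 (s n)) by have [] := hq1 (s n).
have sq2 n : schur (q2 (s n)) by have [] := hq2 (s n).
have [k [Y [pY dY h1 h2]]] := stage (fun n => f1 (s n)) (fun n => g1 (s n)) sq1 sq2
  (clim_subseq fa hs) (clim_subseq gb hs) lw1' lw2' lg1' lg2' a1 b1 w11 w21 g11 g21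
  pX del0 r1 eps0 sG1 sG2.
exists (s k), Y; split=> // z zr; have z1 := le_lt_trans zr r1.
- by have [_ -> // _] := hq1 (s k); exact: h1.
- by have [_ -> // _] := hq2 (s k); exact: h2.
Qed.

End SelfMaps.

(** * Construction of a universal Blaschke product *)

Section Construction.
Variable R : realType.
Local Notation C := R[i].

Lemma natSinv_gt0 (m : nat) : 0 < m.+1%:R^-1 :> R.
Proof. by rewrite invr_gt0. Qed.

Lemma natSinv_small (e : R) : 0 < e -> exists m : nat, m.+1%:R^-1 <= e.
Proof.
move=> e0; have [N _ hN] := near_infty_natSinv_lt (PosNum e0).
by exists N; apply: ltW; exact: (hN N (leqnn N)).
Qed.

(** A natural number encodes a precision and the codes of two targets. The
    [j]-th step adds zeros such that the product approximates the [j]-th pair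
    of targets along some [f n], [g n], and then lowers the total defect that
    is still available, so that no later zeros spoil this approximation. Any
    pair of functions shares its codes with some pair of targets. *)
Lemma universal_blaschke (f g : nat -> C -> C) :
  (forall n, self_map (f n)) -> (forall n, self_map (g n)) ->
  (forall X (del r eps : R) (G1 G2 : C -> C), punctured X -> 0 < del -> r < 1 -> 0 < eps ->
    schur G1 -> schur G2 ->
    exists n Y, [/\ punctured Y /\ Y != [::], defect Y <= del,
      forall z, cm z <= r -> cm (bprod (X ++ Y) (f n z) - G1 z) <= eps &
      forall z, cm z <= r -> cm (bprod (X ++ Y) (g n z) - G2 z) <= eps]) ->
  exists F, [/\ infinite_blaschke_product F, schur F &
    forall (G1 G2 : C -> C), schur G1 -> schur G2 -> forall r e : R, r < 1 -> 0 < e ->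
    exists n, forall z, cm z <= r ->
      cm (F (f n z) - G1 z) <= e /\ cm (F (g n z) - G2 z) <= e].
Proof.
move=> sf sg hstage.
have [rep [rep_schur rep_code]] := code_representative R.
pose target : Type := (nat * seq (int * int) * seq (int * int))%type.
pose dec (j : nat) : target := odflt (0%N, [::], [::]) (unpickle j).
pose m j := (dec j).1.1.
pose T1 j := rep (m j) (dec j).1.2; pose T2 j := rep (m j) (dec j).2.
pose eps j : R := (m j).+1%:R^-1.
have eps0 j : 0 < eps j by exact: natSinv_gt0.
(* The index [n] realizes the approximation, and [del] is so small that zeros
   of total defect [del] change the product by at most [eps j] on the disc of
   radius [r'], which contains the relevant values of [f n] and [g n]. *)
pose good j (X : seq C) (del : R) := exists n, (forall z, cm z <= 1 - eps j ->
    cm (bprod X (f n z) - T1 j z) <= eps j /\ cm (bprod X (g n z) - T2 j z) <= eps j) /\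
  exists r', [/\ r' < 1, forall z, cm z <= 1 - eps j -> cm (f n z) <= r' /\ cm (g n z) <= r' &
    2 / (1 - r') * del <= eps j].
(* A state consists of the zeros chosen so far and the total defect allowed
   for all later ones. *)
pose P (j : nat) (s : seq C * R) := punctured s.1 /\ 0 < s.2.
pose Q j (s t : seq C * R) := exists Y, [/\ t.1 = s.1 ++ Y /\ Y != [::],
  defect Y <= s.2 / 2, t.2 <= s.2 / 2 & good j t.1 t.2].
have P0 : P 0%N ([::], 1) by [].
have step j s : P j s -> exists2 t, Q j s t & P j.+1 t.
  case: s => X del [/= pX del0].
  have d2 : 0 < del / 2 by rewrite divr_gt0.
  have r1 : 1 - eps j < 1 by rewrite ltrBlDr ltrDl.
  have [n [Y [[pY Y0] dY h1 h2]]] := hstage X _ _ _ _ _ pX d2 r1 (eps0 j)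
    (rep_schur (m j) (dec j).1.2) (rep_schur (m j) (dec j).2).
  have [ra ra1 hra] := self_map_image_radius (sf n) r1.
  have [rb rb1 hrb] := self_map_image_radius (sg n) r1.
  pose r' := Num.max ra rb.
  have r'1 : r' < 1 by rewrite gt_max ra1 rb1.
  have k0 : 0 < 2 / (1 - r') by rewrite divr_gt0 // subr_gt0.
  have [del' [d'0 d'1 d'2]] : exists del', [/\ 0 < del', del' <= del / 2 & 2 / (1 - r') * del' <= eps j].
    exists (Num.min (del / 2) (eps j / (2 / (1 - r')))).
    rewrite lt_min d2 divr_gt0 // ge_min lexx; split=> //.
    by rewrite mulrC -ler_pdivlMr // ge_min lexx orbT.
  exists (X ++ Y, del').
    exists Y; split=> //=; exists n; split; first by move=> z zr; split; [exact: h1|exact: h2].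
    by exists r'; split=> // z zr; rewrite !le_max hra ?hrb // orbT.
  by split=> // x; rewrite mem_cat => /orP[/pX|/pY].
have [s [s0 hs]] := dependent_seq P0 step.
pose L j := (s j).1.
have Lgrow j : exists2 Y, L j.+1 = L j ++ Y & Y != [::].
  by have [_ [Y [[e Y0] _ _ _]]] := hs j; exists Y.
have Lp j : punctured (L j) by have [[]] := hs j.
(* One half of the allowance is spent by a step, and at most the other half is
   left for the later ones. *)
have budget i j : (i <= j)%N -> defect (L j) + (s j).2 <= defect (L i) + (s i).2.
  elim: j => [|j IH]; first by rewrite leqn0 => /eqP ->.
  rewrite leq_eqVlt => /orP[/eqP -> //|]; rewrite ltnS => /IH; apply: le_trans.
  have [_ [Y [[e _] dY dt _]]] := hs j.
  by rewrite /L e defect_cat; lra.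
have s_ge0 j : 0 < (s j).2 by have [[]] := hs j.
have Ldef j : defect (L j) <= defect (L 0%N) + (s 0%N).2.
  by have := budget 0%N j (leq0n j); have := s_ge0 j; lra.
have [F [bF sF hF]] := infinite_blaschke_exists Lgrow Lp Ldef.
exists F; split=> // G1 G2 sG1 sG2 r e r1 e0.
(* Three errors of size at most [eps j]: the later zeros, the approximation of
   the target, and its distance to the given function. *)
have me0 : 0 < Num.min (1 - r) (e / 3) by rewrite lt_min subr_gt0 r1 divr_gt0.
have [M hM] := natSinv_small me0.
move: hM; rewrite le_min => /andP[M1 M2].
pose j := pickle ((M, code M G1, code M G2) : target).
have decj : dec j = (M, code M G1, code M G2) by rewrite /dec pickleK.
have [_ [Y [_ _ _ [n [hn [r' [r'1 hr' hd]]]]]]] := hs j.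
exists n => z zr.
have epsj : eps j = M.+1%:R^-1 by rewrite /eps /m decj.
have zr' : cm z <= 1 - eps j by rewrite epsj lerBrDr -lerBrDl; apply: le_trans M1 _; rewrite lerB.
have [h1 h2] := hn z zr'; have [i1 i2] := hr' z zr'.
have tail i : (j.+1 <= i)%N -> defect (L i) - defect (L j.+1) <= (s j.+1).2.
  by move=> /budget; have := s_ge0 i; lra.
have F1 := hF j.+1 r' (f n z) _ r'1 i1 tail.
have F2 := hF j.+1 r' (g n z) _ r'1 i2 tail.
have c1 : cm (T1 j z - G1 z) <= eps j.
  rewrite /T1 /m decj /= epsj; rewrite epsj in zr'.
  by apply: code_close zr' => //; exact: rep_code.
have c2 : cm (T2 j z - G2 z) <= eps j.
  rewrite /T2 /m decj /= epsj; rewrite epsj in zr'.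
  by apply: code_close zr' => //; exact: rep_code.
have e3 : eps j <= e / 3 by rewrite epsj.
rewrite -/(L j.+1) in h1 h2.
split.
  have := cm_tri (bprod (L j.+1) (f n z)) (F (f n z)) (G1 z).
  have := cm_tri (T1 j z) (bprod (L j.+1) (f n z)) (G1 z); lra.
have := cm_tri (bprod (L j.+1) (g n z)) (F (g n z)) (G2 z).
have := cm_tri (T2 j z) (bprod (L j.+1) (g n z)) (G2 z); lra.
Qed.

End Construction.

(** * Necessity of the conditions on the self-maps *)

Section Necessity.
Variable R : realType.
Local Notation C := R[i].
Implicit Types (f phi : C -> C) (t : R).

Let half : C := (2^-1 : R)%:C.

Lemma cm_half : cm half = 2^-1.
Proof. by rewrite cm_real ger0_norm // invr_ge0. Qed.

(** The automorphism [mob t%:C] preserves the pseudo-hyperbolic distance of 0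
    and [half]. If [f \o phi] is close to it at these two points, then by
    Schwarz-Pick [phi] cannot contract this distance, which means that [q
    half] is close to the circle in the normal form of [phi]; by
    [schur_close0] so is [q 0]. The number [D] depends on [t] only and can be
    fixed before [e]. *)
Lemma distortion_lower_bound f phi t (e : R) : schur f -> self_map phi -> 0 <= t < 1 ->
  let D := cm (1 - (mob t%:C 0)^* * mob t%:C half) in
  cm (f (phi 0) - mob t%:C 0) <= e -> cm (f (phi half) - mob t%:C half) <= e ->
  0 < D /\ (1 - distortion phi) * D <= 30 * e.
Proof.
move=> sf sphi /andP[t0 t1] D.
have h1 : cm half < 1 by rewrite cm_half invf_lt1 ?ltr1n.
have o1 : cm (0 : C) < 1 by rewrite cm0.
have ct1 : cm (t%:C : C) < 1 by rewrite cm_real ger0_norm.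
have [q [sq phiE <-]] := self_map_normal_form sphi.
set A0 := f (phi 0); set A1 := f (phi half).
set B0 := mob t%:C 0 in D *; set B1 := mob t%:C half in D *.
move=> e0 e1.
have b0 : cm B0 < 1 by exact: mob_lt1. have b1 : cm B1 < 1 by exact: mob_lt1.
have D0 : 0 < D.
  rewrite cm_gt0; have := mob_den (cmN_lt1 b0) (ltW b1).
  by rewrite rmorphN mulNr.
split=> //.
have BB : cm (B1 - B0) = D / 2.
  have d0 := mob_den ct1 (ltW h1); rewrite conj_real in d0.
  have -> : B1 - B0 = half * (1 - B0^* * B1).
    rewrite /B1 /B0 mob0 /mob conj_real.
    by move: half d0 => h' d0; field.
  by rewrite cmM cm_half mulrC.
have p0 := sphi.2 0 o1; have p1 := sphi.2 half h1.
have sp := schwarz_pick sf p1 p0; rewrite -/A0 -/A1 in sp.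
have den := mob_den (cmN_lt1 p0) (ltW p1); rewrite rmorphN mulNr in den.
have s1 := sq.2 half h1.
have sigma : cm (phi half - phi 0) = 2^-1 * cm (q half) * cm (1 - (phi 0)^* * phi half).
  have hq : cm (half * q half) < 1.
    by rewrite cmM cm_half; apply: le_lt_trans (_ : 2^-1 < 1); [rewrite ler_piMr ?invr_ge0|rewrite invf_lt1 ?ltr1n].
  have := mobK p0 (ltW hq); rewrite -phiE // => /(congr1 (@cm R)).
  rewrite cmM cm_half /mob rmorphN mulNr cm_div => <-.
  by rewrite divfK // cm_eq0.
have key : cm (A1 - A0) <= 2^-1 * cm (q half) * cm (1 - A0^* * A1).
  rewrite -(ler_pM2r (x := cm (1 - (phi 0)^* * phi half))) ?cm_gt0 //.
  by apply: le_trans sp _; rewrite sigma mulrAC.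
have a0 : cm A0 <= 1 by apply: sf.2. have a1 : cm A1 <= 1 by apply: sf.2.
have dprod : cm (1 - A0^* * A1) <= D + 2 * e.
  have a0c : cm A0^* <= 1 by rewrite cmJ.
  have := cm_prod_diff B0^* A1 a0c (ltW b1).
  rewrite -rmorphB cmJ => hp.
  have -> : 1 - A0^* * A1 = (1 - B0^* * B1) - (A0^* * A1 - B0^* * B1) by ring.
  by apply: le_trans (cmDB _ _) _; rewrite -/D; lra.
have low : D / 2 - 2 * e <= cm (A1 - A0).
  have := cm_tri A1 B1 B0; have := cm_tri A0 A1 B0; rewrite [cm (B1 - A1)]cmB BB; lra.
have c0 := cm_ge0 (q half).
have up : 2^-1 * cm (q half) * cm (1 - A0^* * A1) <= 2^-1 * cm (q half) * (D + 2 * e).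
  by rewrite ler_wpM2l // mulr_ge0 // invr_ge0.
have e00 : 0 <= e by apply: le_trans e0; exact: cm_ge0.
have qe : cm (q half) * e <= e by rewrite ler_piMl.
have gap : (1 - cm (q half)) * D <= 6 * e.
  have : 2^-1 * cm (q half) * (D + 2 * e) = cm (q half) * D / 2 + cm (q half) * e by field.
  by rewrite mulrBl mul1r; lra.
have hl : 2^-1 < 1 :> R by rewrite invf_lt1 ?ltr1n.
have hh : cm half <= 2^-1 by rewrite cm_half.
have [_ cl] := schur_close0 sq hl hh.
have e2 : 1 - 2^-1 = 2^-1 :> R by lra.
have e4 : 2 * 2 = 4 :> R by rewrite -natrM.
rewrite e2 invrK e4 in cl.
have : 1 - cm (q 0) <= 5 * (1 - cm (q half)) by have := cmBD (q half) (q 0); lra.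
by move=> /(ler_wpM2r (ltW D0)); lra.
Qed.

(** By Schwarz-Pick [f] cannot increase the pseudo-hyperbolic distance, and
    that of 0 and [t%:C] is [t]. *)
Lemma rho_lower_bound f z w t (e : R) : schur f -> cm z < 1 -> cm w < 1 -> 0 <= t ->
  cm (f z) <= e -> cm (f w - t%:C) <= e -> t - 3 * e <= rho z w.
Proof.
move=> sf z1 w1 t0 h1 h2.
have sp := schwarz_pick sf z1 w1.
have den := mob_den (cmN_lt1 w1) (ltW z1); rewrite rmorphN mulNr in den.
have r1 : rho z w < 1 by exact: rho_lt1.
have r0 : 0 <= rho z w by exact: cm_ge0.
have key : cm (f z - f w) <= rho z w * cm (1 - (f w)^* * f z).
  rewrite rhoC /rho cm_div [cm (w - z)]cmB mulrAC ler_pdivlMr ?cm_gt0 //.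
have up : cm (1 - (f w)^* * f z) <= 1 + e.
  apply: le_trans (cmDB _ _) _; rewrite cm1 cmM cmJ lerD2l.
  by apply: le_trans h1; rewrite ler_piMl ?cm_ge0 ?(sf.2 w w1).
have e0 : 0 <= e := le_trans (cm_ge0 _) h1.
have : rho z w * cm (1 - (f w)^* * f z) <= rho z w * (1 + e) by rewrite ler_wpM2l.
have : rho z w * e <= e by rewrite ler_piMl // ltW.
have ct : cm (t%:C : C) = t by rewrite cm_real ger0_norm.
have := cmBD (f w) (f z); have := cmBD t%:C (f w); rewrite ct ![cm (_ - f w)]cmB.
by rewrite [cm (f w - f z)]cmB; lra.
Qed.

(** Approximate the identity [mob 0] along [phi1] and [mob t%:C], with [t]
    close to 1, along [phi2], at the points 0 and [half] only. Both targets
    are automorphisms, which controls the distortions; their values at 0 are 0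
    and [t], which controls [rho]. *)
Lemma extremal_indices f (phi1 phi2 : nat -> C -> C) :
  (forall n, self_map (phi1 n)) -> (forall n, self_map (phi2 n)) -> schur f ->
  (forall G1 G2 : C -> C, schur G1 -> schur G2 ->
    forall (s : seq C) (e : R), 0 < e -> (forall z, z \in s -> cm z < 1) ->
    exists n, forall z, z \in s ->
      cm (f (phi1 n z) - G1 z) < e /\ cm (f (phi2 n z) - G2 z) < e) ->
  forall (eta : R) N, 0 < eta -> exists2 n, (N <= n)%N &
    [/\ 1 - eta <= distortion (phi1 n), 1 - eta <= distortion (phi2 n) &
        1 - eta <= rho (phi1 n 0) (phi2 n 0)].
Proof.
move=> sp1 sp2 sf approx eta N eta0.
have o1 : cm (0 : C) < 1 by rewrite cm0.
have h1 : cm half < 1 by rewrite cm_half invf_lt1 ?ltr1n.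
have rlt n : rho (phi1 n 0) (phi2 n 0) < 1 by apply: rho_lt1; [exact: (sp1 n).2|exact: (sp2 n).2].
(* Below every [1 - rho (phi1 n 0) (phi2 n 0)] with [n < N], so that the index
   found below is at least [N]. *)
have [eta' [e'0 e'1 e'2 e'N]] : exists eta' : R, [/\ 0 < eta', eta' <= eta, eta' <= 1 &
    forall n, (n < N)%N -> eta' < 1 - rho (phi1 n 0) (phi2 n 0)].
  elim: N => [|N [x [x0 x1 x2 xN]]].
    by exists (Num.min eta 1); rewrite lt_min eta0 ltr01 !ge_min !lexx orbT.
  have d0 : 0 < (1 - rho (phi1 N 0) (phi2 N 0)) / 2 by rewrite divr_gt0 // subr_gt0.
  exists (Num.min x ((1 - rho (phi1 N 0) (phi2 N 0)) / 2)).
  rewrite lt_min x0 d0 !ge_min x1 x2; split=> // n; rewrite ltnS leq_eqVlt => /orP[/eqP ->|/xN xn].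
    by rewrite gt_min; apply/orP; right; lra.
  by rewrite gt_min xn.
pose t := 1 - eta' / 4.
have t01 : 0 <= t < 1 by rewrite /t; lra.
have z01 : (fun s : R => 0 <= s < 1) 0 by rewrite lexx ltr01.
have ct1 : cm (t%:C : C) < 1 by rewrite cm_real ger0_norm; lra.
pose D := cm (1 - (mob t%:C 0)^* * mob t%:C half).
have D0 : 0 < D.
  have b0 : cm (mob t%:C 0) < 1 by exact: mob_lt1.
  have b1 : cm (mob t%:C half) < 1 by exact: mob_lt1.
  by rewrite cm_gt0; have := mob_den (cmN_lt1 b0) (ltW b1); rewrite rmorphN mulNr.
have D1 : 1 = cm (1 - (mob 0%:C 0)^* * mob 0%:C half).
  by rewrite mob0 conjC0 mul0r subr0 cm1.
have [e [e0 e1 e2]] : exists e : R, [/\ 0 < e, 30 * e <= eta' & 30 * e <= eta' * D].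
  exists (Num.min (eta' / 30) (eta' * D / 30)).
  rewrite lt_min !divr_gt0 ?mulr_gt0 //; split=> //.
    by rewrite mulrC -ler_pdivlMr // ge_min lexx.
  by rewrite mulrC -ler_pdivlMr // ge_min lexx orbT.
have c01 : cm (0%:C : C) < 1 by rewrite cm0.
have [|n hn] := approx (mob 0%:C) (mob t%:C) (schur_mob c01) (schur_mob ct1) [:: 0; half] e e0.
  by move=> z; rewrite !inE => /orP[] /eqP ->.
have [a1 a2] := hn 0 (mem_head _ _).
have hin : half \in [:: 0; half] by rewrite !inE eqxx orbT.
have [a3 a4] := hn half hin.
have [_ b1] := distortion_lower_bound sf (sp1 n) z01 (ltW a1) (ltW a3).
have [_ b2] := distortion_lower_bound sf (sp2 n) t01 (ltW a2) (ltW a4).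
have d1 : 1 - eta' <= distortion (phi1 n) by rewrite -D1 mulr1 in b1; lra.
have d2 : 1 - eta' <= distortion (phi2 n).
  have : (1 - distortion (phi2 n)) * D <= eta' * D by apply: le_trans b2 e2.
  by rewrite ler_pM2r //; lra.
rewrite !mob0 in a1 a2; rewrite subr0 in a1.
have t0 : 0 <= t by case/andP: t01.
have b3 := rho_lower_bound sf ((sp1 n).2 0 o1) ((sp2 n).2 0 o1) t0 (ltW a1) (ltW a2).
have r1 : 1 - eta' <= rho (phi1 n 0) (phi2 n 0) by move: b3; rewrite /t; lra.
exists n; last by split; [apply: le_trans d1|apply: le_trans d2|apply: le_trans r1]; rewrite lerB.
by rewrite leqNgt; apply/negP => /e'N; apply/negP; rewrite -leNgt lerBlDr addrC -lerBlDr.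
Qed.

Lemma extremal_subsequence f (phi1 phi2 : nat -> C -> C) :
  (forall n, self_map (phi1 n)) -> (forall n, self_map (phi2 n)) -> schur f ->
  (forall G1 G2 : C -> C, schur G1 -> schur G2 ->
    forall (s : seq C) (e : R), 0 < e -> (forall z, z \in s -> cm z < 1) ->
    exists n, forall z, z \in s ->
      cm (f (phi1 n z) - G1 z) < e /\ cm (f (phi2 n z) - G2 z) < e) ->
  exists nk, {homo nk : i j / (i < j)%N} /\ forall e : R, 0 < e -> [/\
    eventually_nat (fun k => `|distortion (phi1 (nk k)) - 1| <= e),
    eventually_nat (fun k => `|distortion (phi2 (nk k)) - 1| <= e) &
    eventually_nat (fun k => `|rho (phi1 (nk k) 0) (phi2 (nk k) 0) - 1| <= e)].
Proof.
move=> sp1 sp2 sf approx.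
have [nk [hnk hP]] := extract_subseq (fun k N =>
  extremal_indices sp1 sp2 sf approx N (natSinv_gt0 R k)).
exists nk; split=> // e e0; have [N _ hN] := near_infty_natSinv_lt (PosNum e0).
have key (x : nat -> R) : (forall k, 1 - k.+1%:R^-1 <= x k) -> (forall k, x k <= 1) ->
    eventually_nat (fun k => `|x k - 1| <= e).
  move=> l u; exists N => k Nk.
  have kN : k.+1%:R^-1 <= e := ltW (hN k Nk).
  rewrite ler_norml; have := l k; have := u k; move: (k.+1%:R^-1) kN => y; lra.
split; apply: key => k.
- by case: (hP k).
- exact: distortion_le1.
- by case: (hP k).
- exact: distortion_le1.
- by case: (hP k).
- have o1 : cm (0 : C) < 1 by rewrite cm0.
  by apply: ltW; apply: rho_lt1; [exact: (sp1 _).2|exact: (sp2 _).2].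
Qed.

End Necessity.

(** * The equivalence *)

Theorem theorem3p2 (R : realType) (phi1 phi2 : nat -> R[i] -> R[i])
    (a b : R[i])
    (hphi1 : forall n : nat, holomorphic_self_map (phi1 n))
    (hphi2 : forall n : nat, holomorphic_self_map (phi2 n))
    (ha : unit_circle a) (hb : unit_circle b)
    (hphi1a : (fun n : nat => phi1 n 0) @ \oo --> (a : R[i]^o))
    (hphi2b : (fun n : nat => phi2 n 0) @ \oo --> (b : R[i]^o)) :
  [<-> (* (1) *)
       exists f : disc_fun R, disjointly_universal phi1 phi2 f;
       (* (2) *)
       exists f : disc_fun R,
         blaschke_product f /\ disjointly_universal phi1 phi2 f;
       (* (3) *)
       exists nk : nat -> nat,
         [/\ {homo nk : i j / (i < j)%N},
             (fun k : nat => `|cderive (phi1 (nk k)) 0|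
                             / (1 - `|phi1 (nk k) 0| ^+ 2))
               @ \oo --> (1 : R[i]^o),
             (fun k : nat => `|cderive (phi2 (nk k)) 0|
                             / (1 - `|phi2 (nk k) 0| ^+ 2))
               @ \oo --> (1 : R[i]^o)
           & (fun k : nat => pseudo_hyperbolic (phi1 (nk k) 0) (phi2 (nk k) 0))
               @ \oo --> (1 : R[i]^o)]].
Proof.
have sp1 n : self_map (phi1 n) := self_map_hol (hphi1 n).
have sp2 n : self_map (phi2 n) := self_map_hol (hphi2 n).
move/unit_circleE: ha => a1; move/unit_circleE: hb => b1.
have la := cvg_clim hphi1a; have lb := cvg_clim hphi2b.
set Q1 := exists f, _; set Q2 := exists f, _ /\ _; set Q3 := exists nk, _.
have h13 : Q1 -> Q3.
  move=> [f /approx_of_universal[sf approx]].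
  have [nk [hnk hlim]] := extremal_subsequence sp1 sp2 sf approx.
  exists nk; split; first exact: hnk.
  - apply/(real_cvg1 (fun k => distortionE (phi1 (nk k)))) => e e0.
    by case: (hlim e e0).
  - apply/(real_cvg1 (fun k => distortionE (phi2 (nk k)))) => e e0.
    by case: (hlim e e0).
  - apply/(real_cvg1 (fun k => pseudo_hyperbolicE (phi1 (nk k) 0) (phi2 (nk k) 0))) => e e0.
    by case: (hlim e e0).
have h32 : Q3 -> Q2.
  move=> [nk [hnk /(real_cvg1 (fun k => distortionE (phi1 (nk k)))) d1
    /(real_cvg1 (fun k => distortionE (phi2 (nk k)))) d2
    /(real_cvg1 (fun k => pseudo_hyperbolicE (phi1 (nk k) 0) (phi2 (nk k) 0))) d3]].
  have stg := stage_self_maps (fun k => sp1 (nk k)) (fun k => sp2 (nk k)) a1 b1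
    (clim_subseq la hnk) (clim_subseq lb hnk) d1 d2 d3.
  have [F [bF sF hF]] := universal_blaschke (fun k => sp1 (nk k)) (fun k => sp2 (nk k)) stg.
  exists F; split; first by right.
  apply: (universal_of_approx hphi1 hphi2 sF) => G1 G2 s1 s2 r e r1 e0.
  by have [n hn] := hF G1 G2 s1 s2 r e r1 e0; exists (nk n).
have h21 : Q2 -> Q1 by move=> [f [_ uf]]; exists f.
by split; [move=> /h13 /h32|split=> [/h21 /h13|/h32 /h21]].
Qed.
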